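(* Let $0\to B\to E\xrightarrow{p}A\to 0$ be an extension of separable $C^*$-algebras with $B$ stable. Suppose that there exist a separable $C^*$-algebra $D$ and an element $x\in A\odot D$ such that $\|x\|_E>\|x\|_\lambda$. Then the extension is not semi-invertible.
   Context: $A\odot D$ is the algebraic tensor product. $B$ stable means $B\otimes\mathcal K\cong B$, with $\mathcal K$ the compact operators on a separable infinite-dimensional Hilbert space. $L(H)$ is the algebra of bounded operators on a Hilbert space $H$. Asymptotic homomorphisms. An asymptotic homomorphism $\mu=(\mu_t)_{t\in[0,\infty)}:A\to B$ between $C^*$-algebras is (in the sense of Connes and Higson) a family of maps $\mu_t:A\to B$ such that $t\mapsto\mu_t(a)$ is continuous for each $a\in A$ and, for all $a,b\in A$, $\alpha\in\mathbb C$, the norms of $\mu_t(ab)-\mu_t(a)\mu_t(b)$, $\mu_t(a+\alpha b)-\mu_t(a)-\alpha\mu_t(b)$ and $\mu_t(a^* )-\mu_t(a)^*$ tend to $0$ as $t\to\infty$. An asymptotic representation of $A$ on $H$ is an asymptotic homomorphism $A\to L(H)$. The norm $\|\cdot\|_\lambda$. Given separable Hilbert spaces $H_1,H_2$, an asymptotic representation $\mu:A\to L(H_1)$ and a genuine representation ($*$-homomorphism) $\nu:D\to L(H_2)$, define the $*$-homomorphism $\mu\odot\nu: A\odot D\to C_b([0,\infty),L(H_1\otimes H_2))/C_0([0,\infty),L(H_1\otimes H_2))$ by sending $\sum_i a_i\odot d_i$ to the class of $t\mapsto\sum_i\mu_t(a_i)\otimes\nu(d_i)$. The left asymptotic tensor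 norm is $\|x\|_\lambda=\sup_{\mu,\nu}\|\mu\odot\nu(x)\|$, the supremum being over all such $\mu$ and $\nu$. The norm $\|\cdot\|_E$. $B\otimes_{\min}D$ is an ideal of $E\otimes_{\min}D$, and $A\odot D=(E\odot D)/(B\odot D)$ embeds in the quotient $E\otimes_{\min}D/B\otimes_{\min}D$; $\|\cdot\|_E$ is the $C^*$-norm on $A\odot D$ obtained by restricting the quotient norm. Extensions. The direct sum of two extensions of $A$ by the stable algebra $B$ with Busby invariants $\tau,\tau':A\to M(B)/B$ ($M(B)$ the multiplier algebra) is the extension with Busby invariant $\tau\oplus\tau':A\to M_2(M(B)/B)\cong M(B)/B$, the last isomorphism being induced by a fixed isomorphism $M_2(B)\cong B$. An extension $0\to B\to E\xrightarrow{p}A\to0$ is asymptotically split if there is an asymptotic homomorphism $(s_t)_{t\in[0,\infty)}:A\to E$ with $p\circ s_t=\mathrm{id}_A$ for every $t$. It is semi-invertible if there is an extension $0\to B\to E'\to A\to0$ such that the direct sum of the two extensions is asymptotically split. *)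

(* Defs.v *)
From HB Require Import structures.
From mathcomp Require Import all_boot all_order all_algebra.
From mathcomp Require Import generic_quotient complex.
From mathcomp Require Import all_classical all_reals.
From mathcomp Require Import ereal topology normedtype.
From mathcomp Require Import ring lra.

Set Implicit Arguments.
Unset Strict Implicit.
Unset Printing Implicit Defensive.

Import Order.TTheory GRing.Theory Num.Theory.
Import numFieldNormedType.Exports.

Local Open Scope classical_set_scope.
Local Open Scope ring_scope.

Reserved Notation "a ** b" (at level 40, left associativity).

HB.mixin Record CompleteNormedModule_isCStarAlgebra (R : realType) A
    of CompleteNormedModule R[i] A := {
  amul : A -> A -> A;
  star : A -> A;
  amulA : associative amul;
  amulDl : left_distributive amul +%R;
  amulDr : right_distributive amul +%R;
  amulZl : forall (c : R[i]) (a b : A), amul (c *: a) b = c *: amul a b;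
  amulZr : forall (c : R[i]) (a b : A), amul a (c *: b) = c *: amul a b;
  starK : involutive star;
  starD : forall a b : A, star (a + b) = star a + star b;
  starZ : forall (c : R[i]) (a : A), star (c *: a) = conjc c *: star a;
  starM : forall a b : A, star (amul a b) = amul (star b) (star a);
  norm_amul : forall a b : A, `|amul a b| <= `|a| * `|b|;
  norm_star_amul : forall a : A, `|amul (star a) a| = `|a| ^+ 2
}.

(* Complex C*-algebras, not necessarily unital. *)
#[short(type="cstarAlgType")]
HB.structure Definition CStarAlgebra (R : realType) :=
  {A of CompleteNormedModule R[i] A & CompleteNormedModule_isCStarAlgebra R A}.

Notation "a ** b" := (amul a b) : ring_scope.

HB.mixin Record CompleteNormedModule_isHilbert (R : realType) H
    of CompleteNormedModule R[i] H := {
  inner : H -> H -> R[i];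
  innerDZl : forall (c : R[i]) (x y z : H),
    inner (c *: x + y) z = c * inner x z + inner y z;
  inner_conj : forall x y : H, inner y x = conjc (inner x y);
  norm_inner : forall x : H, `|x| ^+ 2 = inner x x
}.

#[short(type="hilbertType")]
HB.structure Definition Hilbert (R : realType) :=
  {H of CompleteNormedModule R[i] H & CompleteNormedModule_isHilbert R H}.


Section norm.
Variables (R : realType) (V : normedModType R[i]).
Implicit Types u v w : V.

(* The norms of the library take values in R[i]; [nrm] is the real-valued one. *)
Definition nrm v : R := complex.Re `|v|.

Lemma nrmE v : `|v| = (nrm v)%:C%C.
Proof. by rewrite /nrm RRe_real // ger0_real. Qed.

Lemma nrm_ge0 v : 0 <= nrm v.
Proof. by rewrite -ler0c -nrmE. Qed.

Lemma nrm0 : nrm 0 = 0. Proof. by rewrite /nrm normr0. Qed.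

Lemma nrm0_eq0 v : nrm v = 0 -> v = 0.
Proof. by move=> v0; apply/eqP; rewrite -normr_eq0 nrmE v0. Qed.

Lemma nrmN v : nrm (- v) = nrm v. Proof. by rewrite /nrm normrN. Qed.

Lemma nrmB v w : nrm (v - w) = nrm (w - v).
Proof. by rewrite -opprB nrmN. Qed.

Lemma nrmD v w : nrm (v + w) <= nrm v + nrm w.
Proof. by rewrite -lecR rmorphD /= -!nrmE ler_normD. Qed.

Lemma nrmZ (c : R[i]) v : nrm (c *: v) = complex.Re `|c| * nrm v.
Proof. by apply: complexI; rewrite rmorphM /= -!nrmE normrZ. Qed.

Lemma cvg_nrmP {T} (F : set_system T) {FF : Filter F} (f : T -> V) l :
  (f @ F --> l) <->
  (forall e : R, 0 < e -> \forall x \near F, nrm (l - f x) < e).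
Proof.
split.
  move=> /cvgrPdist_lt fl e e0; have := fl e%:C%C; rewrite ltcR => /(_ e0).
  by apply: filterS => x; rewrite nrmE ltcR.
move=> fl; apply/cvgrPdist_lt => e e0.
have eR : e = (complex.Re e)%:C%C by rewrite RRe_real // gtr0_real.
have /fl : 0 < complex.Re e by rewrite -ltcR -eR.
by apply: filterS => x xl; rewrite nrmE eR ltcR.
Qed.

Lemma ball_nrmE (v : V) (e : R) : ball v e%:C%C = [set w | nrm (v - w) < e].
Proof. by rewrite -ball_normE /=; apply/seteqP; split => w /=; rewrite nrmE ltcR. Qed.

Lemma cauchy_nrmP (F : set_system V) {FF : ProperFilter F} :
  cauchy F <->
  (forall e : R, 0 < e -> exists v, F [set w | nrm (v - w) < e]).
Proof.
split.
  move=> /cauchyP Fc e e0.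
  have [|v] := Fc e%:C%C; first by rewrite ltcR.
  by rewrite /= ball_nrmE => Fv; exists v.
move=> Fc; apply/cauchyP => e e0.
have eR : e = (complex.Re e)%:C%C by rewrite RRe_real // gtr0_real.
have /Fc[v Fv] : 0 < complex.Re e by rewrite -ltcR -eR.
by exists v; rewrite /= eR ball_nrmE.
Qed.

End norm.

Section bop.
Variables (R : realType) (H : completeNormedModType R[i]).

(* [bop H] is the algebra L(H) of bounded operators. *)
Record bop := Bop {
  bop_fun :> H -> H;
  bop_linear : linear bop_fun;
  bop_bounded : exists k : R, forall x, nrm (bop_fun x) <= k * nrm x
}.

Lemma bopP (S T : bop) : S =1 T -> S = T.
Proof.
case: S T => [S Sl Sb] [T Tl Tb] /= /funext ST; case: _ / ST in Tl Tb *.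
by congr Bop; exact: Prop_irrelevance.
Qed.

HB.instance Definition _ := gen_eqMixin bop.
HB.instance Definition _ := gen_choiceMixin bop.

Implicit Types S T : bop.

Lemma bopDl T : {morph T : x y / x + y}.
Proof. by move=> x y; have := bop_linear T 1 x y; rewrite !scale1r. Qed.

Lemma bop0 T : T 0 = 0.
Proof. by have /eqP := bopDl T 0 0; rewrite addr0 -subr_eq0 opprD addNKr oppr_eq0 => /eqP. Qed.

Lemma bopZl T c x : T (c *: x) = c *: T x.
Proof. by have := bop_linear T c x 0; rewrite !addr0 bop0 addr0. Qed.

Lemma bopN T x : T (- x) = - T x.
Proof. by rewrite -scaleN1r bopZl scaleN1r. Qed.

Lemma bopB T : {morph T : x y / x - y}.
Proof. by move=> x y; rewrite bopDl bopN. Qed.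

Lemma bop_bounded0 T : exists2 k : R, 0 <= k & forall x, nrm (T x) <= k * nrm x.
Proof.
have [k kT] := bop_bounded T; exists (Num.max k 0); first by rewrite le_max lexx orbT.
by move=> x; rewrite (le_trans (kT x)) // ler_wpM2r ?nrm_ge0 // le_max lexx.
Qed.

Let zero_linear : linear (fun _ : H => 0 : H).
Proof. by move=> c x y; rewrite scaler0 addr0. Qed.
Let zero_bounded : exists k : R, forall x : H, nrm (0 : H) <= k * nrm x.
Proof. by exists 0 => x; rewrite nrm0 mul0r. Qed.
Definition bop_zero := Bop zero_linear zero_bounded.

Let opp_linear T : linear (fun x => - T x).
Proof. by move=> c x y; rewrite bop_linear opprD scalerN. Qed.
Let opp_bounded T : exists k : R, forall x : H, nrm (- T x) <= k * nrm x.
Proof. by have [k kT] := bop_bounded T; exists k => x; rewrite nrmN. Qed.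
Definition bop_opp T := Bop (opp_linear T) (opp_bounded T).

Let add_linear S T : linear (fun x => S x + T x).
Proof. by move=> c x y; rewrite !bop_linear addrACA scalerDr. Qed.
Let add_bounded S T : exists k : R, forall x : H, nrm (S x + T x) <= k * nrm x.
Proof.
have [k kS] := bop_bounded S; have [l lT] := bop_bounded T.
by exists (k + l) => x; rewrite (le_trans (nrmD _ _)) // mulrDl lerD.
Qed.
Definition bop_add S T := Bop (add_linear S T) (add_bounded S T).

Let scale_linear (c : R[i]) T : linear (fun x => c *: T x).
Proof. by move=> d x y; rewrite bop_linear scalerDr !scalerA mulrC. Qed.
Let scale_bounded (c : R[i]) T :
  exists k : R, forall x : H, nrm (c *: T x) <= k * nrm x.
Proof.
have [k kT] := bop_bounded T; exists (complex.Re `|c| * k) => x.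
rewrite nrmZ -mulrA ler_wpM2l // -ler0c RRe_real ?ger0_real //.
Qed.
Definition bop_scale c T := Bop (scale_linear c T) (scale_bounded c T).

Let comp_linear S T : linear (fun x => S (T x)).
Proof. by move=> c x y; rewrite !bop_linear. Qed.
Let comp_bounded S T : exists k : R, forall x : H, nrm (S (T x)) <= k * nrm x.
Proof.
have [k k0 kS] := bop_bounded0 S; have [l lT] := bop_bounded T.
exists (k * l) => x; rewrite (le_trans (kS _)) // -mulrA ler_wpM2l //.
Qed.
Definition bop_comp S T := Bop (comp_linear S T) (comp_bounded S T).

Let bop_addA : associative bop_add.
Proof. by move=> S T U; apply/bopP => x /=; rewrite addrA. Qed.
Let bop_addC : commutative bop_add.
Proof. by move=> S T; apply/bopP => x /=; rewrite addrC. Qed.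
Let bop_add0 : left_id bop_zero bop_add.
Proof. by move=> S; apply/bopP => x /=; rewrite add0r. Qed.
Let bop_addN : left_inverse bop_zero bop_opp bop_add.
Proof. by move=> S; apply/bopP => x /=; rewrite addNr. Qed.

HB.instance Definition _ :=
  GRing.isZmodule.Build bop bop_addA bop_addC bop_add0 bop_addN.

Let bop_scaleA c d T : bop_scale c (bop_scale d T) = bop_scale (c * d) T.
Proof. by apply/bopP => x /=; rewrite scalerA. Qed.
Let bop_scale1 : left_id 1 bop_scale.
Proof. by move=> T; apply/bopP => x /=; rewrite scale1r. Qed.
Let bop_scaleDr : right_distributive bop_scale +%R.
Proof. by move=> c S T; apply/bopP => x /=; rewrite scalerDr. Qed.
Let bop_scaleDl T : {morph bop_scale^~ T : c d / c + d}.
Proof. by move=> c d; apply/bopP => x /=; rewrite scalerDl. Qed.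

HB.instance Definition _ := GRing.Zmodule_isLmodule.Build R[i] bop
  bop_scaleA bop_scale1 bop_scaleDr bop_scaleDl.

Definition opnorm T : R := sup [set nrm (T x) | x in [set x | nrm x <= 1]].

Let opnorm_has_sup T : has_sup [set nrm (T x) | x in [set x | nrm x <= 1]].
Proof.
split; first by exists (nrm (T 0)), 0 => //=; rewrite nrm0.
have [k k0 kT] := bop_bounded0 T; exists k => _ [x /= x1 <-].
by rewrite (le_trans (kT x)) // ler_piMr.
Qed.

Lemma opnorm_ge0 T : 0 <= opnorm T.
Proof.
rewrite (le_trans (nrm_ge0 (T 0))) //; apply: sup_ubound.
  by case: (opnorm_has_sup T).
by exists 0 => //=; rewrite nrm0.
Qed.

Lemma le_opnorm T x : nrm (T x) <= opnorm T * nrm x.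
Proof.
have [->|x0] := eqVneq x 0; first by rewrite bop0 nrm0 mulr0.
have nx0 : 0 < nrm x.
  by rewrite lt_neqAle nrm_ge0 andbT eq_sym; apply: contraNneq x0 => /nrm0_eq0 ->.
have ReV : complex.Re `|((nrm x)^-1)%:C%C| = (nrm x)^-1.
  by rewrite ger0_norm // ler0c invr_ge0 ltW.
rewrite -ler_pdivrMr // mulrC -[_^-1]ReV -nrmZ -bopZl.
apply: sup_ubound; first by case: (opnorm_has_sup T).
exists ((nrm x)^-1%:C%C *: x) => //=.
by rewrite nrmZ ReV mulVf // gt_eqF.
Qed.

Lemma opnorm_le T k : 0 <= k -> (forall x, nrm (T x) <= k * nrm x) -> opnorm T <= k.
Proof.
move=> k0 kT; apply: ge_sup; first by case: (opnorm_has_sup T).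
by move=> _ [x /= x1 <-]; rewrite (le_trans (kT x)) // ler_piMr.
Qed.

Lemma opnorm_add S T : opnorm (S + T) <= opnorm S + opnorm T.
Proof.
apply: opnorm_le => [|x]; first by rewrite addr_ge0 ?opnorm_ge0.
by rewrite (le_trans (nrmD _ _)) // mulrDl lerD ?le_opnorm.
Qed.

Lemma opnorm_comp S T : opnorm (bop_comp S T) <= opnorm S * opnorm T.
Proof.
apply: opnorm_le => [|x]; first by rewrite mulr_ge0 ?opnorm_ge0.
by rewrite (le_trans (le_opnorm S (T x))) // -mulrA ler_wpM2l ?opnorm_ge0 ?le_opnorm.
Qed.

Lemma opnorm0_eq0 T : opnorm T = 0 -> T = 0.
Proof.
move=> T0; apply/bopP => x; apply: nrm0_eq0; apply/eqP.
by rewrite eq_le nrm_ge0 andbT (le_trans (le_opnorm T x)) // T0 mul0r.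
Qed.

Lemma opnorm_scale (c : R[i]) T : opnorm (c *: T) = complex.Re `|c| * opnorm T.
Proof.
have Re0 d : 0 <= complex.Re (`|d| : R[i]).
  by rewrite -ler0c RRe_real ?ger0_real.
have le d S : opnorm (d *: S) <= complex.Re `|d| * opnorm S.
  apply: opnorm_le => [|x]; first by rewrite mulr_ge0 // opnorm_ge0.
  rewrite -[(d *: S) x]/(d *: S x) nrmZ -mulrA.
  by rewrite ler_wpM2l ?le_opnorm.
apply/eqP; rewrite eq_le le andTb.
have [->|c0] := eqVneq c 0; first by rewrite normr0 mul0r opnorm_ge0.
have ReV : complex.Re `|c^-1| = (complex.Re `|c|)^-1.
  apply: complexI; rewrite fmorphV !RRe_real ?ger0_real //.
  by rewrite normfV.
have Rec : 0 < complex.Re `|c| by rewrite -ltcR RRe_real ?ger0_real // normr_gt0.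
rewrite mulrC -ler_pdivlMr // -[T in opnorm T <= _](scalerK c0).
by rewrite (le_trans (le _ _)) // ReV mulrC.
Qed.

Let bop_norm T : R[i] := (opnorm T)%:C%C.
Let bop_normD S T : bop_norm (S + T) <= bop_norm S + bop_norm T.
Proof. by rewrite -rmorphD lecR opnorm_add. Qed.
Let bop_normZ (c : R[i]) T : bop_norm (c *: T) = `|c| * bop_norm T.
Proof. by rewrite /bop_norm opnorm_scale rmorphM; congr (_ * _); apply/RRe_real/ger0_real. Qed.
Let bop_norm0_eq0 T : bop_norm T = 0 -> T = 0.
Proof. by move=> /complexI /opnorm0_eq0. Qed.

HB.instance Definition _ := Lmodule_isNormed.Build R[i] bop
  bop_normD bop_normZ bop_norm0_eq0.

Lemma nrm_bopE T : nrm T = opnorm T. Proof. by []. Qed.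

Let bop_complete (F : set_system bop) : ProperFilter F -> cauchy F -> cvg F.
Proof.
move=> FF /cauchy_nrmP Fc.
have Fx x : exists l : H, ((fun T : bop => T x) @ F) --> l.
  apply/cvg_ex; apply: cauchy_cvg; apply/cauchy_nrmP => e e0.
  have nx1 : 0 < nrm x + 1 by rewrite ltr_wpDl ?nrm_ge0.
  have /Fc[S FS] : 0 < e / (nrm x + 1) by rewrite divr_gt0.
  exists (S x); rewrite /fmap /=; move: FS; apply: filterS => T /= ST.
  rewrite -[S x - T x]/((S - T : bop) x) (le_lt_trans (le_opnorm _ _)) //.
  rewrite -nrm_bopE; move: ST; rewrite ltr_pdivlMr //; apply: le_lt_trans.
  by rewrite ler_wpM2l ?nrm_ge0 // lerDl.
pose L x := projT1 (cid (Fx x)).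
have LE x : ((fun T : bop => T x) @ F) --> L x by rewrite /L; case: cid.
have Llin : linear L.
  move=> c x y.
  pose g (T : bop) := c *: T x + T y.
  have gE : g = (fun T : bop => T (c *: x + y)).
    by apply/funext => T; rewrite bop_linear.
  have : g @ F --> L (c *: x + y) by rewrite gE; exact: LE.
  move=> /norm_cvg_unique; apply.
  exact: (cvgD (cvgZl_tmp (k := c) (LE x)) (LE y)).
have Lnear S e : 0 <= e -> F [set T | nrm (S - T) < e] ->
    forall x, nrm (S x - L x) <= e * nrm x.
  move=> e0 FS x; apply/ler_addgt0Pr => d d0.
  have /cvg_nrmP/(_ d d0) Fd := LE x.
  have [T /= [dT eT]] := filter_ex (filterI Fd FS).
  rewrite -(subrK (T x) (S x)) -addrA (le_trans (nrmD _ _)) //.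
  apply: lerD; last by rewrite nrmB ltW.
  rewrite -[S x - T x]/((S - T : bop) x) (le_trans (le_opnorm _ _)) //.
  by rewrite ler_wpM2r ?nrm_ge0 // -nrm_bopE ltW.
have Lbnd : exists k : R, forall x : H, nrm (L x) <= k * nrm x.
  have [S FS] := Fc 1 ltr01; exists (opnorm S + 1) => x.
  rewrite -(subKr (S x) (L x)) (le_trans (nrmD _ _)) // nrmN mulrDl.
  by rewrite lerD ?le_opnorm // Lnear.
apply/cvg_ex; exists (Bop Llin Lbnd); apply/cvg_nrmP => e e0.
have e2 : 0 < e / 2 / 2 by rewrite !divr_gt0.
have [S FS] := Fc _ e2; apply: filterS (FS) => T /= ST.
rewrite -(subrK S (Bop _ _)) -addrA (le_lt_trans (nrmD _ _)) //.
have : nrm (S - Bop Llin Lbnd) <= e / 2 / 2.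
  by rewrite nrm_bopE; apply: opnorm_le => [|x]; [exact: ltW|exact: Lnear (ltW _) _ _].
rewrite nrmB => SL; rewrite (le_lt_trans (lerD SL (ltW ST))) //.
by rewrite -splitr ltr_pdivrMr // ltr_pMr // ltr1n.
Qed.

HB.instance Definition _ := Uniform_isComplete.Build bop bop_complete.

End bop.

Section inner.
Variables (R : realType) (H : hilbertType R).
Implicit Types x y z : H.

Lemma innerDl x y z : inner (x + y) z = inner x z + inner y z.
Proof. by have := innerDZl 1 x y z; rewrite scale1r mul1r. Qed.

Lemma inner0l z : inner 0 z = 0.
Proof. by apply: (addrI (inner 0 z)); rewrite -innerDl !addr0. Qed.

Lemma innerZl c x z : inner (c *: x) z = c * inner x z.
Proof. by have := innerDZl c x 0 z; rewrite !addr0 inner0l addr0. Qed.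

Lemma innerNl x z : inner (- x) z = - inner x z.
Proof. by rewrite -scaleN1r innerZl mulN1r. Qed.

Lemma innerBl x y z : inner (x - y) z = inner x z - inner y z.
Proof. by rewrite innerDl innerNl. Qed.

Lemma innerDr x y z : inner x (y + z) = inner x y + inner x z.
Proof. by rewrite inner_conj innerDl rmorphD /= -!inner_conj. Qed.

Lemma innerZr c x z : inner x (c *: z) = conjc c * inner x z.
Proof. by rewrite inner_conj innerZl rmorphM /= -inner_conj. Qed.

Lemma inner0r x : inner x 0 = 0.
Proof. by rewrite -(scale0r 0) innerZr rmorph0 mul0r. Qed.

Lemma innerNr x z : inner x (- z) = - inner x z.
Proof. by rewrite -scaleN1r innerZr rmorphN1 mulN1r. Qed.

Lemma innerBr x y z : inner x (y - z) = inner x y - inner x z.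
Proof. by rewrite innerDr innerNr. Qed.

Lemma norm_sub_proj z h : h != 0 ->
  `|z - (inner z h / `|h| ^+ 2) *: h| ^+ 2 =
  `|z| ^+ 2 - `|inner z h| ^+ 2 / `|h| ^+ 2.
Proof.
move=> h0; rewrite !norm_inner innerBl !innerBr !innerZl !innerZr.
have hh : inner h h != 0 by rewrite -norm_inner sqrf_eq0 normr_eq0.
rewrite rmorphM fmorphV /= -(inner_conj h h) -(inner_conj z h).
rewrite sqr_normc -inner_conj.
by field.
Qed.

Lemma cauchy_schwarz x y : `|inner x y| <= `|x| * `|y|.
Proof.
have [->|y0] := eqVneq y 0; first by rewrite inner0r normr0 mulr_ge0.
have y2 : 0 < `|y| ^+ 2 by rewrite exprn_gt0 // normr_gt0.
have := exprn_ge0 2 (normr_ge0 (x - (inner x y / `|y| ^+ 2) *: y)).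
rewrite norm_sub_proj // subr_ge0 ler_pdivrMr // -exprMn.
by rewrite ler_sqr // nnegrE // mulr_ge0.
Qed.

Lemma nrm2E x : nrm x ^+ 2 = complex.Re (inner x x).
Proof. by rewrite -norm_inner nrmE -rmorphXn. Qed.

Lemma parallelogram x y :
  nrm (x + y) ^+ 2 + nrm (x - y) ^+ 2 = 2 * (nrm x ^+ 2 + nrm y ^+ 2).
Proof.
rewrite !nrm2E innerBl !innerBr innerDl !innerDr.
case: (inner x x) (inner x y) (inner y x) (inner y y) => [a ?] [b ?] [c ?] [d ?] /=.
ring.
Qed.

Lemma inner_inj x y : (forall z, inner z x = inner z y) -> x = y.
Proof.
move=> xy; apply/eqP; rewrite -subr_eq0 -normr_eq0 -sqrf_eq0 norm_inner.
by rewrite innerBr xy subrr.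
Qed.

Section riesz.
Variable f : H -> R[i].
Hypothesis f_lin : forall c x y, f (c *: x + y) = c * f x + f y.
Variable k : R.
Hypothesis f_bnd : forall x, `|f x| <= k%:C%C * `|x|.

Let f0 : f 0 = 0.
Proof.
have := f_lin 1 0 0; rewrite scale1r addr0 mul1r => /eqP.
by rewrite -subr_eq0 opprD addNKr oppr_eq0 => /eqP.
Qed.
Let fZ c x : f (c *: x) = c * f x.
Proof. by have := f_lin c x 0; rewrite !addr0 f0 addr0. Qed.
Let fD x y : f (x + y) = f x + f y.
Proof. by have := f_lin 1 x y; rewrite scale1r mul1r. Qed.
Let fB x y : f (x - y) = f x - f y.
Proof. by rewrite fD -scaleN1r fZ mulN1r. Qed.

Let min_attained : (exists x, f x = 1) ->
  exists2 z, f z = 1 & forall x, f x = 1 -> nrm z <= nrm x.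
Proof.
move=> [x0 fx0].
pose d := inf [set nrm x | x in [set x | f x = 1]].
have hinf : has_inf [set nrm x | x in [set x | f x = 1]].
  split; first by exists (nrm x0), x0.
  by exists 0 => _ [x _ <-]; exact: nrm_ge0.
have dle x : f x = 1 -> d <= nrm x by move=> fx; apply: ge_inf; [case: hinf|exists x].
have d0 : 0 <= d by apply: lb_le_inf; [case: hinf|move=> _ [x _ <-]; exact: nrm_ge0].
pose S e := [set x | f x = 1 /\ nrm x < d + e].
pose F := filter_from [set e : R | 0 < e] S.
have S0 e : 0 < e -> S e !=set0.
  move=> e0; have [_ [x /= fx <-] xd] := inf_adherent e0 hinf.
  by exists x.
have FF : ProperFilter F.
  apply: filter_from_proper; last by move=> e e0; exact: S0.
  apply: filter_from_filter; first by exists 1 => /=.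
  move=> i j /= i0 j0; exists (Num.min i j); first by rewrite /= lt_min i0.
  move=> x [fx xd]; split; split=> //; rewrite (lt_le_trans xd) // lerD2l.
    by rewrite ge_min lexx.
  by rewrite ge_min lexx orbT.
have Sdist e u w : 0 < e -> S e u -> S e w ->
    nrm (u - w) ^+ 2 <= 8 * d * e + 4 * e ^+ 2.
  move=> e0 [fu ud] [fw wd].
  have : 2 * d <= nrm (u + w).
    have h : 2^-1 * nrm (u + w) = nrm ((2^-1)%:C%C *: (u + w)).
      by rewrite nrmZ; congr (_ * _); rewrite ger0_norm // ler0c invr_ge0.
    rewrite -ler_pdivlMl // h; apply: dle; rewrite fZ fD fu fw.
    by rewrite fmorphV rmorph_nat -[1 + 1]/(2%:R) mulVf // pnatr_eq0.
  have := parallelogram u w.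
  have := nrm_ge0 u; have := nrm_ge0 w; have := nrm_ge0 (u + w).
  move: ud wd d0; move: (nrm u) (nrm w) (nrm (u + w)) (nrm (u - w)) => a b p q.
  nra.
have Fc : cauchy F.
  apply/cauchy_nrmP => e e0.
  pose dl := Num.min 1 (e ^+ 2 / (2 * (8 * d + 4))).
  have dl0 : 0 < dl.
    by rewrite lt_min ltr01 divr_gt0 ?exprn_gt0 // mulr_gt0 // ltr_wpDl ?mulr_ge0.
  have [v Sv] := S0 _ dl0; exists v, dl => // w Sw /=.
  have vw := Sdist _ _ _ dl0 Sv Sw.
  rewrite -(@ltr_pXn2r _ 2) ?nnegrE ?nrm_ge0 ?(ltW e0) //.
  rewrite (le_lt_trans vw) //.
  have dl1 : dl <= 1 by rewrite ge_min lexx.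
  have : dl <= e ^+ 2 / (2 * (8 * d + 4)) by rewrite ge_min lexx orbT.
  rewrite ler_pdivlMr ?mulr_gt0 ?ltr_wpDl ?mulr_ge0 //.
  have : 0 < e ^+ 2 by rewrite exprn_gt0.
  by move: (e ^+ 2) => e2; nra.
have /cvg_ex[z Fz] : cvg F by exact: cauchy_cvg.
have near e : 0 < e -> exists x, [/\ f x = 1, nrm x < d + e & nrm (z - x) < e].
  move=> e0; have /cvg_nrmP/(_ e e0) Fze : id @ F --> z by exact: Fz.
  have FS : F (S e) by exists e.
  by have [x [/= zx [fx xd]]] := filter_ex (filterI Fze FS); exists x.
have fz : f z = 1.
  apply/eqP; rewrite -subr_eq0 -normr_eq0 -[_ == _]negbK; apply/negP => fz1.
  have k1 : 0 < `|k| + 1 by rewrite ltr_wpDl.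
  pose m := complex.Re `|f z - 1|.
  have mE : `|f z - 1| = m%:C%C by rewrite RRe_real // ger0_real.
  have m0 : 0 < m by rewrite -ltcR -mE lt_neqAle eq_sym fz1 normr_ge0.
  have [|x [fx _ zx]] := near (m / (`|k| + 1)); first by rewrite divr_gt0.
  have := f_bnd (z - x); rewrite fB fx mE nrmE -rmorphM lecR.
  rewrite leNgt => /negP; apply.
  rewrite (le_lt_trans (ler_wpM2r (nrm_ge0 _) (ler_norm k))) //.
  move: zx; rewrite ltr_pdivlMr // mulrC; apply: le_lt_trans.
  by rewrite ler_wpM2r ?nrm_ge0 // lerDl.
exists z => // x fx; rewrite (le_trans _ (dle x fx)) //.
apply/ler_addgt0Pr => e e0; have e2 : 0 < e / 2 by rewrite divr_gt0.
have [u [_ ud zu]] := near _ e2.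
rewrite -(subrK u z) (le_trans (nrmD _ _)) //.
by rewrite (le_trans (lerD (ltW zu) (ltW ud))) // addrCA -splitr.
Qed.

Lemma riesz : exists y, forall x, f x = inner x y.
Proof.
have [[x0 fx0]|f00] := pselect (exists x, f x != 0); last first.
  exists 0 => x; rewrite inner0r; apply/eqP; apply: contra_notT f00 => fx.
  by exists x.
have [|z fz zmin] := min_attained.
  by exists ((f x0)^-1 *: x0); rewrite fZ mulVf.
have z0 : z != 0.
  by apply: contra_eq_neq fz => ->; rewrite f0 eq_sym oner_eq0.
have zh h : f h = 0 -> inner z h = 0.
  move=> fh; have [->|h0] := eqVneq h 0; first by rewrite inner0r.
  have /zmin : f (z - (inner z h / `|h| ^+ 2) *: h) = 1.
    by rewrite fB fZ fh mulr0 subr0.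
  rewrite -lecR -!nrmE -ler_sqr ?nnegrE // norm_sub_proj //.
  rewrite lerBrDr gerDl => le0; apply/eqP; rewrite -normr_eq0 -sqrf_eq0.
  have h2 : 0 < `|h| ^+ 2 by rewrite exprn_gt0 // normr_gt0.
  move: le0; rewrite pmulr_lle0 ?invr_gt0 // => le0.
  by rewrite eq_le le0 exprn_ge0.
exists ((`|z| ^- 2) *: z) => x.
have : inner z (x - f x *: z) = 0 by apply: zh; rewrite fB fZ fz mulr1 subrr.
have zz : inner z z != 0 by rewrite -norm_inner sqrf_eq0 normr_eq0.
move/(congr1 conjc); rewrite rmorph0 -inner_conj innerBl innerZl => /eqP.
rewrite subr_eq0 innerZr => /eqP ->.
have -> : conjc (`|z| ^- 2) = (inner z z)^-1.
  by rewrite -norm_inner nrmE -rmorphXn -fmorphV; exact: conjc_real.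
by rewrite mulrCA mulVf // mulr1.
Qed.
End riesz.
End inner.

Section adjoint.
Variables (R : realType) (H : hilbertType R).
Local Notation L := (bop H).
Implicit Types S T : L.

Let adj_ex T y : exists z, forall x, inner (T x) y = inner x z.
Proof.
apply: (@riesz _ _ (fun x => inner (T x) y) _ (opnorm T * nrm y)) => [c u v|x].
  by rewrite bop_linear innerDZl.
rewrite (le_trans (cauchy_schwarz _ _)) // !nrmE -!rmorphM lecR mulrAC.
by rewrite ler_wpM2r ?nrm_ge0 // le_opnorm.
Qed.

Let adj_fun T y := projT1 (cid (adj_ex T y)).

Let adj_funE T x y : inner (T x) y = inner x (adj_fun T y).
Proof. by rewrite /adj_fun; case: cid. Qed.

Let adj_linear T : linear (adj_fun T).
Proof.
move=> c x y; apply: inner_inj => z.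
by rewrite innerDr innerZr -!adj_funE innerDr innerZr.
Qed.

Let adj_le T x : nrm (adj_fun T x) <= opnorm T * nrm x.
Proof.
set y := adj_fun T x.
have [->|y0] := eqVneq y 0; first by rewrite nrm0 mulr_ge0 ?nrm_ge0 ?opnorm_ge0.
have ny : 0 < nrm y.
  by rewrite lt_neqAle nrm_ge0 andbT eq_sym; apply: contraNneq y0 => /nrm0_eq0 ->.
rewrite -(ler_pM2r ny) -expr2 -mulrAC -lecR.
rewrite rmorphXn /= -nrmE norm_inner -adj_funE.
have h : 0 <= inner (T y) x by rewrite adj_funE -norm_inner exprn_ge0.
rewrite -(ger0_norm h) (le_trans (cauchy_schwarz _ _)) // !nrmE -!rmorphM lecR.
by rewrite ler_wpM2r ?nrm_ge0 // le_opnorm.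
Qed.

Let adj_bounded T : exists k : R, forall x : H, nrm (adj_fun T x) <= k * nrm x.
Proof. by exists (opnorm T). Qed.

Definition adjoint T : L := Bop (adj_linear T) (@adj_bounded T).

Lemma adjointE T x y : inner (T x) y = inner x (adjoint T y).
Proof. exact: adj_funE. Qed.

Lemma adjointE' T x y : inner (adjoint T x) y = inner x (T y).
Proof. by rewrite inner_conj -adjointE -inner_conj. Qed.

Lemma adjointP S T : (forall x y, inner (T x) y = inner x (S y)) -> adjoint T = S.
Proof.
by move=> ST; apply/bopP => y; apply: inner_inj => x; rewrite -adjointE.
Qed.

Lemma opnorm_adjoint T : opnorm (adjoint T) <= opnorm T.
Proof. by apply: opnorm_le => [|x]; [exact: opnorm_ge0 | exact: adj_le]. Qed.

Lemma adjointK : involutive adjoint.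
Proof. by move=> T; apply: adjointP => x y; rewrite adjointE'. Qed.

Let comp_DZl c S T U : bop_comp (c *: S + T) U = c *: bop_comp S U + bop_comp T U.
Proof. exact/bopP. Qed.

Let amul_assoc : associative (@bop_comp R H).
Proof. by move=> S T U; apply/bopP. Qed.
Let amul_Dl : left_distributive (@bop_comp R H) +%R.
Proof. by move=> S T U; apply/bopP. Qed.
Let amul_Dr : right_distributive (@bop_comp R H) +%R.
Proof. by move=> S T U; apply/bopP => x /=; rewrite bopDl. Qed.
Let amul_Zl c S T : bop_comp (c *: S) T = c *: bop_comp S T.
Proof. exact/bopP. Qed.
Let amul_Zr c S T : bop_comp S (c *: T) = c *: bop_comp S T.
Proof. by apply/bopP => x /=; rewrite bopZl. Qed.
Let star_D S T : adjoint (S + T) = adjoint S + adjoint T.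
Proof.
apply: adjointP => x y.
rewrite -[(S + T) x]/(S x + T x) innerDl !adjointE -innerDr.
by congr (inner _ _).
Qed.
Let star_Z c T : adjoint (c *: T) = conjc c *: adjoint T.
Proof.
apply: adjointP => x y.
rewrite -[(c *: T) x]/(c *: T x) innerZl adjointE.
rewrite -[(conjc c *: adjoint T) y]/(conjc c *: adjoint T y) innerZr.
by rewrite conjcK.
Qed.
Let star_M S T : adjoint (bop_comp S T) = bop_comp (adjoint T) (adjoint S).
Proof. by apply: adjointP => x y /=; rewrite !adjointE. Qed.
Let norm_M S T : `|bop_comp S T| <= `|S| * `|T|.
Proof. by rewrite !nrmE -rmorphM lecR opnorm_comp. Qed.
Let norm_star_M T : `|bop_comp (adjoint T) T| = `|T| ^+ 2.
Proof.
rewrite !nrmE -rmorphXn; congr (_%:C%C).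
apply/eqP; rewrite eq_le; apply/andP; split.
  rewrite (le_trans (opnorm_comp _ _)) // expr2.
  by rewrite ler_wpM2r ?opnorm_ge0 ?opnorm_adjoint.
set N := nrm (bop_comp _ _).
have N0 : 0 <= N by exact: nrm_ge0.
have : opnorm T <= Num.sqrt N.
  apply: opnorm_le => [|x]; first exact: sqrtr_ge0.
  rewrite -(@ler_pXn2r _ 2) ?nnegrE ?nrm_ge0 ?mulr_ge0 ?sqrtr_ge0 ?nrm_ge0 //.
  rewrite exprMn sqr_sqrtr // -lecR rmorphXn /= -nrmE norm_inner adjointE.
  have h : 0 <= inner x (adjoint T (T x)) by rewrite -adjointE -norm_inner exprn_ge0.
  rewrite -(ger0_norm h) (le_trans (cauchy_schwarz _ _)) // !nrmE -!rmorphM lecR.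
  rewrite mulrC expr2 mulrA ler_wpM2r ?nrm_ge0 //.
  exact: (le_opnorm (bop_comp (adjoint T) T)).
move=> TN; rewrite -[N]sqr_sqrtr // ler_pXn2r ?nnegrE ?nrm_ge0 ?sqrtr_ge0 //.
Qed.

HB.instance Definition _ := CompleteNormedModule_isCStarAlgebra.Build R L
  amul_assoc amul_Dl amul_Dr amul_Zl amul_Zr adjointK star_D star_Z star_M
  norm_M norm_star_M.

End adjoint.

Local Open Scope quotient_scope.

Section homomorphisms.
Variable R : realType.

Definition separable_space (T : topologicalType) : Prop :=
  exists2 S : set T, countable S & dense S.

Definition star_hom (A B : cstarAlgType R) (f : A -> B) : Prop :=
  [/\ linear f, {morph f : a b / a ** b} & {morph f : a / star a}].

Definition star_isomorphic (A B : cstarAlgType R) : Prop :=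
  exists2 f : A -> B, star_hom f & bijective f.

(* Only the restriction of [mu] to [0, +oo[ matters. *)
Record asymptotic_hom (A B : cstarAlgType R) (mu : R -> A -> B) : Prop :=
  AsymptoticHom {
    ahom_continuous : forall a, {within `[0, +oo[, continuous (mu^~ a)};
    ahomM : forall a b,
      nrm (mu t (a ** b) - mu t a ** mu t b) @[t --> +oo] --> (0 : R);
    ahomDZ : forall (c : R[i]) a b,
      nrm (mu t (a + c *: b) - mu t a - c *: mu t b) @[t --> +oo] --> (0 : R);
    ahom_star : forall a,
      nrm (mu t (star a) - star (mu t a)) @[t --> +oo] --> (0 : R)
  }.

End homomorphisms.

Section algebraic_tensor.
Variables (K : pzRingType) (A D : lmodType K).

(* A formal sum of elementary tensors is a list of pairs; [tensor_eq] is the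
   congruence generated by commutativity and bilinearity. *)
Inductive tensor_eq : seq (A * D) -> seq (A * D) -> Prop :=
| tensor_refl s : tensor_eq s s
| tensor_sym s t : tensor_eq s t -> tensor_eq t s
| tensor_trans s t u : tensor_eq s t -> tensor_eq t u -> tensor_eq s u
| tensor_cons v s t : tensor_eq s t -> tensor_eq (v :: s) (v :: t)
| tensor_swap v w s : tensor_eq [:: v, w & s] [:: w, v & s]
| tensor_zero d s : tensor_eq ((0, d) :: s) s
| tensor_addl a b d s :
    tensor_eq ((a + b, d) :: s) [:: (a, d), (b, d) & s]
| tensor_addr a d e s :
    tensor_eq ((a, d + e) :: s) [:: (a, d), (a, e) & s]
| tensor_scale c a d s :
    tensor_eq ((c *: a, d) :: s) ((a, c *: d) :: s).

Let tensor_eqb s t := `[< tensor_eq s t >].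
Let tensor_eqb_refl : reflexive tensor_eqb.
Proof. by move=> s; apply/asboolP; exact: tensor_refl. Qed.
Let tensor_eqb_sym : symmetric tensor_eqb.
Proof. by move=> s t; apply/asboolP/asboolP; exact: tensor_sym. Qed.
Let tensor_eqb_trans : transitive tensor_eqb.
Proof.
by move=> t s u /asboolP st /asboolP tu; apply/asboolP; exact: tensor_trans st tu.
Qed.

Canonical tensor_equiv :=
  EquivRel tensor_eqb tensor_eqb_refl tensor_eqb_sym tensor_eqb_trans.

Definition atensor := {eq_quot tensor_equiv}.
HB.instance Definition _ := Choice.on atensor.
HB.instance Definition _ := EqQuotient.on atensor.

Lemma atensor_eqP s t : \pi_atensor s = \pi_atensor t <-> tensor_eq s t.
Proof.
by split=> [/eqmodP/asboolP|st]; [|apply/eqmodP/asboolP].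
Qed.

(* When [f] is bilinear this is the linear map on the tensor product that it
   induces, see [tsum_pi]. *)
Definition tsum (V : nmodType) (f : A -> D -> V) (x : atensor) : V :=
  \sum_(u <- repr x) f u.1 u.2.

Lemma tsum_pi (V : lmodType K) (f : A -> D -> V) :
  (forall d, linear (f^~ d)) -> (forall a, linear (f a)) ->
  forall s, tsum f (\pi s) = \sum_(u <- s) f u.1 u.2.
Proof.
move=> fl fr s.
suff h t u : tensor_eq t u ->
    \sum_(v <- t) f v.1 v.2 = \sum_(v <- u) f v.1 v.2.
  by rewrite /tsum; apply: h; apply/atensor_eqP; rewrite reprK.
have f0 d : f 0 d = 0.
  by have := fl d (-1) 0 0; rewrite scaler0 addr0 scaleN1r addNr.
have f0r a : f a 0 = 0.
  by have := fr a (-1) 0 0; rewrite scaler0 addr0 scaleN1r addNr.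
elim=> {t u} [//|t u _ -> //|t u v _ -> _ -> //|v t u _ IH|v w t|d t|a b d t
  |a d e t|c a d t].
- by rewrite !big_cons IH.
- by rewrite !big_cons addrCA.
- by rewrite big_cons /= f0 add0r.
- by rewrite !big_cons /= -[a]scale1r fl !scale1r addrA.
- by rewrite !big_cons /= -[d]scale1r fr !scale1r addrA.
- rewrite !big_cons /=; congr (_ + _).
  by have := fl d c a 0; have := fr a c d 0; rewrite !addr0 f0 f0r !addr0 => -> ->.
Qed.

End algebraic_tensor.

Definition atensor_map (K : pzRingType) (E A D : lmodType K) (p : E -> A)
    (z : atensor E D) : atensor A D :=
  \pi_(atensor A D) [seq (p u.1, u.2) | u <- repr z].

Section hilbert_tensor.
Variable R : realType.

(* The Hilbert space tensor product, determined up to unitary equivalence by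
   the following properties. *)
Record hilbert_tensor (H1 H2 : hilbertType R) := HilbertTensor {
  ht_space :> hilbertType R;
  ht_tens : H1 -> H2 -> ht_space;
  ht_linearl : forall y, linear (ht_tens^~ y);
  ht_linearr : forall x, linear (ht_tens x);
  ht_inner : forall x x' y y',
    inner (ht_tens x y) (ht_tens x' y') = inner x x' * inner y y';
  ht_dense : dense (range (tsum ht_tens))
}.

(* S (x) T is the unique bounded operator such that
   (S (x) T)(x (x) y) = S x (x) T y. *)
Definition op_tensor (H1 H2 : hilbertType R) (HT : hilbert_tensor H1 H2)
    (S : bop H1) (T : bop H2) : bop HT :=
  xget 0 [set W : bop HT |
    forall x y, W (ht_tens HT x y) = ht_tens HT (S x) (T y)].

End hilbert_tensor.

Section tensor_norms.
Variable R : realType.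
Implicit Types A D : cstarAlgType R.

(* Continuous functions on [0, +oo[ vanishing at infinity. *)
Definition c0_fun (V : normedModType R[i]) : set (R -> V) :=
  [set g : R -> V | {within `[0, +oo[, continuous g} /\
           nrm (g t) @[t --> +oo] --> (0 : R)].

Definition sup_norm (V : normedModType R[i]) (f : R -> V) : \bar R :=
  ereal_sup [set (nrm (f t))%:E | t in [set t | 0 <= t]].

(* The norm of the class of f in the quotient C_b([0, +oo[, V) / C_0([0, +oo[, V). *)
Definition cb_mod_c0_norm (V : normedModType R[i]) (f : R -> V) : \bar R :=
  ereal_inf [set sup_norm (fun t => f t - g t) | g in @c0_fun V].

Definition norm_lambda A D (x : atensor A D) : \bar R :=
  ereal_sup [set q | exists (H1 H2 : hilbertType R) (HT : hilbert_tensor H1 H2)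
      (mu : R -> A -> bop H1) (nu : D -> bop H2),
    [/\ separable_space H1, separable_space H2, asymptotic_hom mu, star_hom nu
      & q = cb_mod_c0_norm
              (fun t => tsum (fun a d => op_tensor HT (mu t a) (nu d)) x)]].

(* The spatial norm. *)
Definition min_norm A D (x : atensor A D) : \bar R :=
  ereal_sup [set q | exists (H1 H2 : hilbertType R) (HT : hilbert_tensor H1 H2)
      (pi : A -> bop H1) (sigma : D -> bop H2),
    [/\ star_hom pi, star_hom sigma
      & q = (nrm (tsum (fun a d => op_tensor HT (pi a) (sigma d)) x))%:E]].

(* The minimal tensor product: the completion of the *-algebra A (.) D for the
   spatial norm. *)
Record min_tensor A D := MinTensor {
  mt_alg :> cstarAlgType R;
  mt_tens : A -> D -> mt_alg;
  mt_linearl : forall d, linear (mt_tens^~ d);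
  mt_linearr : forall a, linear (mt_tens a);
  mt_mul : forall a a' d d',
    mt_tens a d ** mt_tens a' d' = mt_tens (a ** a') (d ** d');
  mt_star : forall a d, star (mt_tens a d) = mt_tens (star a) (star d);
  mt_norm : forall x : atensor A D, (nrm (tsum mt_tens x))%:E = min_norm x;
  mt_dense : dense (range (tsum mt_tens))
}.

End tensor_norms.

Section stability.
Variable R : realType.

Definition infinite_dimensional (H : hilbertType R) : Prop :=
  forall s : seq H, exists x : H,
    forall c : nat -> R[i], x <> \sum_(k < size s) c k *: s`_k.

Definition compact_operator (H : hilbertType R) (T : bop H) : Prop :=
  precompact (T @` [set x | nrm x <= 1]).

Definition is_compact_operators (K : cstarAlgType R) (H : hilbertType R) : Prop :=
  exists j : K -> bop H,
    [/\ star_hom j, injective j & range j = @compact_operator H].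

Definition stable (B : cstarAlgType R) : Prop :=
  exists (H : hilbertType R) (K : cstarAlgType R) (BK : min_tensor B K),
    [/\ separable_space H, infinite_dimensional H, is_compact_operators K H
      & star_isomorphic BK B].

End stability.

Section extensions.
Variable R : realType.
Variables B A : cstarAlgType R.

Record extension := Extension {
  ext_alg :> cstarAlgType R;
  ext_i : B -> ext_alg;
  ext_p : ext_alg -> A;
  ext_i_hom : star_hom ext_i;
  ext_p_hom : star_hom ext_p;
  ext_i_inj : injective ext_i;
  ext_p_surj : forall a, exists e, ext_p e = a;
  ext_exact : forall e, ext_p e = 0 <-> range ext_i e
}.

Definition asymptotically_split (X : extension) : Prop :=
  exists2 s : R -> A -> X, asymptotic_hom s
    & forall t, 0 <= t -> forall a, ext_p (s t a) = a.

(* The closed ideal B (x)_min D of E (x)_min D. *)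
Definition ideal_tensor (X : extension) (D : cstarAlgType R)
    (ED : min_tensor X D) : set ED :=
  closure (range (tsum (fun (b : B) (d : D) => mt_tens ED (ext_i X b) d))).

Arguments ideal_tensor {X D} ED _.

(* The coset of x in E (x)_min D / B (x)_min D. *)
Definition ext_coset (X : extension) (D : cstarAlgType R)
    (ED : min_tensor X D) (x : atensor A D) : set ED :=
  [set w | exists2 z : atensor X D, atensor_map (@ext_p X) z = x
    & ideal_tensor ED (w - tsum (mt_tens ED) z)].

Arguments ext_coset {X D} ED x _.

Definition norm_E (X : extension) (D : cstarAlgType R)
    (ED : min_tensor X D) (x : atensor A D) : R :=
  inf [set nrm w | w in ext_coset ED x].

End extensions.

Section multipliers.
Variables (R : realType) (B : cstarAlgType R).

(* Double centralizers; linearity and boundedness of both maps, as well as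
   l (a b) = l a b and r (a b) = a r b, are automatic. *)
Record multiplier := Multiplier {
  mlt_l : B -> B;
  mlt_r : B -> B;
  mltP : forall a b, a ** mlt_l b = mlt_r a ** b
}.

HB.instance Definition _ := gen_eqMixin multiplier.
HB.instance Definition _ := gen_choiceMixin multiplier.

Lemma amul0 (a : B) : a ** 0 = 0.
Proof. by rewrite -(scale0r 0) amulZr !scale0r. Qed.

Lemma amul0l (a : B) : 0 ** a = 0.
Proof. by rewrite -(scale0r 0) amulZl !scale0r. Qed.

Let mlt0P (a b : B) : a ** 0 = 0 ** b.
Proof. by rewrite amul0 amul0l. Qed.
Definition mlt0 := Multiplier mlt0P.

Definition corona_eq (m n : multiplier) : Prop :=
  exists b : B, forall x,
    mlt_l m x = mlt_l n x + b ** x /\ mlt_r m x = mlt_r n x + x ** b.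

Let corona_eqb m n := `[< corona_eq m n >].
Let corona_eqb_refl : reflexive corona_eqb.
Proof.
by move=> m; apply/asboolP; exists 0 => x; rewrite amul0 amul0l !addr0.
Qed.
Let corona_eqb_sym : symmetric corona_eqb.
Proof.
suff h m n : corona_eq m n -> corona_eq n m.
  by move=> m n; apply/asboolP/asboolP; exact: h.
move=> [b mn]; exists (- b) => x; have [-> ->] := mn x.
rewrite -scaleN1r amulZl amulZr !scaleN1r -!addrA !subrr !addr0.
by [].
Qed.
Let corona_eqb_trans : transitive corona_eqb.
Proof.
move=> n m o /asboolP[b mn] /asboolP[c no]; apply/asboolP.
exists (c + b) => x; have [-> ->] := mn x; have [-> ->] := no x.
by rewrite amulDl amulDr !addrA.
Qed.

Canonical corona_equiv :=
  EquivRel corona_eqb corona_eqb_refl corona_eqb_sym corona_eqb_trans.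

Definition corona := {eq_quot corona_equiv}.
HB.instance Definition _ := Choice.on corona.
HB.instance Definition _ := EqQuotient.on corona.

Definition mx2_mul (X Y : 'M[B]_2) : 'M[B]_2 :=
  \matrix_(i, j) \sum_k X i k ** Y k j.

Definition mx2_star (X : 'M[B]_2) : 'M[B]_2 := \matrix_(i, j) star (X j i).

Record mx2_iso := Mx2Iso {
  mx2_fun :> 'M[B]_2 -> B;
  mx2_inv : B -> 'M[B]_2;
  mx2_funK : cancel mx2_fun mx2_inv;
  mx2_invK : cancel mx2_inv mx2_fun;
  mx2_funD : {morph mx2_fun : X Y / X + Y};
  mx2_funZ : forall (c : R[i]) X,
    mx2_fun (map_mx ( *:%R c) X) = c *: mx2_fun X;
  mx2_funM : forall X Y, mx2_fun (mx2_mul X Y) = mx2_fun X ** mx2_fun Y;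
  mx2_funS : forall X, mx2_fun (mx2_star X) = star (mx2_fun X)
}.

Variable theta : mx2_iso.

Let mlt_mx_l (m : 'M[multiplier]_2) (b : B) : B :=
  theta (\matrix_(i, j) \sum_k mlt_l (m i k) (mx2_inv theta b k j)).
Let mlt_mx_r (m : 'M[multiplier]_2) (b : B) : B :=
  theta (\matrix_(i, j) \sum_k mlt_r (m k j) (mx2_inv theta b i k)).

Let amul_sumr I (s : seq I) (a : B) (F : I -> B) :
  a ** (\sum_(k <- s) F k) = \sum_(k <- s) a ** F k.
Proof. exact: (big_morph _ (amulDr a) (amul0 a)). Qed.
Let amul_suml I (s : seq I) (a : B) (F : I -> B) :
  (\sum_(k <- s) F k) ** a = \sum_(k <- s) F k ** a.
Proof.
exact: (big_morph (amul^~ a) (fun x y => amulDl x y a) (amul0l a)).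
Qed.

Let mlt_mxP m a b : a ** mlt_mx_l m b = mlt_mx_r m a ** b.
Proof.
rewrite -{1}(mx2_invK theta a) -{2}(mx2_invK theta b) -!mx2_funM.
congr (theta _); apply/matrixP => i j; rewrite !mxE.
under eq_bigr do rewrite mxE amul_sumr.
rewrite exchange_big /=; apply: eq_bigr => k _; rewrite mxE amul_suml.
by apply: eq_bigr => l _; rewrite mltP.
Qed.

(* The isomorphism M_2(M(B)) = M(M_2(B)) -> M(B) induced by theta. *)
Definition mlt_mx (m : 'M[multiplier]_2) : multiplier := Multiplier (mlt_mxP m).

(* The isomorphism M_2(M(B)/B) -> M(B)/B induced by theta. *)
Definition corona_mx (X : 'M[corona]_2) : corona := \pi_corona (mlt_mx (map_mx repr X)).

Definition corona_oplus (x y : corona) : corona :=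
  corona_mx (\matrix_(i, j)
    if i != j then \pi_corona mlt0 else if i == ord0 then x else y).

End multipliers.

Section busby.
Variables (R : realType) (B A : cstarAlgType R).
Implicit Type X : extension B A.

Lemma ext_idealr X (e : X) (b : B) : exists c, ext_i X c = e ** ext_i X b.
Proof.
have [_ pM _] := ext_p_hom X.
have : ext_p (e ** ext_i X b) = 0.
  by rewrite pM (_ : ext_p (ext_i X b) = 0) ?amul0 //; apply/ext_exact; exists b.
by move=> /ext_exact[c _ <-]; exists c.
Qed.

Lemma ext_ideall X (e : X) (b : B) : exists c, ext_i X c = ext_i X b ** e.
Proof.
have [_ pM _] := ext_p_hom X.
have : ext_p (ext_i X b ** e) = 0.
  by rewrite pM (_ : ext_p (ext_i X b) = 0) ?amul0l //; apply/ext_exact; exists b.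
by move=> /ext_exact[c _ <-]; exists c.
Qed.

Let ext_mlt_l X (e : X) (b : B) : B := projT1 (cid (ext_idealr e b)).
Let ext_mlt_r X (e : X) (b : B) : B := projT1 (cid (ext_ideall e b)).

Let ext_mltP X (e : X) a b : a ** ext_mlt_l e b = ext_mlt_r e a ** b.
Proof.
have [_ iM _] := ext_i_hom X; apply: (@ext_i_inj _ _ _ X); rewrite !iM.
rewrite /ext_mlt_l /ext_mlt_r; case: cid => c /= ->; case: cid => d /= ->.
by rewrite amulA.
Qed.

(* The canonical map E -> M(B). *)
Definition ext_mlt X (e : X) : multiplier B := Multiplier (ext_mltP e).

Definition busby X (a : A) : corona B :=
  \pi_(corona B) (ext_mlt (projT1 (cid (ext_p_surj X a)))).

Definition is_direct_sum (theta : mx2_iso B) (X X' Y : extension B A) : Prop :=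
  forall a, busby Y a = corona_oplus theta (busby X a) (busby X' a).

Definition semi_invertible (theta : mx2_iso B) X : Prop :=
  exists X' Y : extension B A,
    is_direct_sum theta X X' Y /\ asymptotically_split Y.

End busby.

(* Main.v *)
From HB Require Import structures.
Require Import Defs.
From mathcomp Require Import all_boot all_order all_algebra.
From mathcomp Require Import generic_quotient complex.
From mathcomp Require Import all_classical all_reals.
From mathcomp Require Import ereal topology normedtype sequences.
From mathcomp Require Import ring lra.

Set Implicit Arguments.
Unset Strict Implicit.
Unset Printing Implicit Defensive.

Import Order.TTheory GRing.Theory Num.Theory.
Import numFieldNormedType.Exports.

Local Open Scope classical_set_scope.
Local Open Scope ring_scope.
Local Open Scope quotient_scope.

(** Let [Y] be the direct sum of [E] and some [E'], and let [s] be a family of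
    lifts that splits [Y] asymptotically.  In the matrix picture of [Y] over
    the multipliers of [B], the upper left corner [c y] of an element [y] is an
    element of [E] over the same element of [A] as [y], the lower left corner
    [g y] is an element of [B], and
      [c (star y ** z) = star (c y) ** c z + star (g y) ** g z]
    ([direct_sum_compression]).  So for [x] the sum of the [a (x) d] and every
    [n], the sum of the [c (s n a) (x) d] is a lift of [x] to [E], and its
    spatial norm is at least [norm_E x] ([norm_E_le_min_norm]).  If
    [L < norm_E x], there are representations [pi_n] of [E] and [sigma_n] of
    [D] in which the [n]-th lift stretches some finite sum of elementary
    tensors by more than [L] ([min_norm_witness]).

    These countably many pairs are replaced by a single pair of separable
    representations, of [Y] and of [D] ([common_dilation]).  The vectors
    [v y = (pi_n (c y) u, pi_n (g y) u)] have the inner products that a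
    representation of [Y] imposes on the vectors [y u], that is
    [<v y, v z> = <u, v (star y ** z)>], and such a family generates a
    representation of [Y] on its closed span ([separable_representation]);
    this is Stinespring's dilation of [pi_n \o c].  The span is separable
    because it is generated by orbits of vectors under [E].  A dilation can only
    increase the length of an image vector, so if [pi] and [nu] are the new
    representations, then [pi \o s] is an asymptotic representation of [A] and,
    at each integer time [n], it stretches a vector by at least [L].  Hence
    [L <= norm_lambda x] for all [L < norm_E x].

    All the operators above are bounded for one reason ([gram_contractive]): a
    self-adjoint [h] of norm less than 1 has the form [c + c - c ** c], that
    is, [1 - h] is the square of the self-adjoint [1 - c]
    ([one_sub_sqrt]), so a positive sesquilinear form that is compatible with
    the multiplication is nonnegative at [1 - h].  This gives contractivity of
    *-homomorphisms into bounded operators, of [S (x) 1] on algebraic tensors,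
    and of the dilated representation, before any of these is known to be
    continuous; they then extend by density ([bop_extend]). *)

(** * Linear identities in modules *)

(** Syntactic linear expressions, for proving identities in modules by
    comparing, with [ring], the coefficients of each atom. *)
Inductive lexpr (K : Type) :=
| LVar of nat | LZero | LAdd of lexpr K & lexpr K | LOpp of lexpr K
| LScale of K & lexpr K.

Section module_identities.
Variables (K : comNzRingType) (V : lmodType K).

Fixpoint leval (env : seq V) (e : lexpr K) : V :=
  match e with
  | LVar i => env`_i
  | LZero => 0
  | LAdd e f => leval env e + leval env f
  | LOpp e => - leval env e
  | LScale c e => c *: leval env e
  end.

Fixpoint lcoef (e : lexpr K) (i : nat) : K :=
  match e with
  | LVar j => (j == i)%:R
  | LZero => 0
  | LAdd e f => lcoef e i + lcoef f i
  | LOpp e => - lcoef e i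
  | LScale c e => c * lcoef e i
  end.

Fixpoint lbounded n (e : lexpr K) : bool :=
  match e with
  | LVar j => (j < n)%N
  | LZero => true
  | LAdd e f => lbounded n e && lbounded n f
  | LOpp e => lbounded n e
  | LScale _ e => lbounded n e
  end.

Lemma leval_coef env e : lbounded (size env) e ->
  leval env e = \sum_(i < size env) lcoef e i *: env`_i.
Proof.
elim: e => [j|//=|e IHe f IHf|e IHe|c e IHe] /=.
- move=> jn; rewrite (bigD1 (Ordinal jn)) //= eqxx scale1r big1 ?addr0 // => i ij.
  by rewrite (_ : (j == i) = false) ?scale0r //; apply: contraNF ij => /eqP ji; apply/eqP/val_inj.
- by rewrite big1 // => i _; rewrite scale0r.
- by move=> /andP[/IHe-> /IHf->]; rewrite -big_split; apply: eq_bigr => i _; rewrite scalerDl.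
- by move=> /IHe->; rewrite -sumrN; apply: eq_bigr => i _; rewrite scaleNr.
- by move=> /IHe->; rewrite scaler_sumr; apply: eq_bigr => i _; rewrite scalerA.
Qed.

Fixpoint lcoef_eq (n : nat) e f : Prop :=
  if n is m.+1 then lcoef e m = lcoef f m /\ lcoef_eq m e f else True.

Lemma leval_eq env e f : lbounded (size env) e -> lbounded (size env) f ->
  lcoef_eq (size env) e f -> leval env e = leval env f.
Proof.
move=> eb fb ef; rewrite !leval_coef //; apply: eq_bigr => -[i /= +] _.
elim: (size env) ef => // n IH [efn /IH{}IH]; rewrite ltnS leq_eqVlt.
by case/predU1P => [->|/IH//]; rewrite efn.
Qed.

End module_identities.

Ltac lmem x env :=
  lazymatch env with
  | nil => constr:(false) | cons x _ => constr:(true) | cons _ ?s => lmem x s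
  end.
Ltac lindex x env :=
  lazymatch env with
  | cons x _ => constr:(O) | cons _ ?s => let n := lindex x s in constr:(S n)
  end.
Ltac latoms x env :=
  lazymatch x with
  | (?a + ?b)%R => let s := latoms a env in latoms b s
  | (- ?a)%R => latoms a env
  | (_ *: ?a)%R => latoms a env
  | 0%R => env
  | _ => let b := lmem x env in
         lazymatch b with true => env | false => constr:(cons x env) end
  end.
Ltac lquote K x env :=
  lazymatch x with
  | (?a + ?b)%R => let a' := lquote K a env in let b' := lquote K b env in
                   constr:(@LAdd K a' b')
  | (- ?a)%R => let a' := lquote K a env in constr:(@LOpp K a')
  | (?c *: ?a)%R => let a' := lquote K a env in constr:(@LScale K c a')
  | 0%R => constr:(@LZero K)
  | _ => let n := lindex x env in constr:(@LVar K n)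
  end.
Ltac module_reduce K :=
  lazymatch goal with
  | |- @eq ?V ?x ?y =>
    let e := constr:(@nil V) in
    let env := latoms x e in let env := latoms y env in
    let x' := lquote K x env in let y' := lquote K y env in
    refine (@leval_eq _ _ env x' y' isT isT _);
    rewrite /= ; repeat split
  end.
Tactic Notation "module" constr(K) := module_reduce K; ring.

(** * Real norms, closed subspaces and closed spans *)

Section norm_facts.
Variables (R : realType) (V : normedModType R[i]).
Implicit Types u v w : V.

Lemma Re_norm_ge0 (c : R[i]) : 0 <= complex.Re `|c|.
Proof. by rewrite -ler0c RRe_real ?ger0_real. Qed.

Lemma nrm_dist v w : nrm v - nrm w <= nrm (v - w).
Proof. by rewrite lerBlDr -{1}(subrK w v) nrmD. Qed.

Lemma nrmB_tri u v w : nrm (v - w) <= nrm (v - u) + nrm (u - w).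
Proof. by rewrite -{1}(subrK u v) -addrA nrmD. Qed.

Lemma nrm_gt0 v : v != 0 -> 0 < nrm v.
Proof.
by move=> v0; rewrite lt_neqAle nrm_ge0 andbT eq_sym; apply: contraNneq v0 => /nrm0_eq0 ->.
Qed.

Lemma nrmZr (a : R) v : nrm (a%:C%C *: v) = `|a| * nrm v.
Proof.
rewrite nrmZ; congr (_ * _); have [a0|a0] := leP 0 a.
  by rewrite !ger0_norm // ler0c.
by rewrite ltr0_norm ?(ltr0_norm a0) // ltcR.
Qed.

Lemma nrm_small_eq0 (k : R) v : (forall e, 0 < e -> nrm v <= k * e) -> v = 0.
Proof.
move=> vk; apply/nrm0_eq0/eqP; rewrite eq_le nrm_ge0 andbT leNgt; apply/negP => v0.
have k0 : 0 < 2 * `|k| + 1 by rewrite ltr_wpDl // mulr_ge0.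
have := vk (nrm v / (2 * `|k| + 1)); rewrite divr_gt0 // mulrA ler_pdivlMr // => /(_ isT).
by have := ler_norm k; nra.
Qed.

(** Closed sets, in terms of the real-valued norm. *)
Definition nrm_closed (P : set V) : Prop :=
  forall v, (forall e : R, 0 < e -> exists2 w, P w & nrm (v - w) < e) -> P v.

Lemma dense_nrmP (S : set V) :
  dense S <-> forall v (e : R), 0 < e -> exists2 w, S w & nrm (v - w) < e.
Proof.
split=> [Sd v e e0|Sd O [v Ov] Oo].
  have [||w [/= vw Sw]] := Sd (ball v e%:C%C).
  - by exists v; apply: ballxx; rewrite ltcR.
  - exact: ball_open.
  by exists w => //; move: vw; rewrite ball_nrmE.
have : nbhs v O by exact: open_nbhs_nbhs.
rewrite -nbhs_ballE => -[e /= e0]; have eR : e = (complex.Re e)%:C%C.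
  by rewrite RRe_real // gtr0_real.
have /(Sd v)[w Sw vw] : 0 < complex.Re e by rewrite -ltcR -eR.
by rewrite eR ball_nrmE => /(_ w vw) Uw; exists w.
Qed.

End norm_facts.

(** Completeness in a form that suits objects known only up to an error: [F e]
    is the set of approximations of quality [e]. *)
Lemma nrm_complete (R : realType) (V : completeNormedModType R[i]) (F : R -> set V) :
  (forall d e, d <= e -> F d `<=` F e) ->
  (forall e, 0 < e -> F e !=set0) ->
  (forall e, 0 < e -> exists2 d, 0 < d &
     forall v w, F d v -> F d w -> nrm (v - w) < e) ->
  exists l, forall e, 0 < e -> exists2 d, 0 < d & forall v, F d v -> nrm (l - v) < e.
Proof.
move=> Fmono F0 Fc.
pose G := filter_from [set e : R | 0 < e] F.
have GF : ProperFilter G.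
  apply: filter_from_proper; last by move=> e e0; exact: F0.
  apply: filter_from_filter; first by exists 1 => /=.
  move=> i j /= i0 j0; exists (Num.min i j); first by rewrite /= lt_min i0.
  by move=> v Fv; split; apply: Fmono Fv; rewrite ge_min lexx // orbT.
have : cauchy G.
  apply/cauchy_nrmP => e e0; have [d d0 Fd] := Fc e e0.
  have [v Fv] := F0 d d0; exists v; exists d => // w Fw /=; exact: Fd.
move=> /cauchy_cvg/cvg_ex[l Gl]; exists l => e e0.
have /cvg_nrmP/(_ e e0)[d d0 Fd] : id @ G --> l by exact: Gl.
by exists d => // v /Fd.
Qed.

Section closed_subspaces.
Variables (R : realType) (V : normedModType R[i]).
Implicit Types (P Q : set V) (G : set V).

Definition subspace P : Prop :=
  P 0 /\ forall c u v, P u -> P v -> P (c *: u + v).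

Lemma subspaceD P u v : subspace P -> P u -> P v -> P (u + v).
Proof. by move=> [_ Pl] Pu Pv; rewrite -[u]scale1r; exact: Pl. Qed.

Lemma subspaceZ P c u : subspace P -> P u -> P (c *: u).
Proof. by move=> [P0 Pl] Pu; rewrite -[_ *: u]addr0; exact: Pl. Qed.

Lemma subspaceN P u : subspace P -> P u -> P (- u).
Proof. by move=> Ps Pu; rewrite -scaleN1r; exact: subspaceZ. Qed.

Lemma subspace_sum P I (s : seq I) (F : I -> V) :
  subspace P -> (forall i, P (F i)) -> P (\sum_(i <- s) F i).
Proof.
move=> Ps PF; elim/big_ind: _ => //; first by case: Ps.
by move=> u v; exact: subspaceD.
Qed.

(** The closed linear span of [G]; as an intersection it comes with its
    induction principle. *)
Definition cspan G : set V := fun v =>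
  forall P, subspace P -> nrm_closed P -> G `<=` P -> P v.

Lemma cspan_gen G : G `<=` cspan G.
Proof. by move=> v Gv P _ _; apply. Qed.

Lemma cspan_subspace G : subspace (cspan G).
Proof.
split; first by move=> P [].
by move=> c u v Gu Gv P Ps Pc GP; have [_] := Ps; apply; [exact: Gu|exact: Gv].
Qed.

Lemma cspan_closed G : nrm_closed (cspan G).
Proof.
move=> v Gv P Ps Pc GP; apply: (Pc) => e /Gv[w Gw vw].
by exists w => //; exact: (Gw P).
Qed.

Lemma nrm_closed_preimage (W : normedModType R[i]) (f : V -> W) (k : R) (Q : set W) :
  (forall u v, nrm (f u - f v) <= k * nrm (u - v)) ->
  nrm_closed Q -> nrm_closed (f @^-1` Q).
Proof.
move=> fk Qc v fv; apply: Qc => e e0.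
have k1 : 0 < `|k| + 1 by rewrite ltr_wpDl.
have [|w Qw vw] := fv (e / (`|k| + 1)); first by rewrite divr_gt0.
exists (f w) => //; apply: le_lt_trans (fk v w) _.
move: vw; rewrite ltr_pdivlMr // => vw.
by have := ler_norm k; have := nrm_ge0 (v - w); nra.
Qed.

Lemma nrm_closed_eq (W : normedModType R[i]) (f g : V -> W) (k : R) :
  (forall u v, nrm (f u - f v) <= k * nrm (u - v)) ->
  (forall u v, nrm (g u - g v) <= k * nrm (u - v)) ->
  nrm_closed [set v | f v = g v].
Proof.
move=> fk gk v fgv; apply/eqP; rewrite -subr_eq0; apply/eqP.
apply: (@nrm_small_eq0 _ _ (2 * `|k|)) => e /fgv[w fg vw].
have := nrmB_tri (f w) (f v) (g v); have := fk v w; have := gk w v.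
rewrite -[X in nrm (X - g v)]fg (nrmB w); have := nrm_ge0 (v - w).
by have := normr_ge0 k; have := ler_norm k; nra.
Qed.

End closed_subspaces.

Lemma cspan_approx (R : realType) (V : normedModType R[i]) (J : Type) (g : J -> V) v (e : R) :
  cspan (range g) v -> 0 < e ->
  exists l : seq (R[i] * J), nrm (v - \sum_(p <- l) p.1 *: g p.2) < e.
Proof.
move=> gv; move: e; pose P := [set v | forall e : R, 0 < e ->
  exists l : seq (R[i] * J), nrm (v - \sum_(p <- l) p.1 *: g p.2) < e].
suff : P v by [].
apply: gv => [|u uP d d0|_ [j _ <-] d d0].
- split; first by move=> d d0; exists [::]; rewrite big_nil subr0 nrm0.
  move=> c u u' Pu Pu' d d0.
  have k0 : 0 < complex.Re `|c| + 1 by rewrite ltr_wpDl ?Re_norm_ge0.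
  have [|l ul] := Pu (d / 2 / (complex.Re `|c| + 1)); first by rewrite !divr_gt0.
  have [|m um] := Pu' (d / 2); first by rewrite divr_gt0.
  exists ([seq (c * p.1, p.2) | p <- l] ++ m); rewrite big_cat big_map /=.
  rewrite (eq_bigr (fun p => c *: (p.1 *: g p.2))); last first.
    by move=> p _; rewrite scalerA.
  rewrite -scaler_sumr; set a := \sum_(_ <- l) _ in ul *; set b := \sum_(_ <- m) _ in um *.
  have -> : c *: u + u' - (c *: a + b) = c *: (u - a) + (u' - b) by module R[i].
  rewrite (le_lt_trans (nrmD _ _)) // nrmZ [d]splitr ler_ltD //.
  rewrite ltW //; move: ul; rewrite ltr_pdivlMr // mulrC; apply: le_lt_trans.
  by rewrite ler_wpM2r ?nrm_ge0 // lerDl.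
- have d2 : 0 < d / 2 by rewrite divr_gt0.
  have [w /(_ _ d2)[l wl] uw] := uP _ d2; exists l.
  by rewrite (le_lt_trans (nrmB_tri w _ _)) // [d]splitr ltrD.
- by exists [:: (1, j)]; rewrite big_seq1 /= scale1r subrr nrm0.
Qed.

(** * Automatic contractivity *)

Section cstar_facts.
Variables (R : realType) (A : cstarAlgType R).
Implicit Types a b c h : A.

Lemma amulBl a b c : (a - b) ** c = a ** c - b ** c.
Proof. by rewrite -scaleN1r amulDl amulZl scaleN1r. Qed.

Lemma amulBr a b c : a ** (b - c) = a ** b - a ** c.
Proof. by rewrite -scaleN1r amulDr amulZr scaleN1r. Qed.

Lemma starB a b : star (a - b) = star a - star b.
Proof. by rewrite -scaleN1r starD starZ rmorphN1 scaleN1r. Qed.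

Lemma star0 : star 0 = 0 :> A.
Proof. by rewrite -[in LHS](subrr (0 : A)) starB subrr. Qed.

Lemma nrm_amul a b : nrm (a ** b) <= nrm a * nrm b.
Proof. by rewrite -lecR rmorphM /= -!nrmE norm_amul. Qed.

Lemma nrm_star_amul a : nrm (star a ** a) = nrm a ^+ 2.
Proof. by apply: complexI; rewrite -nrmE norm_star_amul rmorphXn /= -nrmE. Qed.

Lemma nrm_star_le a : nrm a <= nrm (star a).
Proof.
have [->|a0] := eqVneq a 0; first by rewrite star0.
by rewrite -(ler_pM2r (nrm_gt0 a0)) -expr2 -nrm_star_amul nrm_amul.
Qed.

Lemma nrm_star a : nrm (star a) = nrm a.
Proof. by apply/eqP; rewrite eq_le nrm_star_le andbT -{2}(starK a) nrm_star_le. Qed.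

Lemma star_amul_eq0 a : star a ** a = 0 -> a = 0.
Proof.
move=> a0; apply: nrm0_eq0; apply/eqP.
by rewrite -sqrf_eq0 -nrm_star_amul a0 nrm0.
Qed.

(** The element [c] is the fixed point of [c = (h + c ** c) / 2], a contraction
    of the ball of radius [nrm h].  The radius is [nrm h] because
    [(r + r ^+ 2) / 2 <= r] for [r <= 1]; each iteration multiplies the
    residue by at most [r]. *)
Lemma one_sub_sqrt h : star h = h -> nrm h < 1 ->
  exists2 c, star c = c & h = c + c - c ** c.
Proof.
move=> hh h1; set r := nrm h in h1.
have r0 : 0 <= r by exact: nrm_ge0.
pose res c := h - (c + c - c ** c).
have sqB c d : nrm c <= r -> nrm d <= r -> nrm (c ** c - d ** d) <= 2 * r * nrm (c - d).
  move=> cr dr; have -> : c ** c - d ** d = (c - d) ** c + d ** (c - d).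
    by rewrite amulBl amulBr addrA subrK.
  rewrite (le_trans (nrmD _ _)) // (le_trans (lerD (nrm_amul _ _) (nrm_amul _ _))) //.
  by have := nrm_ge0 (c - d); nra.
have half (x : A) : nrm ((2^-1)%:C%C *: x) = 2^-1 * nrm x.
  by rewrite nrmZr ger0_norm // invr_ge0.
have dbl (x : A) : (2^-1)%:C%C *: x + (2^-1)%:C%C *: x = x.
  have -> : (2^-1 : R) = 1 / 2 by rewrite div1r.
  by rewrite -scalerDl -rmorphD /= -splitr scale1r.
have resE c d : res c - res d = (c ** c - d ** d) - ((c - d) + (c - d)).
  by rewrite /res; module R[i].
have iter n : exists c, [/\ star c = c, nrm c <= r & nrm (res c) <= r ^+ n].
  elim: n => [|n [c [cs cr cres]]].
    exists 0; rewrite star0 nrm0; split=> //.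
    by rewrite /res amul0 addr0 !subr0 expr0 ltW.
  set d := (2^-1)%:C%C *: (h + c ** c).
  have dd : d + d = h + c ** c by exact: dbl.
  have dr : nrm d <= r.
    rewrite half (le_trans (ler_wpM2l _ (nrmD _ _))) ?invr_ge0 //.
    by have := nrm_amul c c; have := nrm_ge0 c; rewrite -/r; nra.
  exists d; split=> //.
    by rewrite starZ conjc_real starD starM hh cs.
  have dc : d - c = (2^-1)%:C%C *: res c.
    by rewrite -[X in _ - X](dbl c) /res /d; module R[i].
  have -> : res d = d ** d - c ** c.
    by rewrite /res dd; module R[i].
  rewrite (le_trans (sqB _ _ dr cr)) // dc half exprS mulrA -[2 * r]mulrC mulfK ?pnatr_eq0 //.
  exact: ler_wpM2l.
pose F (e : R) := [set c | [/\ star c = c, nrm c <= r & nrm (res c) < e]].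
have F0 e : 0 < e -> F e !=set0.
  move=> e0; have /cvgrPdist_lt/(_ e e0)[n _ /(_ n (leqnn n))] : (r ^+ n @[n --> \oo] --> 0).
    by apply: cvg_expr; rewrite ger0_norm.
  rewrite sub0r normrN ger0_norm ?exprn_ge0 // => rn.
  by have [c [cs cr cn]] := iter n; exists c; split=> //; exact: le_lt_trans rn.
have [| |e e0|l Fl] := @nrm_complete _ A F.
- by move=> d e de c [cs cr cd]; split=> //; exact: lt_le_trans de.
- exact: F0.
- have r1 : 0 < 1 - r by rewrite subr_gt0.
  exists (e * (1 - r)); first by rewrite mulr_gt0.
  move=> c d [_ cr cres] [_ dr dres].
  have := nrmD (c ** c - d ** d) (- (res c - res d)); rewrite nrmN.
  have -> : (c ** c - d ** d) + - (res c - res d) = (c - d) + (c - d).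
    by rewrite resE; module R[i].
  have := sqB _ _ cr dr; have := nrmD (res c) (- res d); rewrite nrmN.
  have -> : nrm (c - d + (c - d)) = 2 * nrm (c - d).
    by rewrite -[in RHS](dbl (c - d)) -scalerDr half mulVKf ?pnatr_eq0.
  by nra.
have Fd e : 0 < e -> exists2 c, F e c & nrm (l - c) < e.
  move=> e0; have [d d0 Fld] := Fl e e0.
  have [|c [cs cr cres]] := F0 (Num.min d e); first by rewrite lt_min d0.
  exists c.
    by split=> //; rewrite (lt_le_trans cres) // ge_min lexx orbT.
  by apply: Fld; split=> //; rewrite (lt_le_trans cres) // ge_min lexx.
exists l.
  apply/eqP; rewrite -subr_eq0; apply/eqP/(@nrm_small_eq0 _ _ 2) => e e0.
  have [c [cs _ _] lc] := Fd e e0.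
  rewrite (le_trans (nrmB_tri c _ _)) // -{1}cs -starB nrm_star (nrmB c).
  by rewrite mulr_natl mulr2n lerD // ltW.
suff : res l = 0 by move/eqP; rewrite /res subr_eq0 => /eqP.
apply: (@nrm_small_eq0 _ _ (nrm l + r + 2 + 1)) => e e0.
have [c [_ cr cres] lc] := Fd e e0.
rewrite -(subrK (res c) (res l)) (le_trans (nrmD _ _)) //.
rewrite resE mulrDl mul1r lerD ?(ltW cres) //.
have -> : l ** l - c ** c = (l - c) ** l + c ** (l - c).
  by rewrite amulBl amulBr addrA subrK.
rewrite (le_trans (nrmD _ _)) // nrmN.
have := nrmD ((l - c) ** l) (c ** (l - c)).
have := nrmD (l - c) (l - c).
have := nrm_amul (l - c) l; have := nrm_amul c (l - c).
have := nrm_ge0 l; have := nrm_ge0 (l - c); have := nrm_ge0 c.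
by nra.
Qed.
End cstar_facts.

(** The hypothesis says that [w y] behaves like [y] applied to [xi], but does
    not require [w] to be continuous.  For [star y ** y = c + c - c ** c] it
    gives
      [nrm xi ^+ 2 - nrm (w y) ^+ 2 = nrm (xi - w c) ^+ 2],
    which is nonnegative. *)
Lemma gram_contractive (R : realType) (Y : cstarAlgType R) (H : hilbertType R)
    (xi : H) (w : Y -> H) :
  linear w -> (forall y z, inner (w y) (w z) = inner xi (w (star y ** z))) ->
  forall y, nrm (w y) <= nrm y * nrm xi.
Proof.
move=> wl wg.
have wZ c y : w (c *: y) = c *: w y.
  have w0 : w 0 = 0 by have := wl (-1) 0 0; rewrite scaler0 addr0 scaleN1r addNr.
  by have := wl c y 0; rewrite w0 !addr0.
have wD y z : w (y + z) = w y + w z by have := wl 1 y z; rewrite !scale1r.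
have wN y : w (- y) = - w y by rewrite -scaleN1r wZ scaleN1r.
have wlt1 y : nrm y < 1 -> nrm (w y) <= nrm xi.
  move=> y1; have [||c cs yc] := @one_sub_sqrt _ _ (star y ** y).
  - by rewrite starM starK.
  - by rewrite nrm_star_amul exprn_ilt1 ?nrm_ge0.
  rewrite -(@ler_pXn2r _ 2) ?nnegrE ?nrm_ge0 // !nrm2E wg yc -subr_ge0.
  have wcc : inner xi (w (c ** c)) = inner (w c) (w c) by rewrite wg cs.
  rewrite !wD wN !innerDr innerNr wcc.
  have := sqr_ge0 (nrm (xi - w c)); rewrite nrm2E innerBl !innerBr.
  have -> : inner (w c) xi = conjc (inner xi (w c)) by rewrite inner_conj.
  move: (inner xi xi) (inner xi (w c)) (inner (w c) (w c)) => [a ?] [b ?] [d ?] /=.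
  by lra.
move=> y; apply/ler_addgt0Pr => e e0.
have x1 : 0 < nrm xi + 1 by rewrite ltr_wpDl ?nrm_ge0.
pose m := nrm y + e / (nrm xi + 1).
have m0 : 0 < m by rewrite ltr_wpDl ?nrm_ge0 // divr_gt0.
have /wlt1 : nrm (m^-1%:C%C *: y) < 1.
  by rewrite nrmZr gtr0_norm ?invr_gt0 // mulrC ltr_pdivrMr // mul1r ltrDl divr_gt0.
rewrite wZ nrmZr gtr0_norm ?invr_gt0 // mulrC ler_pdivrMr //.
move=> /le_trans; apply; rewrite mulrC mulrDl lerD2l.
by rewrite mulrAC ler_pdivrMr // ler_wpM2l ?ltW // ltrDl.
Qed.

Lemma star_hom_contractive (R : realType) (Y : cstarAlgType R) (H : hilbertType R)
    (pi : Y -> bop H) : star_hom pi -> forall y, nrm (pi y) <= nrm y.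
Proof.
move=> [pl pM pS] y; rewrite nrm_bopE; apply: opnorm_le => [|x]; first exact: nrm_ge0.
apply: (@gram_contractive _ _ _ x (fun y => pi y x)) => [c a b|a b].
  by rewrite pl.
by rewrite pM pS adjointE.
Qed.

(** * Inner products and bounded extensions *)

Section inner_continuity.
Variables (R : realType) (H : hilbertType R).
Implicit Types x y z : H.

Lemma nrm_inner x y : nrm (inner x y : R[i]^o) <= nrm x * nrm y.
Proof. by rewrite -lecR rmorphM /= -!nrmE cauchy_schwarz. Qed.

Lemma nrm_innerBr z x y : nrm ((inner z x : R[i]^o) - inner z y) <= nrm z * nrm (x - y).
Proof. by rewrite -innerBr nrm_inner. Qed.

Lemma inner_suml I (s : seq I) (F : I -> H) z :
  inner (\sum_(i <- s) F i) z = \sum_(i <- s) inner (F i) z.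
Proof. exact: (big_morph (fun x => inner x z) (fun x y => innerDl x y z) (inner0l z)). Qed.

Lemma inner_sumr I (s : seq I) (F : I -> H) z :
  inner z (\sum_(i <- s) F i) = \sum_(i <- s) inner z (F i).
Proof. exact: (big_morph (inner z) (innerDr z) (inner0r z)). Qed.

Lemma bop_sumE I (s : seq I) (F : I -> bop H) x :
  (\sum_(i <- s) F i) x = \sum_(i <- s) F i x.
Proof. exact: (big_morph (fun T : bop H => T x)). Qed.

Lemma bop_sum I (s : seq I) (F : I -> H) (T : bop H) :
  T (\sum_(i <- s) F i) = \sum_(i <- s) T (F i).
Proof. exact: (big_morph T (bopDl T) (bop0 T)). Qed.

End inner_continuity.

Lemma mul_conjc_nrm (R : realType) (z : R[i]) :
  z * conjc z = (nrm (z : R[i]^o) ^+ 2)%:C%C.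
Proof.
rewrite -sqr_normc; have -> : `|z| = (nrm (z : R[i]^o))%:C%C by exact: (nrmE (z : R[i]^o)).
by rewrite -rmorphXn.
Qed.

(** A densely defined bounded operator is given by its graph [G], so that it
    need not be checked separately that its values are well defined. *)
Section extension_by_density.
Variables (R : realType) (H : completeNormedModType R[i]).
Variables (G : H -> H -> Prop) (k : R).
Hypothesis k0 : 0 <= k.
Hypothesis G_linear :
  forall c u v u' v', G u v -> G u' v' -> G (c *: u + u') (c *: v + v').
Hypothesis G_bounded : forall u v, G u v -> nrm v <= k * nrm u.
Hypothesis G_dense :
  forall x (e : R), 0 < e -> exists u v, G u v /\ nrm (x - u) < e.

Let G_dist u v u' v' : G u v -> G u' v' -> nrm (v - v') <= k * nrm (u - u').
Proof.
have flip (x y : H) : x - y = -1 *: y + x by rewrite scaleN1r addrC.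
by move=> Guv Guv'; rewrite !flip; apply: G_bounded; exact: G_linear.
Qed.

(** The inequality characterizes the value of the extension at [x], also when
   [x] is in the domain of [G]. *)
Let value x : exists l, forall u v, G u v -> nrm (l - v) <= k * nrm (x - u).
Proof.
pose F (e : R) := [set v | exists2 u, G u v & nrm (x - u) < e].
have [| |e e0|l Fl] := @nrm_complete _ H F.
- by move=> d e de v [u Guv xu]; exists u => //; exact: lt_le_trans de.
- by move=> e /(G_dense x)[u [v [Guv xu]]]; exists v, u.
- have k1 : 0 < 2 * k + 1 by rewrite ltr_wpDl // mulr_ge0.
  exists (e / (2 * k + 1)); first by rewrite divr_gt0.
  move=> v v' [u Guv]; rewrite ltr_pdivlMr // => xu [u' Guv'].
  rewrite ltr_pdivlMr // => xu'.
  have := G_dist Guv Guv'; have := ler_wpM2l k0 (nrmB_tri x u u').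
  rewrite (nrmB u x); have := nrm_ge0 (x - u); have := nrm_ge0 (x - u').
  by lra.
exists l => u v Guv; apply/ler_addgt0Pr => e e0.
have k1 : 0 < 2 * k + 2 by rewrite ltr_wpDl // mulr_ge0.
have e1 : 0 < e / (2 * k + 2) by rewrite divr_gt0.
have [d d0 Fd] := Fl _ e1.
have [|u' [v' [Guv' ]]] := G_dense x (e := Num.min d (e / (2 * k + 2))).
  by rewrite lt_min d0.
rewrite lt_min => /andP[xd]; rewrite ltr_pdivlMr // => xe.
have /Fd : F d v' by exists u'.
rewrite ltr_pdivlMr // => lv'.
have := nrmB_tri v' l v; have := G_dist Guv' Guv.
have := ler_wpM2l k0 (nrmB_tri x u' u); rewrite (nrmB u' x).
have := nrm_ge0 (x - u'); have := mulr_ge0 k0 (nrm_ge0 (l - v')).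
by lra.
Qed.

Lemma bop_extend :
  exists2 T : bop H, (forall u v, G u v -> T u = v) & opnorm T <= k.
Proof.
pose L x := projT1 (cid (value x)).
have LE x u v : G u v -> nrm (L x - v) <= k * nrm (x - u).
  by rewrite /L; case: cid => l /= ; apply.
have Llin : linear L.
  move=> c x y; apply/eqP; rewrite -subr_eq0; apply/eqP.
  set m := complex.Re `|c|; have m0 : 0 <= m by exact: Re_norm_ge0.
  apply: (@nrm_small_eq0 _ _ (2 * k * (m + 1))) => e e0.
  have [u [v [Guv xu]]] := G_dense x e0; have [u' [v' [Guv' yu']]] := G_dense y e0.
  rewrite (le_trans (nrmB_tri (c *: v + v') _ _)) //.
  have := LE (c *: x + y) _ _ (G_linear c Guv Guv').
  have -> : c *: x + y - (c *: u + u') = c *: (x - u) + (y - u') by module R[i].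
  have := nrmD (c *: (x - u)) (y - u'); rewrite nrmZ -/m.
  have -> : c *: v + v' - (c *: L x + L y) = c *: (v - L x) + (v' - L y) by module R[i].
  have := nrmD (c *: (v - L x)) (v' - L y); rewrite nrmZ -/m.
  have := LE x _ _ Guv; have := LE y _ _ Guv'.
  rewrite (nrmB v) (nrmB v').
  have := nrm_ge0 (x - u); have := nrm_ge0 (y - u').
  move: (nrm (x - u)) (nrm (y - u')) xu yu' => a b ae be a0 b0 h1 h2 h3 h4 h5.
  have ka : k * a <= k * e by rewrite ler_wpM2l // ltW.
  have kb : k * b <= k * e by rewrite ler_wpM2l // ltW.
  have mka : m * (k * a) <= m * (k * e) by rewrite ler_wpM2l.
  have mh2 := ler_wpM2l m0 h2.
  have kh4 := ler_wpM2l k0 h4.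
  by lra.
have Lbnd x : nrm (L x) <= k * nrm x.
  apply/ler_addgt0Pr => e e0.
  have k1 : 0 < 2 * k + 1 by rewrite ltr_wpDl // mulr_ge0.
  have [|u [v [Guv]]] := G_dense x (e := e / (2 * k + 1)); first by rewrite divr_gt0.
  rewrite ltr_pdivlMr // => xu.
  have := LE x _ _ Guv; have := G_bounded Guv; have := nrm_dist (L x) v.
  have := ler_wpM2l k0 (nrm_dist u x); rewrite (nrmB u); have := nrm_ge0 (x - u).
  by lra.
exists (Bop Llin (ex_intro _ k Lbnd)).
  move=> u v Guv; apply/eqP; rewrite -subr_eq0; apply/eqP/nrm0_eq0/eqP.
  by rewrite eq_le nrm_ge0 andbT (le_trans (LE u _ _ Guv)) // subrr nrm0 mulr0.
by apply: opnorm_le.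
Qed.

End extension_by_density.

(** * Tensor products of operators *)

Section tensor_operators.
Variables (R : realType) (H1 H2 : hilbertType R) (HT : hilbert_tensor H1 H2).
Implicit Types (S : bop H1) (T : bop H2) (l : seq (H1 * H2)).

Definition tens l : HT := \sum_(p <- l) ht_tens HT p.1 p.2.

Lemma tensZl c x y : ht_tens HT (c *: x) y = c *: ht_tens HT x y.
Proof.
have h0 : ht_tens HT 0 y = 0.
  by have := ht_linearl HT y (-1) 0 0; rewrite scaler0 addr0 scaleN1r addNr.
by have := ht_linearl HT y c x 0; rewrite h0 !addr0.
Qed.

Lemma tens_dense (x : HT) (e : R) : 0 < e -> exists l, nrm (x - tens l) < e.
Proof.
move=> e0; have /dense_nrmP/(_ x e e0)[_ [z _ <-] xz] := @ht_dense _ _ _ HT.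
by exists (repr z).
Qed.

Lemma tens_linear c l l' :
  tens ([seq (c *: p.1, p.2) | p <- l] ++ l') = c *: tens l + tens l'.
Proof.
rewrite /tens big_cat big_map scaler_sumr; congr (_ + _).
by apply: eq_bigr => p _; rewrite tensZl.
Qed.

Lemma inner_tens l l' :
  inner (tens l) (tens l') =
  \sum_(p <- l) \sum_(q <- l') inner p.1 q.1 * inner p.2 q.2.
Proof.
rewrite inner_suml; apply: eq_bigr => p _.
by rewrite inner_sumr; apply: eq_bigr => q _; rewrite ht_inner.
Qed.

(** [bop H1] is a C*-algebra that acts on formal sums of elementary tensors
   through the first factor, so [gram_contractive] applies. *)
Let tensl_bound S l : nrm (tens [seq (S p.1, p.2) | p <- l]) <= nrm S * nrm (tens l).
Proof.
apply: (@gram_contractive _ _ _ (tens l) (fun S => tens [seq (S p.1, p.2) | p <- l])).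
  move=> c U V; rewrite /tens !big_map scaler_sumr -big_split.
  by apply: eq_bigr => p _; exact: ht_linearl.
move=> U V; rewrite !inner_tens big_map; apply: eq_bigr => p _.
by rewrite !big_map; apply: eq_bigr => q _; rewrite /= adjointE.
Qed.

Let tensr_bound T l : nrm (tens [seq (p.1, T p.2) | p <- l]) <= nrm T * nrm (tens l).
Proof.
apply: (@gram_contractive _ _ _ (tens l) (fun T => tens [seq (p.1, T p.2) | p <- l])).
  move=> c U V; rewrite /tens !big_map scaler_sumr -big_split.
  by apply: eq_bigr => p _; exact: ht_linearr.
move=> U V; rewrite !inner_tens big_map; apply: eq_bigr => p _.
by rewrite !big_map; apply: eq_bigr => q _; rewrite /= adjointE.
Qed.

(** The operator [op_tensor HT S T] is chosen among the operators with this
    property and is 0 if there are none, so the content is that one exists. *)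
Lemma op_tensorE S T x y :
  op_tensor HT S T (ht_tens HT x y) = ht_tens HT (S x) (T y).
Proof.
rewrite /op_tensor.
suff [W WE] : exists W : bop HT,
    forall x y, W (ht_tens HT x y) = ht_tens HT (S x) (T y).
  by case: xgetP => [V _ /= ->//|/(_ W)/= []].
pose G u v := exists2 l, u = tens l & v = tens [seq (S p.1, T p.2) | p <- l].
have [||_ _ [l -> ->]|z e e0|W WE _] := @bop_extend _ HT G (nrm S * nrm T).
- by rewrite mulr_ge0 // nrm_ge0.
- move=> c _ _ _ _ [l -> ->] [l' -> ->].
  (* Scalars of formal sums are absorbed in the first factors. *)
  exists ([seq (c *: p.1, p.2) | p <- l] ++ l'); first by rewrite tens_linear.
  by rewrite -tens_linear map_cat -!map_comp; congr (tens (_ ++ _)); apply: eq_map => p /=; rewrite bopZl.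
- have -> : [seq (S p.1, T p.2) | p <- l] =
      [seq (S p.1, p.2) | p <- [seq (p.1, T p.2) | p <- l]].
    by rewrite -map_comp.
  rewrite (le_trans (tensl_bound _ _)) // -mulrA ler_wpM2l ?nrm_ge0 //.
- have [l zl] := tens_dense z e0.
  by exists (tens l), (tens [seq (S p.1, T p.2) | p <- l]); split=> //; exists l.
exists W => x' y'.
have h (p : H1 * H2) : ht_tens HT p.1 p.2 = tens [:: p] by rewrite /tens big_seq1.
rewrite (h (x', y')) (h (S x', T y')); apply: WE.
by exists [:: (x', y')].
Qed.

Lemma op_tensor_tens S T l :
  op_tensor HT S T (tens l) = tens [seq (S p.1, T p.2) | p <- l].
Proof.
by rewrite bop_sum /tens big_map; apply: eq_bigr => p _; rewrite op_tensorE.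
Qed.

Lemma bop_tens_eq (U W : bop HT) :
  (forall x y, U (ht_tens HT x y) = W (ht_tens HT x y)) -> U = W.
Proof.
move=> UW; apply/bopP => z; apply/eqP; rewrite -subr_eq0.
rewrite -[_ - _]/((U - W : bop HT) z); apply/eqP/(@nrm_small_eq0 _ _ (opnorm (U - W))) => e e0.
have [l zl] := tens_dense z e0.
have : (U - W : bop HT) (tens l) = 0.
  by rewrite bop_sum big1 // => p _; rewrite -[LHS]/(U _ - W _) UW subrr.
move=> UWl; rewrite -[X in nrm X]subr0 -UWl -bopB (le_trans (le_opnorm _ _)) //.
by rewrite ler_wpM2l ?opnorm_ge0 // ltW.
Qed.

Lemma op_tensor_linearl T : linear ((op_tensor HT)^~ T).
Proof.
move=> c S S'; apply: bop_tens_eq => x y.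
by rewrite -[RHS]/(c *: op_tensor HT S T _ + op_tensor HT S' T _) !op_tensorE ht_linearl.
Qed.

Lemma op_tensor_linearr S : linear (op_tensor HT S).
Proof.
move=> c T T'; apply: bop_tens_eq => x y.
by rewrite -[RHS]/(c *: op_tensor HT S T _ + op_tensor HT S T' _) !op_tensorE ht_linearr.
Qed.

End tensor_operators.

(** * Hilbert direct sums *)

Section partial_sums.
Variable I : countType.

(** Infinite sums over [I] are limits of these partial sums, in which the
    indices come in the order of their codes. *)
Definition psum (V : nmodType) (n : nat) (f : I -> V) : V :=
  \sum_(m < n) oapp f 0 (pickle_inv m).

Lemma psumS (V : nmodType) n (f : I -> V) :
  psum n.+1 f = psum n f + oapp f 0 (pickle_inv n).
Proof. by rewrite /psum big_ord_recr. Qed.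

Lemma psum_add (V : nmodType) n (f g : I -> V) :
  psum n (fun i => f i + g i) = psum n f + psum n g.
Proof. by rewrite /psum -big_split; apply: eq_bigr => m _; case: pickle_inv => //=; rewrite addr0. Qed.

Lemma psum_morph (V W : nmodType) (phi : V -> W) n (f : I -> V) :
  {morph phi : u v / u + v} -> phi 0 = 0 ->
  psum n (fun i => phi (f i)) = phi (psum n f).
Proof.
move=> phiD phi0; rewrite /psum (big_morph phi phiD phi0).
by apply: eq_bigr => m _; case: pickle_inv => //=; rewrite phi0.
Qed.

Lemma eq_psum (V : nmodType) n (f g : I -> V) : f =1 g -> psum n f = psum n g.
Proof. by move=> fg; apply: eq_bigr => m _; case: pickle_inv => //= i; rewrite fg. Qed.

Lemma eq_psum_in (V : nmodType) n (f g : I -> V) :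
  (forall i, (pickle i < n)%N -> f i = g i) -> psum n f = psum n g.
Proof.
move=> fg; apply: eq_bigr => m _.
by have := pickle_invK (T := I) m; case: pickle_inv => //= i im; rewrite fg // im.
Qed.

Lemma psum_single (V : nmodType) n i (f : I -> V) :
  (forall j, j != i -> f j = 0) -> (pickle i < n)%N -> psum n f = f i.
Proof.
move=> f0 ni; rewrite /psum (bigD1 (Ordinal ni)) //= pickleK_inv /= big1 ?addr0 //.
move=> m mi; have := pickle_invK (T := I) m; case: pickle_inv => //= j jm.
by rewrite f0 //; apply: contraNneq mi => ji; apply/eqP/val_inj; rewrite /= -jm ji.
Qed.

Lemma ler_psum (R : numDomainType) n (f g : I -> R) :
  (forall i, f i <= g i) -> psum n f <= psum n g.
Proof. by move=> fg; apply: ler_sum => m _; case: pickle_inv => //=. Qed.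

Lemma psum_homo (R : numDomainType) (f : I -> R) : (forall i, 0 <= f i) ->
  {homo (fun n => psum n f) : m n / (m <= n)%N >-> m <= n}.
Proof.
move=> f0 m n; elim: n => [|n IH]; first by rewrite leqn0 => /eqP ->.
rewrite leq_eqVlt => /predU1P[->//|/IH /le_trans]; apply.
by rewrite psumS lerDl; case: pickle_inv => //=.
Qed.

End partial_sums.

Section complex_limits.
Variable R : realType.
Implicit Types (s t : nat -> R[i]) (l m : R[i]).

(** Convergence of real and imaginary parts, which follows from monotone
    convergence of the norms by polarization. *)
Definition clim s l : Prop :=
  ((fun n => complex.Re (s n)) @ \oo --> complex.Re l) /\
  ((fun n => complex.Im (s n)) @ \oo --> complex.Im l).

Lemma clim_unique s l m : clim s l -> clim s m -> l = m.
Proof.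
move=> [rl il] [rm im].
have := norm_cvg_unique rl rm; have := norm_cvg_unique il im.
by case: l m {rl il rm im} => [a b] [c d] /= -> ->.
Qed.

Lemma climD s t l m : clim s l -> clim t m -> clim (fun n => s n + t n) (l + m).
Proof.
move=> [rs is_] [rt it]; rewrite /clim raddfD /= [complex.Im (l + m)]raddfD.
split; under eq_fun do rewrite raddfD /=; exact: cvgD.
Qed.

Lemma climZ c s l : clim s l -> clim (fun n => c * s n) (c * l).
Proof.
case: c => a b [rs is_]; rewrite /clim; case: l rs is_ => x y /= rs is_; split.
  have -> : (fun n => complex.Re ((a +i* b)%C * s n)) =
      (fun n => a * complex.Re (s n) - b * complex.Im (s n)).
    by apply/funext => n; case: (s n).
  by apply: cvgB; apply: cvgMl_tmp.
have -> : (fun n => complex.Im ((a +i* b)%C * s n)) =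
    (fun n => a * complex.Im (s n) + b * complex.Re (s n)).
  by apply/funext => n; case: (s n).
by apply: cvgD; apply: cvgMl_tmp.
Qed.

Lemma clim_conj s l : clim s l -> clim (fun n => conjc (s n)) (conjc l).
Proof.
move=> [rs is_]; rewrite /clim; case: l rs is_ => x y /= rs is_; split.
  by have -> : (fun n => complex.Re (conjc (s n))) = (fun n => complex.Re (s n))
    by apply/funext => n; case: (s n).
have -> : (fun n => complex.Im (conjc (s n))) = (fun n => - complex.Im (s n)).
  by apply/funext => n; case: (s n).
exact: cvgN.
Qed.

Lemma clim_near s l (N : nat) : (forall n, (N <= n)%N -> s n = l) -> clim s l.
Proof.
by move=> sl; split; apply: cvg_near_cst; exists N => // n /sl ->.
Qed.

End complex_limits.

Section direct_sum.
Variables (R : realType) (I : countType) (F : I -> hilbertType R).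

(** The Hilbert direct sum of the [F i]. *)
Record dsum := Dsum {
  dsum_fun :> forall i, F i;
  dsum_bounded : exists k : R, forall n, psum n (fun i => nrm (dsum_fun i) ^+ 2) <= k
}.

Implicit Types x y z : dsum.

Lemma dsumP x y : (forall i, x i = y i) -> x = y.
Proof.
case: x y => [f fb] [g gb] /= fg.
have e : f = g by apply: functional_extensionality_dep.
by case: _ / e in gb fg *; congr Dsum; exact: Prop_irrelevance.
Qed.

HB.instance Definition _ := gen_eqMixin dsum.
HB.instance Definition _ := gen_choiceMixin dsum.

Let zero_bounded : exists k : R, forall n, psum n (fun i => nrm (0 : F i) ^+ 2) <= k.
Proof.
exists 0 => n; rewrite /psum big1 // => m _.
by case: pickle_inv => //= i; rewrite nrm0 expr0n.
Qed.
Definition dsum_zero := Dsum zero_bounded.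

Let add_bounded x y : exists k : R, forall n, psum n (fun i => nrm (x i + y i) ^+ 2) <= k.
Proof.
have [k xk] := dsum_bounded x; have [l yl] := dsum_bounded y.
exists (2 * (k + l)) => n.
apply: (@le_trans _ _ (psum n (fun i => 2 * (nrm (x i) ^+ 2 + nrm (y i) ^+ 2)))).
  by apply: ler_psum => i; rewrite -parallelogram lerDl sqr_ge0.
rewrite (@psum_morph _ _ _ (fun u : R => 2 * u)); [|exact: mulrDr|exact: mulr0].
by rewrite ler_wpM2l // psum_add lerD.
Qed.
Definition dsum_add x y := Dsum (add_bounded x y).

Let scale_bounded (c : R[i]) x :
  exists k : R, forall n, psum n (fun i => nrm (c *: x i) ^+ 2) <= k.
Proof.
have [k xk] := dsum_bounded x; exists (complex.Re `|c| ^+ 2 * k) => n.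
rewrite (eq_psum _ (g := fun i => complex.Re `|c| ^+ 2 * nrm (x i) ^+ 2)); last first.
  by move=> i; rewrite nrmZ exprMn.
rewrite (@psum_morph _ _ _ (fun u : R => complex.Re `|c| ^+ 2 * u)); [|exact: mulrDr|exact: mulr0].
by rewrite ler_wpM2l // sqr_ge0.
Qed.
Definition dsum_scale c x := Dsum (scale_bounded c x).

Let opp_bounded x : exists k : R, forall n, psum n (fun i => nrm (- x i) ^+ 2) <= k.
Proof.
have [k xk] := dsum_bounded x; exists k => n.
by rewrite (eq_psum _ (g := fun i => nrm (x i) ^+ 2)) // => i; rewrite nrmN.
Qed.
Definition dsum_opp x := Dsum (opp_bounded x).

Let dsum_addA : associative dsum_add.
Proof. by move=> x y z; apply/dsumP => i /=; rewrite addrA. Qed.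
Let dsum_addC : commutative dsum_add.
Proof. by move=> x y; apply/dsumP => i /=; rewrite addrC. Qed.
Let dsum_add0 : left_id dsum_zero dsum_add.
Proof. by move=> x; apply/dsumP => i /=; rewrite add0r. Qed.
Let dsum_addN : left_inverse dsum_zero dsum_opp dsum_add.
Proof. by move=> x; apply/dsumP => i /=; rewrite addNr. Qed.

HB.instance Definition _ :=
  GRing.isZmodule.Build dsum dsum_addA dsum_addC dsum_add0 dsum_addN.

Let dsum_scaleA c d x : dsum_scale c (dsum_scale d x) = dsum_scale (c * d) x.
Proof. by apply/dsumP => i /=; rewrite scalerA. Qed.
Let dsum_scale1 : left_id 1 dsum_scale.
Proof. by move=> x; apply/dsumP => i /=; rewrite scale1r. Qed.
Let dsum_scaleDr : right_distributive dsum_scale +%R.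
Proof. by move=> c x y; apply/dsumP => i /=; rewrite scalerDr. Qed.
Let dsum_scaleDl x : {morph dsum_scale^~ x : c d / c + d}.
Proof. by move=> c d; apply/dsumP => i /=; rewrite scalerDl. Qed.

HB.instance Definition _ := GRing.Zmodule_isLmodule.Build R[i] dsum
  dsum_scaleA dsum_scale1 dsum_scaleDr dsum_scaleDl.

Lemma dsumDE x y i : (x + y) i = x i + y i. Proof. by []. Qed.
Lemma dsumBE x y i : (x - y) i = x i - y i. Proof. by []. Qed.
Lemma dsumZE c x i : (c *: x) i = c *: x i. Proof. by []. Qed.

Let sqn n x : R := psum n (fun i => nrm (x i) ^+ 2).
Let ipn n x y : R[i] := psum n (fun i => inner (x i) (y i)).

Let sqn_homo x : {homo (fun n => sqn n x) : m n / (m <= n)%N >-> m <= n}.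
Proof. by move=> m n mn; apply: psum_homo => // i; exact: sqr_ge0. Qed.

Let sqn_cvg x : cvgn (fun n => sqn n x).
Proof.
apply: nondecreasing_is_cvgn; first exact: sqn_homo.
by have [k xk] := dsum_bounded x; exists k => _ [n _ <-]; exact: xk.
Qed.

Let Re_ipn n x y : complex.Re (ipn n x y) = 4^-1 * (sqn n (x + y) - sqn n (x - y)).
Proof.
rewrite /ipn -(@psum_morph _ _ _ (@complex.Re R)) //; last exact: raddfD.
rewrite /sqn -(@psum_morph _ _ _ (fun u : R => - u)) //; [|exact: opprD|exact: oppr0].
rewrite -psum_add -(@psum_morph _ _ _ (fun u : R => 4^-1 * u)) //; [|exact: mulrDr|exact: mulr0].
apply: eq_psum => i; rewrite dsumDE dsumBE !nrm2E innerBl !innerBr innerDl !innerDr.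
rewrite (inner_conj (x i) (y i)).
case: (inner (x i) (x i)) (inner (x i) (y i)) (inner (y i) (y i)) => [a ?] [b ?] [c ?] /=.
by field.
Qed.

Let Im_ipn n x y : complex.Im (ipn n x y) = complex.Re (ipn n x ('i%C *: y)).
Proof.
rewrite /ipn -(@psum_morph _ _ _ (@complex.Re R)) //; last exact: raddfD.
rewrite -(@psum_morph _ _ _ (@complex.Im R)) //; last exact: raddfD.
apply: eq_psum => i; rewrite dsumZE innerZr; case: (inner _ _) => a b /=.
by ring.
Qed.

Let Re_ipn_cvg x y : cvgn (fun n => complex.Re (ipn n x y)).
Proof.
under eq_fun do rewrite Re_ipn.
apply: is_cvgMl_tmp; apply: is_cvgB; exact: sqn_cvg.
Qed.

Let ip_ex x y : exists l, clim (fun n => ipn n x y) l.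
Proof.
have : cvgn (fun n => complex.Im (ipn n x y)).
  by under eq_fun do rewrite Im_ipn; exact: Re_ipn_cvg.
move=> /cvg_ex[b bl]; have /cvg_ex[a al] := @Re_ipn_cvg x y.
by exists (a +i* b)%C.
Qed.

Definition dsum_inner x y : R[i] := projT1 (cid (ip_ex x y)).

Lemma dsum_innerP x y :
  clim (fun n => psum n (fun i => inner (x i) (y i))) (dsum_inner x y).
Proof. by rewrite /dsum_inner; case: cid. Qed.

Let ipDZl c x y z : dsum_inner (c *: x + y) z = c * dsum_inner x z + dsum_inner y z.
Proof.
apply: clim_unique (dsum_innerP _ _) _.
have := climD (climZ c (dsum_innerP x z)) (dsum_innerP y z).
have e n : c * psum n (fun i => inner (x i) (z i)) + psum n (fun i => inner (y i) (z i)) =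
    psum n (fun i => inner ((c *: x + y) i) (z i)).
  rewrite -(@psum_morph _ _ _ (fun u => c * u)) //; [|exact: mulrDr|exact: mulr0].
  by rewrite -psum_add; apply: eq_psum => i; rewrite dsumDE dsumZE innerDZl.
by rewrite (funext e).
Qed.

Let ip_conj x y : dsum_inner y x = conjc (dsum_inner x y).
Proof.
apply: clim_unique (dsum_innerP _ _) _; have := climD (clim_conj (dsum_innerP x y)) (clim_near (l := 0) (N := 0) (fun _ _ => erefl)).
rewrite addr0.
have e n : conjc (psum n (fun i => inner (x i) (y i))) + 0 =
    psum n (fun i => inner (y i) (x i)).
  rewrite addr0 -(@psum_morph _ _ _ (@conjc R)) //; [|exact: raddfD|exact: raddf0].
  by apply: eq_psum => i; rewrite -inner_conj.
by rewrite (funext e).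
Qed.

Let sq x : R := complex.Re (dsum_inner x x).

Let sqn_ip n x : ipn n x x = (sqn n x)%:C%C.
Proof.
rewrite /ipn /sqn -(@psum_morph _ _ _ (fun u : R => u%:C%C)) //; last exact: rmorphD.
by apply: eq_psum => i; rewrite -norm_inner nrmE -rmorphXn.
Qed.

Let sq_cvg x : (fun n => sqn n x) @ \oo --> sq x.
Proof.
have [+ _] := dsum_innerP x x; rewrite -/(sq x).
by under eq_fun do rewrite -/(ipn _ x x) sqn_ip /=.
Qed.

Let ip_sq x : dsum_inner x x = (sq x)%:C%C.
Proof.
have [_ +] := dsum_innerP x x; under eq_fun do rewrite -/(ipn _ x x) sqn_ip /=.
move=> /norm_cvg_unique/(_ (cvg_cst _)); rewrite /sq.
by case: (dsum_inner x x) => a b /= ->.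
Qed.

Let sqn_le n x : sqn n x <= sq x.
Proof.
rewrite -(cvg_lim (@Rhausdorff R) (@sq_cvg x)).
by apply: nondecreasing_cvgn_le; [exact: sqn_homo|exact: sqn_cvg].
Qed.

Let sq_ge0 x : 0 <= sq x.
Proof. by rewrite (le_trans _ (sqn_le 0 x)) // /sqn /psum big_ord0. Qed.

Let coord_sq x i : nrm (x i) ^+ 2 <= sq x.
Proof.
rewrite (le_trans _ (sqn_le (pickle i).+1 x)) // /sqn psumS pickleK_inv /=.
by rewrite lerDr sumr_ge0 // => m _; case: pickle_inv => //= j; exact: sqr_ge0.
Qed.

Let sq_eq0 x : sq x = 0 -> x = 0.
Proof.
move=> x0; apply/dsumP => i; apply: nrm0_eq0; apply/eqP.
by rewrite -sqrf_eq0 eq_le sqr_ge0 andbT -x0 coord_sq.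
Qed.

Let ipDl x y z : dsum_inner (x + y) z = dsum_inner x z + dsum_inner y z.
Proof. by have := ipDZl 1 x y z; rewrite scale1r mul1r. Qed.
Let ip0l z : dsum_inner 0 z = 0.
Proof. by apply: (addrI (dsum_inner 0 z)); rewrite -ipDl !addr0. Qed.
Let ipZl c x z : dsum_inner (c *: x) z = c * dsum_inner x z.
Proof. by have := ipDZl c x 0 z; rewrite ip0l !addr0. Qed.
Let ipDr x y z : dsum_inner x (y + z) = dsum_inner x y + dsum_inner x z.
Proof. by rewrite ip_conj ipDl rmorphD /= -!ip_conj. Qed.
Let ipZr c x z : dsum_inner x (c *: z) = conjc c * dsum_inner x z.
Proof. by rewrite ip_conj ipZl rmorphM /= -ip_conj. Qed.

Let sqDZ (t : R) x y :
  sq (x + t%:C%C *: y) = sq x + 2 * t * complex.Re (dsum_inner x y) + t ^+ 2 * sq y.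
Proof.
rewrite /sq ipDl !ipDr !ipZl !ipZr (ip_conj x y).
case: (dsum_inner x x) (dsum_inner x y) (dsum_inner y y) => [a ?] [b ?] [c ?] /=.
by ring.
Qed.

Let sqZ c x : sq (c *: x) = complex.Re `|c| ^+ 2 * sq x.
Proof.
apply: complexI; rewrite -ip_sq ipZl ipZr ip_sq mulrA -sqr_normc.
have -> : `|c| = (complex.Re `|c|)%:C%C by rewrite RRe_real ?ger0_real.
by rewrite -rmorphXn -rmorphM.
Qed.

Let Re_ip_le x y : complex.Re (dsum_inner x y) <= Num.sqrt (sq x) * Num.sqrt (sq y).
Proof.
have [y0|y0] := eqVneq (sq y) 0.
  rewrite (sq_eq0 y0) ip_conj ip0l rmorph0 /=.
  by rewrite mulr_ge0 ?sqrtr_ge0.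
have sy : 0 < sq y by rewrite lt_neqAle eq_sym y0 sq_ge0.
set r := complex.Re _.
have : r ^+ 2 <= sq x * sq y.
  have := sq_ge0 (x + (- r / sq y)%:C%C *: y); rewrite sqDZ -/r.
  have -> : sq x + 2 * (- r / sq y) * r + (- r / sq y) ^+ 2 * sq y = sq x - r ^+ 2 / sq y.
    by field.
  by rewrite subr_ge0 ler_pdivrMr.
move=> rxy; rewrite -sqrtrM //; apply: le_trans (ler_norm r) _.
by rewrite -sqrtr_sqr ler_wsqrtr.
Qed.

Let dsum_norm x : R[i] := (Num.sqrt (sq x))%:C%C.
Let dsum_normD x y : dsum_norm (x + y) <= dsum_norm x + dsum_norm y.
Proof.
rewrite -rmorphD lecR -(@ler_pXn2r _ 2) ?nnegrE ?addr_ge0 ?sqrtr_ge0 //.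
have := sqDZ 1 x y; rewrite scale1r => e.
rewrite sqrrD !sqr_sqrtr // e; have := Re_ip_le x y; lra.
Qed.
Let dsum_normZ (c : R[i]) x : dsum_norm (c *: x) = `|c| * dsum_norm x.
Proof.
rewrite /dsum_norm sqZ sqrtrM ?sqr_ge0 // sqrtr_sqr ger0_norm ?Re_norm_ge0 //.
by rewrite rmorphM; congr (_ * _); exact/RRe_real/ger0_real.
Qed.
Let dsum_norm0_eq0 x : dsum_norm x = 0 -> x = 0.
Proof.
move=> /complexI/eqP; rewrite sqrtr_eq0 => x0; apply: sq_eq0.
by apply/eqP; rewrite eq_le x0 sq_ge0.
Qed.

HB.instance Definition _ := Lmodule_isNormed.Build R[i] dsum
  dsum_normD dsum_normZ dsum_norm0_eq0.

Let nrm_sq x : nrm x ^+ 2 = sq x. Proof. exact: sqr_sqrtr. Qed.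

Let nrm_coord x i : nrm (x i) <= nrm x.
Proof. by rewrite -(@ler_pXn2r _ 2) ?nnegrE ?nrm_ge0 // nrm_sq coord_sq. Qed.

Let dsum_complete (G : set_system dsum) : ProperFilter G -> cauchy G -> cvg G.
Proof.
move=> GF /cauchy_nrmP Gc.
have Gx i : exists l : F i, ((fun x : dsum => x i) @ G) --> l.
  apply/cvg_ex; apply: cauchy_cvg; apply/cauchy_nrmP => e e0.
  have [x Gxe] := Gc e e0; exists (x i); rewrite /fmap /=.
  move: Gxe; apply: filterS => y /= xy.
  by rewrite -dsumBE (le_lt_trans (nrm_coord _ _)).
pose L i := projT1 (cid (Gx i)).
have LE i : ((fun x : dsum => x i) @ G) --> L i by rewrite /L; case: cid.
have lim_sq x n :
    (fun y : dsum => psum n (fun i => nrm (x i - y i) ^+ 2)) @ G -->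
    psum n (fun i => nrm (x i - L i) ^+ 2).
  elim: n => [|n IH].
    by rewrite /psum; under eq_fun do rewrite big_ord0; rewrite big_ord0; exact: cvg_cst.
  under eq_fun do rewrite psumS; rewrite psumS; apply: cvgD => //.
  case: pickle_inv => [i|] /=; last exact: cvg_cst.
  have h : (fun y : dsum => nrm (x i - y i)) @ G --> nrm (x i - L i).
    apply/cvgrPdist_lt => e e0; have /cvg_nrmP/(_ e e0) := LE i.
    apply: filterS => y /= Ly; rewrite ltr_norml; apply/andP; split.
      rewrite ltrNl opprB (le_lt_trans (nrm_dist _ _)) //.
      by have -> : x i - y i - (x i - L i) = L i - y i by module R[i].
    rewrite (le_lt_trans (nrm_dist _ _)) //.
    have -> : x i - L i - (x i - y i) = - (L i - y i) by module R[i].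
    by rewrite nrmN.
  by under eq_fun do rewrite expr2; rewrite expr2; exact: cvgM.
have near_sq x e : 0 <= e -> G [set y | nrm (x - y) < e] ->
    forall n, psum n (fun i => nrm (x i - L i) ^+ 2) <= e ^+ 2.
  move=> e0 Gxe n; apply: cvgr_to_le (lim_sq x n) _; move: Gxe.
  apply: filterS => y /= xy.
  rewrite (le_trans (sqn_le n (x - y))) // -nrm_sq.
  by rewrite ler_pXn2r ?nnegrE ?nrm_ge0 //; exact: ltW.
have Lbnd : exists k : R, forall n, psum n (fun i => nrm (L i) ^+ 2) <= k.
  have [x Gx1] := Gc 1 ltr01.
  have d0 : exists k : R, forall n, psum n (fun i => nrm (x i - L i) ^+ 2) <= k.
    by exists (1 ^+ 2); exact: near_sq.
  have [k kP] := dsum_bounded (x - Dsum d0); exists k => n.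
  rewrite (le_trans _ (kP n)) //; apply: ler_psum => i.
  by rewrite dsumBE /= subKr.
apply/cvg_ex; exists (Dsum Lbnd); apply/cvg_nrmP => e e0.
have e2 : 0 < e / 2 / 2 by rewrite !divr_gt0.
have [x Gxe] := Gc _ e2; apply: filterS (Gxe) => y /= xy.
rewrite (le_lt_trans (nrmB_tri x _ _)) //.
have : nrm (x - Dsum Lbnd) <= e / 2 / 2.
  rewrite -(@ler_pXn2r _ 2) ?nnegrE ?nrm_ge0 ?(ltW e2) // nrm_sq.
  apply: cvgr_to_le (@sq_cvg _) _; apply: nearW => n.
  exact: near_sq (ltW e2) Gxe n.
rewrite nrmB => xL; rewrite (le_lt_trans (lerD xL (ltW xy))) //.
by rewrite -splitr ltr_pdivrMr // ltr_pMr // ltr1n.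
Qed.

HB.instance Definition _ := Uniform_isComplete.Build dsum dsum_complete.

Let dsum_norm_inner x : `|x| ^+ 2 = dsum_inner x x.
Proof. by rewrite ip_sq nrmE -rmorphXn nrm_sq. Qed.

HB.instance Definition _ := CompleteNormedModule_isHilbert.Build R dsum
  ipDZl ip_conj dsum_norm_inner.

Lemma dsum_nrm_cvg x :
  (fun n => psum n (fun i => nrm (x i) ^+ 2)) @ \oo --> nrm x ^+ 2.
Proof. by rewrite nrm_sq; exact: sq_cvg. Qed.

End direct_sum.

Section direct_sum_inclusions.
Variables (R : realType) (I : countType) (F : I -> hilbertType R).
Implicit Types (x y : dsum F).

Definition single_fun i (u : F i) (j : I) : F j :=
  if @eqP _ i j is ReflectT e then ecast k (F k) e u else 0.

Lemma single_funE i (u : F i) : single_fun u i = u.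
Proof. by rewrite /single_fun; case: eqP => // e; rewrite eq_axiomK. Qed.

Lemma single_funN i j (u : F i) : j != i -> single_fun u j = 0.
Proof. by rewrite /single_fun eq_sym; case: eqP. Qed.

Let single_bounded i (u : F i) :
  exists k : R, forall n, psum n (fun j => nrm (single_fun u j) ^+ 2) <= k.
Proof.
exists (nrm u ^+ 2) => n; set f := fun j => _.
rewrite (@le_trans _ _ (psum (maxn n (pickle i).+1) f)) //.
  by apply: psum_homo; [move=> j; exact: sqr_ge0 | exact: leq_maxl].
rewrite (@psum_single _ _ _ i) ?leq_max ?ltnS ?leqnn ?orbT //.
  by rewrite /f single_funE.
by move=> j ji; rewrite /f single_funN // nrm0 expr0n.
Qed.

Definition single i (u : F i) : dsum F := Dsum (single_bounded u).

Lemma singleE i (u : F i) : single u i = u.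
Proof. exact: single_funE. Qed.

Lemma singleN i j (u : F i) : j != i -> single u j = 0.
Proof. exact: single_funN. Qed.

Lemma inner_single i x (u : F i) : inner x (single u) = inner (x i) u.
Proof.
apply: clim_unique (dsum_innerP x (single u)) _.
apply: (@clim_near _ _ _ (pickle i).+1) => n ni.
rewrite (@psum_single _ _ _ i) ?singleE // => j ji.
by rewrite singleN // inner0r.
Qed.

Lemma inner_single_neq i j (u : F i) (v : F j) : i != j -> inner (single u) (single v) = 0.
Proof. by move=> ij; rewrite inner_single singleN ?inner0l // eq_sym. Qed.

Lemma inner_single_eq i (u v : F i) : inner (single u) (single v) = inner u v.
Proof. by rewrite inner_single singleE. Qed.

Lemma single_linear i : linear (@single i).
Proof.
move=> c u v; apply/dsumP => j; rewrite dsumDE dsumZE.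
have [->|ji] := eqVneq j i; first by rewrite !singleE.
by rewrite !singleN // scaler0 addr0.
Qed.

Lemma nrm_single i (u : F i) : nrm (single u) = nrm u.
Proof.
apply/eqP; rewrite -(@eqrXn2 _ 2 (nrm _)) ?nrm_ge0 //; apply/eqP.
by rewrite !nrm2E inner_single_eq.
Qed.

(** Removing the coordinates of [x] one by one leaves a rest whose squared norm
    is the tail of a convergent series. *)
Lemma dsum_spanned (P : set (dsum F)) : subspace P -> nrm_closed P ->
  (forall i (u : F i), P (single u)) -> forall x, P x.
Proof.
move=> Ps Pc P1 x.
pose part (r : dsum F) n : dsum F := oapp (fun i => single (r i)) 0 (pickle_inv n).
pose rest := fix rest n := if n is m.+1 then rest m - part (rest m) m else x.
have restS n : rest n.+1 = rest n - part (rest n) n by [].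
have partS r n j : pickle_inv n = Some j -> part r n = single (r j).
  by move=> nj; rewrite /part nj.
have partN r n : pickle_inv n = None :> option I -> part r n = 0.
  by move=> nj; rewrite /part nj.
have invK n (j : I) : pickle_inv n = Some j -> pickle j = n.
  by move=> nj; have := pickle_invK (T := I) n; rewrite nj.
have restE n i : rest n i = if (pickle i < n)%N then 0 else x i.
  elim: n i => [//|n IH] i; rewrite restS ltnS [(pickle i <= n)%N]leq_eqVlt.
  case E : (pickle_inv n : option I) => [j|]; last first.
    have /negbTE -> : pickle i != n.
      by apply/eqP => ni; have := pickleK_inv i; rewrite ni E.
    by rewrite (partN _ _ E) subr0 IH.
  have jn := invK _ _ E; rewrite (partS _ _ _ E) dsumBE.
  have [->|ij] := eqVneq i j; first by rewrite singleE jn eqxx subrr.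
  rewrite singleN // subr0 IH; have /negbTE -> // : pickle i != n.
  by apply: contraNneq ij; rewrite -jn => /(pcan_inj pickleK) ->.
have rest_sq n : nrm (rest n) ^+ 2 = nrm x ^+ 2 - psum n (fun i => nrm (x i) ^+ 2).
  elim: n => [|n IH]; first by rewrite /psum big_ord0 subr0.
  rewrite psumS opprD addrA -IH restS.
  case E : (pickle_inv n : option I) => [j|]; last by rewrite (partN _ _ E) !subr0.
  have jn := invK _ _ E; rewrite (partS _ _ _ E).
  have -> : oapp (fun i => nrm (x i) ^+ 2) 0 (Some j) = nrm (rest n j) ^+ 2.
    by rewrite restE jn ltnn.
  rewrite !nrm2E innerBl !innerBr inner_single_eq.
  rewrite (inner_conj (rest n) (single _)) inner_single.
  move: (inner (rest n j) (rest n j)) (inner (rest n) (rest n)) => [a ?] [b ?] /=.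
  by ring.
have Prest n : P (x - rest n).
  elim: n => [|n IH]; first by rewrite subrr; case: Ps.
  rewrite restS opprB addrCA addrC; apply: subspaceD => //.
  case E : (pickle_inv n : option I) => [j|]; first by rewrite (partS _ _ _ E).
  by rewrite (partN _ _ E); case: Ps.
apply: Pc => e e0; have /cvgrPdist_lt/(_ (e ^+ 2)) := @dsum_nrm_cvg _ _ _ x.
rewrite exprn_gt0 // => /(_ isT)[n _ /(_ n (leqnn n))] xn.
exists (x - rest n) => //; rewrite subKr -(@ltr_pXn2r _ 2) ?nnegrE ?nrm_ge0 ?(ltW e0) //.
by rewrite rest_sq (le_lt_trans (ler_norm _)).
Qed.

End direct_sum_inclusions.

(** * Closed subspaces and separability *)

Lemma countable_range (T : countType) (U : Type) (p : T -> U) : countable (range p).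
Proof.
have : forall y, exists n, range p y -> exists2 t, pickle t = n & p t = y.
  move=> y; have [[t _ ty]|ny] := pselect (range p y); last by exists 0%N.
  by exists (pickle t) => _; exists t.
move=> /choice[f fP]; apply/countable_injP; exists f => y z.
rewrite !inE => /fP[t ty py] /fP[t' ty' pz] yz; rewrite -py -pz; congr (p _).
by apply: (pcan_inj pickleK); rewrite ty ty'.
Qed.

Lemma countable_enum (T : choiceType) (S : set T) (x0 : T) : countable S ->
  exists g : nat -> T, S `<=` range g.
Proof.
move=> Sc; have [f fI] := elimT (countable_injP _) Sc.
exists (fun n => xget x0 [set y | S y /\ f y = n]).
move=> y Sy; exists (f y) => //; case: xgetP => [z _ [Sz fz]|/(_ y) []//].
by apply: fI; rewrite ?inE.
Qed.

Section rational_combinations.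
Variables (R : realType) (V : normedModType R[i]) (I : countType) (g : I -> V).

Let rcomb (l : seq (rat * rat * I)) : V :=
  \sum_(p <- l) (ratr p.1.1 +i* ratr p.1.2)%C *: g p.2.

Let near_rcomb : set V := [set v | forall e : R, 0 < e -> exists l, nrm (v - rcomb l) < e].

Let near_rcombD u v : near_rcomb u -> near_rcomb v -> near_rcomb (u + v).
Proof.
move=> nu nv e e0; have e2 : 0 < e / 2 by rewrite divr_gt0.
have [l ul] := nu _ e2; have [m vm] := nv _ e2; exists (l ++ m).
have -> : rcomb (l ++ m) = rcomb l + rcomb m by rewrite /rcomb big_cat.
have -> : u + v - (rcomb l + rcomb m) = (u - rcomb l) + (v - rcomb m) by module R[i].
by rewrite (le_lt_trans (nrmD _ _)) // [e]splitr ltrD.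
Qed.

Let near_rcomb0 : near_rcomb 0.
Proof. by move=> e e0; exists [::]; rewrite /rcomb big_nil subr0 nrm0. Qed.

Let near_rcomb_closed : nrm_closed near_rcomb.
Proof.
move=> v nv e e0; have e2 : 0 < e / 2 by rewrite divr_gt0.
have [w /(_ _ e2)[l wl] vw] := nv _ e2; exists l.
by rewrite (le_lt_trans (nrmB_tri w _ _)) // [e]splitr ltrD.
Qed.

Let rat_approx (a : R) (e : R) : 0 < e -> exists q : rat, `|a - ratr q| < e.
Proof.
move=> e0; have [|q] := @rat_in_itvoo R (a - e) (a + e); first by lra.
by rewrite in_itv /= => /andP[aq qa]; exists q; rewrite ltr_norml; lra.
Qed.

Let nrm_scaleC (a b : R) (v : V) : nrm ((a +i* b)%C *: v) <= (`|a| + `|b|) * nrm v.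
Proof.
rewrite nrmZ ler_wpM2r ?nrm_ge0 // normc_def /=.
rewrite -(@ler_pXn2r _ 2) ?nnegrE ?sqrtr_ge0 ?addr_ge0 // sqr_sqrtr ?addr_ge0 ?sqr_ge0 //.
rewrite sqrrD !real_normK ?num_real // addrAC lerDl.
by rewrite mulrn_wge0 // mulr_ge0.
Qed.

Let near_rcomb_gen c i : near_rcomb (c *: g i).
Proof.
case: c => a b e e0; have k0 : 0 < 2 * (nrm (g i) + 1).
  by rewrite mulr_gt0 // ltr_wpDl ?nrm_ge0.
have d0 : 0 < e / (2 * (nrm (g i) + 1)) by rewrite divr_gt0.
have [q aq] := rat_approx a d0; have [r br] := rat_approx b d0.
exists [:: (q, r, i)]; rewrite /rcomb big_seq1 /= -scalerBl.
have -> : ((a +i* b) - (ratr q +i* ratr r))%C = ((a - ratr q) +i* (b - ratr r))%C by [].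
apply: le_lt_trans (nrm_scaleC _ _ _) _.
move: aq br; rewrite !ltr_pdivlMr // => aq br.
have := nrm_ge0 (g i); have := normr_ge0 (a - ratr q); have := normr_ge0 (b - ratr r).
move: (nrm (g i)) `|a - ratr q| `|b - ratr r| aq br => s p t ps ts t0 p0 s0.
by lra.
Qed.

(** The dense sequence enumerates the combinations of the [g i] with
    coefficients in Q[i]. *)
Lemma cspan_countable_dense :
  exists q : nat -> V, forall v, cspan (range g) v ->
    forall e : R, 0 < e -> exists n, nrm (v - q n) < e.
Proof.
exists (fun n => oapp rcomb 0 (unpickle n)) => v gv e e0.
suff /(_ e e0)[l vl] : near_rcomb v by exists (pickle l); rewrite pickleK.
apply: near_rcomb_closed => d /(cspan_approx gv)[l vl].
exists (\sum_(p <- l) p.1 *: g p.2) => //.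
by elim/big_rec: _ => // p w _ wr; exact: near_rcombD.
Qed.

End rational_combinations.

Lemma separable_enum (R : realType) (V : normedModType R[i]) : separable_space V ->
  exists g : nat -> V, forall P : set V, nrm_closed P -> (forall n, P (g n)) -> forall x, P x.
Proof.
move=> [S Sc /dense_nrmP Sd]; have [g Sg] := countable_enum 0 Sc.
exists g => P Pc Pg x; apply: Pc => e /(Sd x)[y /Sg[n _ <-] xy].
by exists (g n).
Qed.

(** Closed subspaces are bundled, so that the proofs of closedness are part of
    the type of their elements and these form a Hilbert space. *)
Record closed_subspace (R : realType) (H : hilbertType R) := ClosedSubspace {
  cs_set : set H;
  cs_subspace : subspace cs_set;
  cs_closed : nrm_closed cs_set
}.

Section closed_subspace_hilbert.
Variables (R : realType) (H : hilbertType R) (S : closed_subspace H).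

Record cs_elt := CsElt { cs_val :> H; cs_in : cs_set S cs_val }.
Implicit Types x y z : cs_elt.

Lemma cs_valP x y : cs_val x = cs_val y -> x = y.
Proof.
case: x y => [x Sx] [y Sy] /= xy; case: _ / xy in Sy *.
by congr CsElt; exact: Prop_irrelevance.
Qed.

HB.instance Definition _ := gen_eqMixin cs_elt.
HB.instance Definition _ := gen_choiceMixin cs_elt.

Let Ss := cs_subspace S.
Definition cs_zero := CsElt (proj1 Ss).
Definition cs_add x y := CsElt (subspaceD Ss (cs_in x) (cs_in y)).
Definition cs_opp x := CsElt (subspaceN Ss (cs_in x)).
Definition cs_scale c x := CsElt (subspaceZ c Ss (cs_in x)).

Let cs_addA : associative cs_add.
Proof. by move=> x y z; apply/cs_valP; exact: addrA. Qed.
Let cs_addC : commutative cs_add.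
Proof. by move=> x y; apply/cs_valP; exact: addrC. Qed.
Let cs_add0 : left_id cs_zero cs_add.
Proof. by move=> x; apply/cs_valP; exact: add0r. Qed.
Let cs_addN : left_inverse cs_zero cs_opp cs_add.
Proof. by move=> x; apply/cs_valP; exact: addNr. Qed.

HB.instance Definition _ :=
  GRing.isZmodule.Build cs_elt cs_addA cs_addC cs_add0 cs_addN.

Let cs_scaleA c d x : cs_scale c (cs_scale d x) = cs_scale (c * d) x.
Proof. by apply/cs_valP; exact: scalerA. Qed.
Let cs_scale1 : left_id 1 cs_scale.
Proof. by move=> x; apply/cs_valP; exact: scale1r. Qed.
Let cs_scaleDr : right_distributive cs_scale +%R.
Proof. by move=> c x y; apply/cs_valP; exact: scalerDr. Qed.
Let cs_scaleDl x : {morph cs_scale^~ x : c d / c + d}.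
Proof. by move=> c d; apply/cs_valP; exact: scalerDl. Qed.

HB.instance Definition _ := GRing.Zmodule_isLmodule.Build R[i] cs_elt
  cs_scaleA cs_scale1 cs_scaleDr cs_scaleDl.

Lemma cs_valD x y : cs_val (x + y) = cs_val x + cs_val y. Proof. by []. Qed.
Lemma cs_valB x y : cs_val (x - y) = cs_val x - cs_val y. Proof. by []. Qed.
Lemma cs_valZ c x : cs_val (c *: x) = c *: cs_val x. Proof. by []. Qed.

Let cs_norm x : R[i] := `|cs_val x|.
Let cs_normD x y : cs_norm (x + y) <= cs_norm x + cs_norm y.
Proof. exact: ler_normD. Qed.
Let cs_normZ (c : R[i]) x : cs_norm (c *: x) = `|c| * cs_norm x.
Proof. exact: normrZ. Qed.
Let cs_norm0_eq0 x : cs_norm x = 0 -> x = 0.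
Proof. by move=> /normr0_eq0 x0; exact: cs_valP. Qed.

HB.instance Definition _ := Lmodule_isNormed.Build R[i] cs_elt
  cs_normD cs_normZ cs_norm0_eq0.

Lemma nrm_cs_val x : nrm (cs_val x) = nrm x. Proof. by []. Qed.

Let cs_complete (G : set_system cs_elt) : ProperFilter G -> cauchy G -> cvg G.
Proof.
move=> GF /cauchy_nrmP Gc.
have : cauchy (cs_val @ G).
  apply/cauchy_nrmP => e /Gc[x Gx]; exists (cs_val x).
  exact: Gx.
move=> /cauchy_cvg/cvg_ex[l Gl].
have /cvg_nrmP Gle : cs_val @ G --> l by exact: Gl.
have Sl : cs_set S l.
  apply: (cs_closed (c := S)) => e /Gle /filter_ex[x xl].
  by exists (cs_val x) => //; exact: cs_in.
by apply/cvg_ex; exists (CsElt Sl); apply/cvg_nrmP => e /Gle.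
Qed.

HB.instance Definition _ := Uniform_isComplete.Build cs_elt cs_complete.

Let cs_inner x y : R[i] := inner (cs_val x) (cs_val y).
Let cs_innerDZl c x y z : cs_inner (c *: x + y) z = c * cs_inner x z + cs_inner y z.
Proof. exact: innerDZl. Qed.
Let cs_inner_conj x y : cs_inner y x = conjc (cs_inner x y).
Proof. exact: inner_conj. Qed.
Let cs_norm_inner x : `|x| ^+ 2 = cs_inner x x.
Proof. exact: norm_inner. Qed.

HB.instance Definition _ := CompleteNormedModule_isHilbert.Build R cs_elt
  cs_innerDZl cs_inner_conj cs_norm_inner.

Lemma inner_cs_val x y : inner (cs_val x) (cs_val y) = inner x y. Proof. by []. Qed.

(** The dense sequence of the span need not meet the subspace, so each ball of
    radius [1 / m.+1] around one of its terms contributes one point of the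
    subspace, if it has any. *)
Lemma closed_subspace_separable (I : countType) (g : I -> H) :
  cs_set S `<=` cspan (range g) -> separable_space cs_elt.
Proof.
move=> Sg; have [q qP] := cspan_countable_dense g.
pose p (u : nat * nat) := xget 0 [set x : cs_elt | nrm (cs_val x - q u.1) < u.2.+1%:R^-1].
exists (range p); first exact: countable_range.
apply/dense_nrmP => x e e0.
have [|m] := @ltr_add_invr _ 0 (e / 2); first by rewrite divr_gt0.
rewrite add0r => me.
have m0 : 0 < m.+1%:R^-1 :> R by rewrite invr_gt0 ltr0n.
have [n xn] := qP _ (Sg _ (cs_in x)) _ m0; exists (p (n, m)); first by exists (n, m).
rewrite -nrm_cs_val cs_valB (le_lt_trans (nrmB_tri (q n) _ _)) //.
rewrite [e]splitr ltrD //; first exact: lt_trans me.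
rewrite nrmB /p /=; case: xgetP => [y _ /= yn|/(_ x)//].
exact: lt_trans me.
Qed.

End closed_subspace_hilbert.

(** * Tensor products of Hilbert spaces *)

Section orthonormal_bases.
Variables (R : realType) (H : hilbertType R).

Definition orthonormal_basis (I : countType) (e : I -> H) : Prop :=
  (forall i j, inner (e i) (e j) = (i == j)%:R) /\ (forall x, cspan (range e) x).

Variable v : nat -> H.

Let unitize (x : H) : H := (nrm x)^-1%:C%C *: x.
Let residue (s : seq H) (x : H) : H := x - \sum_(u <- s) inner x u *: u.
Let gs := fix gs n :=
  if n is m.+1 then rcons (gs m) (unitize (residue (gs m) (v m))) else [::].
Let e n := unitize (residue (gs n) (v n)).

Let gsE n : gs n = mkseq e n.
Proof. by elim: n => //= n IH; rewrite mkseqS -IH. Qed.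

Let unitizeK x : (nrm x)%:C%C *: unitize x = x.
Proof.
have [->|x0] := eqVneq x 0; first by rewrite /unitize !scaler0.
by rewrite scalerA -rmorphM mulfV ?scale1r // gt_eqF ?nrm_gt0.
Qed.

Let unitize_norm x : unitize x != 0 -> inner (unitize x) (unitize x) = 1.
Proof.
move=> ux0; have x0 : x != 0 by apply: contraNneq ux0 => ->; rewrite /unitize scaler0.
rewrite -norm_inner nrmE nrmZr ger0_norm ?invr_ge0 ?nrm_ge0 //.
by rewrite mulVf ?expr1n // gt_eqF ?nrm_gt0.
Qed.

Let e_norm k x : inner x (e k) * inner (e k) (e k) = inner x (e k).
Proof.
have [e0|ek] := eqVneq (e k) 0; first by rewrite e0 inner0r mul0r.
by rewrite unitize_norm ?mulr1.
Qed.

Let e_orth n : forall k, (k < n)%N -> inner (e n) (e k) = 0.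
Proof.
elim/ltn_ind: n => n IH k kn.
suff h : inner (residue (gs n) (v n)) (e k) = 0 by rewrite {1}/e innerZl h mulr0.
rewrite /residue innerBl gsE inner_suml /mkseq big_map.
rewrite (bigD1_seq k) ?mem_iota ?iota_uniq //= innerZl e_norm big1_seq; last first.
  move=> j /andP[jk]; rewrite mem_iota /= add0n => jn; rewrite innerZl.
  have [kj|jk'|kj] := ltngtP k j; last by rewrite kj eqxx in jk.
    by rewrite IH // mulr0.
  by rewrite [X in _ * X]inner_conj (IH k) // rmorph0 mulr0.
by rewrite addr0 subrr.
Qed.

(** The Gram-Schmidt vectors [e k] that vanish are left out of the index
    type. *)
Lemma gram_schmidt :
  exists (I : countType) (b : I -> H),
    (forall i j, inner (b i) (b j) = (i == j)%:R) /\ forall n, cspan (range b) (v n).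
Proof.
exists {k : nat | e k != 0}, (fun k => e (val k)); split.
  move=> [j ej] [k ek]; rewrite -val_eqE /=.
  have [jk|kj|->] := ltngtP j k; last exact: unitize_norm.
    by rewrite inner_conj e_orth // rmorph0.
  by rewrite e_orth.
move=> n; set b := fun k : {k : nat | e k != 0} => _.
have sb k : cspan (range b) (e k).
  have [->|ek] := eqVneq (e k) 0; first by case: (cspan_subspace (range b)).
  by apply: cspan_gen; exists (exist _ k ek).
have -> : v n = (nrm (residue (gs n) (v n)))%:C%C *: e n + \sum_(u <- gs n) inner (v n) u *: u.
  by rewrite unitizeK subrK.
apply: subspaceD (cspan_subspace _) _ _.
  exact: subspaceZ (cspan_subspace _) (sb _).
rewrite gsE /mkseq big_map; apply: (subspace_sum _ (cspan_subspace _)) => k.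
exact: subspaceZ (cspan_subspace _) (sb _).
Qed.

End orthonormal_bases.

Lemma orthonormal_basis_exists (R : realType) (H : hilbertType R) :
  separable_space H ->
  exists (I : countType) (b : I -> H), orthonormal_basis b.
Proof.
move=> [S Sc /dense_nrmP Sd]; have [g Sg] := countable_enum 0 Sc.
have [I [b [bo bg]]] := gram_schmidt g; exists I, b; split=> // x.
apply: cspan_closed => e /(Sd x)[y /Sg[n _ <-] xy].
by exists (g n).
Qed.

Section tensor_product.
Variables (R : realType) (H1 H2 : hilbertType R) (I : countType) (e : I -> H2).
Hypothesis e_orth : forall i j, inner (e i) (e j) = (i == j)%:R.
Hypothesis e_total : forall y, cspan (range e) y.

(** The difference of the two sides is the squared distance of [y] to its
    projection [p] on the span of finitely many [e i]. *)
Lemma bessel y n : psum n (fun i => nrm (inner y (e i) : R[i]^o) ^+ 2) <= nrm y ^+ 2.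
Proof.
pose p := psum n (fun i => inner y (e i) *: e i).
have ip z : inner p z = psum n (fun i => inner y (e i) * inner (e i) z).
  rewrite /p -(@psum_morph _ _ _ (fun u => inner u z)) ?inner0l //.
    by apply: eq_psum => i; rewrite innerZl.
  by move=> u w; exact: innerDl.
have pe i : (pickle i < n)%N -> inner p (e i) = inner y (e i).
  move=> ni; rewrite ip (@psum_single _ _ _ i) // ?e_orth ?eqxx ?mulr1 // => j ji.
  by rewrite e_orth (negbTE ji) mulr0.
set s := psum n _.
have py : inner p y = s%:C%C.
  rewrite ip /s -(@psum_morph _ _ _ (fun u : R => u%:C%C)) //; last exact: rmorphD.
  by apply: eq_psum => i; rewrite (inner_conj y) mul_conjc_nrm.
have pp : inner p p = s%:C%C.
  rewrite ip -py ip; apply: eq_psum_in => i ni.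
  by rewrite (inner_conj p (e i)) pe // -inner_conj.
have h : nrm (y - p) ^+ 2 = nrm y ^+ 2 - s.
  rewrite !nrm2E innerBl !innerBr pp (inner_conj p y) py.
  by case: (inner y y) => a b /=; ring.
by have := sqr_ge0 (nrm (y - p)); rewrite h subr_ge0.
Qed.

Let coef_bounded (x : H1) (y : H2) :
  exists k : R, forall n, psum n (fun i => nrm (inner y (e i) *: x) ^+ 2) <= k.
Proof.
exists (nrm x ^+ 2 * nrm y ^+ 2) => n.
rewrite (eq_psum _ (g := fun i => nrm x ^+ 2 * nrm (inner y (e i) : R[i]^o) ^+ 2)); last first.
  by move=> i; rewrite nrmZ exprMn mulrC.
rewrite (@psum_morph _ _ _ (fun u : R => nrm x ^+ 2 * u)); [|exact: mulrDr|exact: mulr0].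
by rewrite ler_wpM2l ?sqr_ge0 // bessel.
Qed.

Let tns (x : H1) (y : H2) : dsum (fun _ : I => H1) := Dsum (coef_bounded x y).

Let tnsE x y i : tns x y i = inner y (e i) *: x. Proof. by []. Qed.

Let tns_linearl y : linear (tns^~ y).
Proof. by move=> c x x'; apply/dsumP => i; rewrite dsumDE dsumZE !tnsE scalerDr !scalerA mulrC. Qed.

Let tns_linearr x : linear (tns x).
Proof. by move=> c y y'; apply/dsumP => i; rewrite dsumDE dsumZE !tnsE innerDZl scalerDl scalerA. Qed.

Let tns_e x i : tns x (e i) = single (F := fun _ => H1) (i := i) x.
Proof.
apply/dsumP => j; rewrite tnsE e_orth.
have [->|ij] := eqVneq i j; first by rewrite singleE scale1r.
by rewrite singleN 1?eq_sym // scale0r.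
Qed.

Let nrm_tns x y : nrm (tns x y) <= nrm x * nrm y.
Proof.
rewrite -(@ler_pXn2r _ 2) ?nnegrE ?mulr_ge0 ?nrm_ge0 // exprMn.
apply: cvgr_to_le (@dsum_nrm_cvg _ _ _ (tns x y)) _; apply: nearW => n.
rewrite (eq_psum _ (g := fun i => nrm x ^+ 2 * nrm (inner y (e i) : R[i]^o) ^+ 2)); last first.
  by move=> i; rewrite tnsE nrmZ exprMn mulrC.
rewrite (@psum_morph _ _ _ (fun u : R => nrm x ^+ 2 * u)); [|exact: mulrDr|exact: mulr0].
by rewrite ler_wpM2l ?sqr_ge0 // bessel.
Qed.

Let tnsB x y y' : tns x (y - y') = tns x y - tns x y'.
Proof.
apply/dsumP => i; rewrite dsumBE !tnsE innerBl; exact: scalerBl.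
Qed.

Let tns_inner x x' y y' : inner (tns x y) (tns x' y') = inner x x' * inner y y'.
Proof.
pose P := [set y' | inner (tns x y) (tns x' y') = inner x x' * inner y y'].
suff : P y' by [].
apply: e_total.
- split; first by rewrite /P /= (_ : tns x' 0 = 0) ?inner0r ?mulr0 // -(subrr 0) tnsB subrr.
  move=> c u v; rewrite /P /= => pu pv.
  by rewrite tns_linearr !innerDr !innerZr pu pv mulrDr mulrCA.
- apply: (@nrm_closed_eq _ _ R[i]^o _ _ (nrm x * nrm y * nrm x')) => u v.
    apply: le_trans (nrm_innerBr _ _ _) _; rewrite -tnsB -[leRHS]mulrA.
    by apply: ler_pM; rewrite ?nrm_ge0 ?nrm_tns.
  rewrite -mulrBr -innerBr [nrm _](_ : _ = nrm (inner x x' : R[i]^o) * nrm (inner y (u - v) : R[i]^o)).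
    have -> : nrm x * nrm y * nrm x' * nrm (u - v) = (nrm x * nrm x') * (nrm y * nrm (u - v)).
      by ring.
    by apply: ler_pM; rewrite ?nrm_ge0 ?nrm_inner.
  by rewrite -nrmZ.
- move=> _ [i _ <-]; rewrite /P /= tns_e inner_single tnsE innerZl mulrC.
  by [].
Qed.

Let tns_dense : dense (range (tsum tns)).
Proof.
have pi_sum l : tsum tns (\pi l) = \sum_(u <- l) tns u.1 u.2.
  exact: tsum_pi tns_linearl tns_linearr l.
apply/dense_nrmP => z d d0.
have : cspan (range (fun u : H1 * H2 => tns u.1 u.2)) z.
  apply: dsum_spanned; [exact: cspan_subspace|exact: cspan_closed|move=> i u].
  by apply: cspan_gen; exists (u, e i) => //=; rewrite tns_e.
move=> /cspan_approx/(_ d0)[l zl].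
exists (tsum tns (\pi [seq (p.1 *: p.2.1, p.2.2) | p <- l])); first by eexists.
rewrite pi_sum big_map (eq_bigr (fun p => p.1 *: tns p.2.1 p.2.2)) // => p _.
by apply/dsumP => i; rewrite dsumZE !tnsE !scalerA mulrC.
Qed.

(** The tensor product is a direct sum of copies of [H1], one for each vector
    of a basis of [H2], with [x (x) y = (<y, e i> x)_i].  Parseval's identity
    gives the inner products; it is clear for [y = e i] and extends by
    linearity and continuity. *)
Lemma basis_hilbert_tensor : inhabited (hilbert_tensor H1 H2).
Proof. by constructor; exact: HilbertTensor tns_linearl tns_linearr tns_inner tns_dense. Qed.

End tensor_product.

Lemma hilbert_tensor_exists (R : realType) (H1 H2 : hilbertType R) :
  separable_space H2 -> inhabited (hilbert_tensor H1 H2).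
Proof.
move=> /orthonormal_basis_exists[I [e [eo et]]].
exact: basis_hilbert_tensor eo et.
Qed.

(** * Representations from Gram matrices *)

(** A GNS construction with a family of vectors instead of one: [w k y] is to
    become [y] applied to [xi k].  The representation lives on the closed span
    of all the [xi k] and [w k y]. *)
Section separable_representation.
Variables (R : realType) (Y : cstarAlgType R) (H : hilbertType R) (K : Type).
Variables (xi : K -> H) (w : K -> Y -> H).
Hypothesis w_linear : forall k, linear (w k).
Hypothesis w_gram : forall k l y z,
  inner (w k y) (w l z) = inner (xi k) (w l (star y ** z)).
Hypothesis w_xi : forall k l y, inner (w k y) (xi l) = inner (xi k) (w l (star y)).

(** [(k, None)] stands for [xi k] and [(k, Some y)] for [y] applied to it; the
   action of the algebra is defined on these formal vectors, then on their
   combinations. *)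
Let vec (p : K * option Y) : H := if p.2 is Some y then w p.1 y else xi p.1.
Let act (y : Y) (p : K * option Y) : K * option Y :=
  (p.1, Some (if p.2 is Some z then y ** z else y)).

Let act_gram y z p q :
  inner (vec (act y p)) (vec (act z q)) = inner (vec p) (vec (act (star y ** z) q)).
Proof.
case: p q => [k [a|]] [l [b|]]; rewrite /vec /= !w_gram //; congr (inner _ (w _ _)).
- by rewrite starM !amulA.
- by rewrite starM !amulA.
- by rewrite amulA.
Qed.

Let act_star y p q : inner (vec (act y p)) (vec q) = inner (vec p) (vec (act (star y) q)).
Proof.
case: p q => [k [a|]] [l [b|]]; rewrite /vec /= ?w_gram ?w_xi //.
- by rewrite starM amulA.
- by rewrite starM.
Qed.

Let act_linear c y z p : vec (act (c *: y + z) p) = c *: vec (act y p) + vec (act z p).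
Proof. by case: p => [k [a|]]; rewrite /vec /= ?amulDl ?amulZl w_linear. Qed.

Let comb (l : seq (R[i] * (K * option Y))) : H := \sum_(p <- l) p.1 *: vec p.2.
Let acts y (l : seq (R[i] * (K * option Y))) := [seq (p.1, act y p.2) | p <- l].

Let comb_acts y l : comb (acts y l) = \sum_(p <- l) p.1 *: vec (act y p.2).
Proof. by rewrite /comb big_map. Qed.

Let acts_linear l : linear (fun y => comb (acts y l)).
Proof.
move=> c y z; rewrite !comb_acts scaler_sumr -big_split; apply: eq_bigr => p _.
by rewrite act_linear scalerDr !scalerA mulrC.
Qed.

Let acts_star y l m : inner (comb (acts y l)) (comb m) = inner (comb l) (comb (acts (star y) m)).
Proof.
rewrite !comb_acts /comb !inner_suml; apply: eq_bigr => p _.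
rewrite !innerZl !inner_sumr; congr (_ * _); apply: eq_bigr => q _.
by rewrite !innerZr act_star.
Qed.

Let acts_gram y z l m :
  inner (comb (acts y l)) (comb (acts z m)) = inner (comb l) (comb (acts (star y ** z) m)).
Proof.
rewrite !comb_acts /comb !inner_suml; apply: eq_bigr => p _.
rewrite !innerZl !inner_sumr; congr (_ * _); apply: eq_bigr => q _.
by rewrite !innerZr act_gram.
Qed.

Let acts_bounded y l : nrm (comb (acts y l)) <= nrm y * nrm (comb l).
Proof.
apply: (@gram_contractive _ _ _ _ (fun y => comb (acts y l))); first exact: acts_linear.
by move=> a b; exact: acts_gram.
Qed.

Let S := ClosedSubspace (cspan_subspace (range vec)) (@cspan_closed _ _ (range vec)).
Let W : hilbertType R := cs_elt S.

Let comb_in l : cs_set S (comb l).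
Proof.
apply: (subspace_sum _ (cspan_subspace _)) => p.
by apply: subspaceZ (cspan_subspace _) _; apply: cspan_gen; exists p.2.
Qed.
Let elt l : W := CsElt (comb_in l).

Let elt_dense (x : W) (e : R) : 0 < e -> exists l, nrm (x - elt l) < e.
Proof. by move=> e0; exact: cspan_approx (cs_in x) e0. Qed.

Let elt_ext (x y : W) : (forall l, inner (elt l) x = inner (elt l) y) -> x = y.
Proof.
move=> xy; apply/eqP; rewrite -subr_eq0; apply/eqP.
set d := x - y; have d0 l : inner (elt l) d = 0 by rewrite innerBr xy subrr.
have dd : (inner d d : R[i]^o) = 0.
  apply: (@nrm_small_eq0 _ _ (nrm d)) => e /(elt_dense d)[l dl].
  have -> : inner d d = inner (d - elt l) d by rewrite innerBl d0 subr0.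
  rewrite (le_trans (nrm_inner _ _)) // mulrC ler_wpM2l ?nrm_ge0 //.
  exact: ltW.
by apply: nrm0_eq0; apply/eqP; rewrite -sqrf_eq0 nrm2E dd.
Qed.

Let rep_ex y : exists T : bop W, forall l, T (elt l) = elt (acts y l).
Proof.
pose G (u v : W) := exists2 l, u = elt l & v = elt (acts y l).
have [||_ _ [l -> ->]|x e e0|T TE _] := @bop_extend _ W G (nrm y).
- exact: nrm_ge0.
- move=> c _ _ _ _ [l -> ->] [m -> ->].
  exists ([seq (c * p.1, p.2) | p <- l] ++ m); apply: cs_valP.
    rewrite cs_valD cs_valZ /= /comb big_cat big_map scaler_sumr; congr (_ + _).
    by apply: eq_bigr => p _; rewrite scalerA.
  rewrite cs_valD cs_valZ /= !comb_acts big_cat big_map scaler_sumr; congr (_ + _).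
  by apply: eq_bigr => p _; rewrite scalerA.
- exact: acts_bounded.
- have [l xl] := elt_dense x e0.
  by exists (elt l), (elt (acts y l)); split=> //; exists l.
by exists T => l; apply: TE; exists l.
Qed.

Let rep y : bop W := projT1 (cid (rep_ex y)).
Let repE y l : rep y (elt l) = elt (acts y l).
Proof. by rewrite /rep; case: cid => T /= ->. Qed.

Let bop_ext (T U : bop W) : (forall l, T (elt l) = U (elt l)) -> T = U.
Proof.
move=> TU; rewrite -[T]adjointK -[U]adjointK; congr adjoint.
by apply/bopP => x; apply: elt_ext => l; rewrite -!adjointE TU.
Qed.

Let rep_star_hom : star_hom rep.
Proof.
split=> [c y z|y z|y]; first last.
- apply: bop_ext => l; apply: elt_ext => m.
  by rewrite repE -[RHS]adjointE repE -!inner_cs_val /= acts_star.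
- apply: bop_ext => l; rewrite -[RHS]/(rep y (rep z (elt l))) !repE; apply: cs_valP => /=.
  congr comb; rewrite /acts -map_comp; apply: eq_map => -[c [k [a|]]] //=.
  by rewrite /act /= amulA.
- apply: bop_ext => l; rewrite -[RHS]/(c *: rep y (elt l) + rep z (elt l)) !repE.
  by apply: cs_valP; rewrite cs_valD cs_valZ /= acts_linear.
Qed.

Lemma separable_representation (I : countType) (g : I -> H) :
  (forall k, cspan (range g) (xi k)) -> (forall k y, cspan (range g) (w k y)) ->
  exists (V : hilbertType R) (pi : Y -> bop V) (j : K -> V),
    [/\ separable_space V, star_hom pi,
        forall k l, inner (j k) (j l) = inner (xi k) (xi l)
      & forall k l y z, inner (pi y (j k)) (pi z (j l)) = inner (w k y) (w l z)].
Proof.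
move=> gxi gw; exists W, rep, (fun k => elt [:: (1, (k, None))]); split=> //.
- apply: (@closed_subspace_separable _ _ S _ g) => x Sx.
  apply: Sx; [exact: cspan_subspace|exact: cspan_closed|].
  by move=> _ [[k [y|]] _ <-]; [exact: gw|exact: gxi].
- by move=> k l; rewrite -inner_cs_val /= /comb !big_seq1 !scale1r.
- by move=> k l y z; rewrite !repE -inner_cs_val /= /comb !big_seq1 !scale1r.
Qed.

End separable_representation.

(** * The corner of a direct sum of extensions *)

Section extension_facts.
Variables (R : realType) (B A : cstarAlgType R) (X : extension B A).
Implicit Types (e : X) (x : B).

Lemma star_homD (C D : cstarAlgType R) (f : C -> D) :
  star_hom f -> {morph f : a b / a + b}.
Proof. by move=> [fl _ _] a b; have := fl 1 a b; rewrite !scale1r. Qed.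

Lemma star_hom0 (C D : cstarAlgType R) (f : C -> D) : star_hom f -> f 0 = 0.
Proof. by move=> fh; apply: (addrI (f 0)); rewrite -star_homD // !addr0. Qed.

Lemma star_homB (C D : cstarAlgType R) (f : C -> D) :
  star_hom f -> {morph f : a b / a - b}.
Proof.
move=> fh a b; apply: (addIr (f b)).
by rewrite -star_homD // !subrK.
Qed.

Lemma ext_p_i x : ext_p (ext_i X x) = 0.
Proof. by apply/ext_exact; exists x. Qed.

Lemma ext_mlt_lE e x : ext_i X (mlt_l (ext_mlt e) x) = e ** ext_i X x.
Proof. by rewrite /ext_mlt /=; case: cid. Qed.

Lemma ext_mlt_rE e x : ext_i X (mlt_r (ext_mlt e) x) = ext_i X x ** e.
Proof. by rewrite /ext_mlt /=; case: cid. Qed.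

Lemma corona_eqP (m n : multiplier B) :
  \pi_(corona B) m = \pi_(corona B) n <-> corona_eq m n.
Proof. by split=> [/eqmodP/asboolP|mn]; [|apply/eqmodP/asboolP]. Qed.

Lemma busbyE e : busby X (ext_p e) = \pi_(corona B) (ext_mlt e).
Proof.
rewrite /busby; case: cid => e' /= e'e; apply/corona_eqP.
have [iD iM] := (star_homD (ext_i_hom X), (ext_i_hom X)).
have : ext_p (e' - e) = 0 by rewrite (star_homB (ext_p_hom X)) e'e subrr.
move=> /ext_exact[b _ be]; exists b => x; have [_ {}iM _] := iM.
split; apply: (@ext_i_inj _ _ _ X); rewrite iD iM ?ext_mlt_lE ?ext_mlt_rE be.
  by rewrite amulBl addrC subrK.
by rewrite amulBr addrC subrK.
Qed.

Lemma mlt_l0 (m : multiplier B) : mlt_l m 0 = 0.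
Proof. by apply: star_amul_eq0; rewrite mltP amul0. Qed.

(** An extension acts faithfully on its ideal once its quotient is fixed: if
    the difference is [b] in [B], then [b ** star b = 0]. *)
Lemma ext_eq e e' : ext_p e = ext_p e' ->
  (forall x x', star (ext_i X x') ** (e ** ext_i X x) = star (ext_i X x') ** (e' ** ext_i X x)) ->
  e = e'.
Proof.
move=> pe ee; have [_ iM iS] := ext_i_hom X.
have : ext_p (e - e') = 0 by rewrite (star_homB (ext_p_hom X)) pe subrr.
move=> /ext_exact[b _ be].
have bx x x' : star x' ** (b ** x) = 0.
  apply: (@ext_i_inj _ _ _ X); rewrite (star_hom0 (ext_i_hom X)) !iM iS be.
  by rewrite amulBl amulBr ee subrr.
have b0 : star b = 0 by apply: star_amul_eq0; rewrite starK; apply: star_amul_eq0.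
apply/eqP; rewrite -subr_eq0 -be -[b]starK b0 star0.
by rewrite (star_hom0 (ext_i_hom X)).
Qed.

End extension_facts.

Section compression.
Variables (R : realType) (B A : cstarAlgType R) (theta : mx2_iso B).
Variables (X X' Y : extension B A).
Hypothesis XY : is_direct_sum theta X X' Y.

(** The matrix with columns [(u, v)] and 0; multiplication by [y] on the left
    acts on such matrices through the first column of [y]. *)
Definition first_column (u v : B) : 'M[B]_2 :=
  \matrix_(i, j) if j == ord0 then if i == ord0 then u else v else 0.

Let col (u v : B) : Y := ext_i Y (theta (first_column u v)).

Let col_inj u v u' v' : col u v = col u' v' -> u = u' /\ v = v'.
Proof.
move=> /(@ext_i_inj _ _ _ Y)/(can_inj (mx2_funK theta))/matrixP e.
by have := e ord0 ord0; have := e ord_max ord0; rewrite !mxE.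
Qed.

Let colD u v u' v' : col u v + col u' v' = col (u + u') (v + v').
Proof.
rewrite /col -(star_homD (ext_i_hom Y)) -mx2_funD; congr (ext_i _ (theta _)).
by apply/matrixP => i j; rewrite !mxE; case: (j == _) => //; [case: ifP|rewrite addr0].
Qed.

Let col_gram u v u' v' :
  star (col u' v') ** col u v = col (star u' ** u + star v' ** v) 0.
Proof.
have [_ iM iS] := ext_i_hom Y; rewrite /col -iS -iM -mx2_funS -mx2_funM.
congr (ext_i _ (theta _)); apply/matrixP => i j; rewrite !mxE big_ord_recl big_ord1 !mxE /=.
case: (j == _); last by rewrite !amul0 addr0.
by case: (i == _) => //; rewrite star0 !amul0l addr0.
Qed.

Let ord2_max (i : 'I_2) : i != ord0 -> i = ord_max.
Proof. by case: i => [[|[|//]] ?] // _; exact: val_inj. Qed.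

(** [e] and [g] are the entries of the first column of the matrix of [y]. *)
Let compressed (y : Y) (e : X) (g : B) : Prop := ext_p e = ext_p y /\
  forall x, y ** col x 0 = col (mlt_l (ext_mlt e) x) (g ** x).

(** The Busby invariant of [Y] says that the matrix of [y] is, up to [b] in
   [B], diagonal with the Busby invariant of [X] in the upper left corner.
   The off-diagonal entry and the error terms [b0], [b1] are in [B]. *)
Let compressed_ex y : exists eg, compressed y eg.1 eg.2.
Proof.
suff [e [g c]] : exists e g, compressed y e g by exists (e, g).
have [e0 pe0] := ext_p_surj X (ext_p y).
have := XY (ext_p y); rewrite busbyE -pe0 busbyE => /corona_eqP[b yb].
set m := map_mx repr _ in yb.
have [b0 eb0] : corona_eq (m ord0 ord0) (ext_mlt e0).
  by apply/corona_eqP; rewrite /m !mxE reprK.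
have [b1 eb1] : corona_eq (m ord_max ord0) (mlt0 B).
  by apply/corona_eqP; rewrite /m !mxE reprK.
clearbody m; pose be := mx2_inv theta b.
exists (e0 + ext_i X (b0 + be ord0 ord0)), (b1 + be ord_max ord0); split.
  by rewrite (star_homD (ext_p_hom X)) ext_p_i addr0.
move=> x; rewrite {1}/col -(ext_mlt_lE y); have [-> _] := yb (theta (first_column x 0)).
have -> : mlt_l (mlt_mx theta m) (theta (first_column x 0)) =
    theta (first_column (mlt_l (m ord0 ord0) x) (mlt_l (m ord_max ord0) x)).
  rewrite /mlt_mx /= mx2_funK; congr (theta _); apply/matrixP => i j.
  rewrite !mxE big_ord_recl big_ord1 !mxE /= (_ : lift _ _ = ord_max); last exact: val_inj.
  case: (j == _); last by rewrite !mlt_l0 addr0.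
  rewrite mlt_l0 addr0; by have [->|/ord2_max->] := eqVneq i ord0.
have -> : b ** theta (first_column x 0) =
    theta (first_column (be ord0 ord0 ** x) (be ord_max ord0 ** x)).
  rewrite -[b](mx2_invK theta) -mx2_funM -/be; congr (theta _); apply/matrixP => i j.
  rewrite !mxE big_ord_recl big_ord1 !mxE /=.
  case: (j == _); last by rewrite !amul0 addr0.
  by rewrite amul0 addr0; have [->|/ord2_max->] := eqVneq i ord0.
rewrite (star_homD (ext_i_hom Y)) -!/(col _ _) colD; congr col.
  have [_ iM _] := ext_i_hom X; apply: (@ext_i_inj _ _ _ X).
  rewrite (star_homD (ext_i_hom X)) ext_mlt_lE (eb0 x).1 (star_homD (ext_i_hom X)).
  rewrite ext_mlt_lE !iM amulDl (star_homD (ext_i_hom X)) amulDl.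
  by rewrite addrA.
by rewrite (eb1 x).1 /= add0r amulDl.
Qed.

Let compressed_unique y e g e' g' :
  compressed y e g -> compressed y e' g' -> e = e' /\ g = g'.
Proof.
move=> [pe eg] [pe' eg'].
have h x : mlt_l (ext_mlt e) x = mlt_l (ext_mlt e') x /\ g ** x = g' ** x.
  by apply: col_inj; rewrite -eg eg'.
split; first by apply: ext_eq => [|x x']; rewrite ?pe ?pe' // -!ext_mlt_lE (h x).1.
apply/eqP; rewrite -subr_eq0; apply/eqP.
have gg x : (g - g') ** x = 0 by rewrite amulBl (h x).2 subrr.
rewrite -[LHS]starK; apply: (canLR (@starK _ _)); rewrite star0.
by apply: star_amul_eq0; rewrite starK.
Qed.

(** The corner [c] is not multiplicative; [g] measures the defect.  The
    formulas hold because [first_column] determines [c] and [g], and they can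
    be checked on the products [star (y ** col x' 0) ** (z ** col x 0)]. *)
Lemma direct_sum_compression :
  exists (c : Y -> X) (g : Y -> B),
    [/\ linear c, linear g, forall y, ext_p (c y) = ext_p y,
        forall y z, c (star y ** z) = star (c y) ** c z + ext_i X (star (g y) ** g z)
      & forall y, c (star y) = star (c y)].
Proof.
have [cg cgP] := choice compressed_ex.
have [_ pM pS] := ext_p_hom X; have [_ qM qS] := ext_p_hom Y.
have [_ iM iS] := ext_i_hom X.
have [pl _ _] := ext_p_hom X; have [ql _ _] := ext_p_hom Y; have [il _ _] := ext_i_hom X.
have lin c y z : (cg (c *: y + z)).1 = c *: (cg y).1 + (cg z).1 /\
    (cg (c *: y + z)).2 = c *: (cg y).2 + (cg z).2.
  apply: compressed_unique (cgP _) _; have [py yE] := cgP y; have [pz zE] := cgP z.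
  split=> [|x]; first by rewrite pl ql py pz.
  rewrite amulDl amulZl yE zE.
  have -> u v : c *: col u v = col (c *: u) (c *: v).
    have iZ (a : B) : ext_i Y (c *: a) = c *: ext_i Y a.
      have [jl _ _] := ext_i_hom Y; have := jl c a 0.
      by rewrite (star_hom0 (ext_i_hom Y)) !addr0.
    rewrite /col -iZ -mx2_funZ; congr (ext_i _ (theta _)).
    by apply/matrixP => i j; rewrite !mxE; case: (j == _) => //; [case: ifP|rewrite scaler0].
  rewrite colD; congr col; last by rewrite amulDl amulZl.
  apply: (@ext_i_inj _ _ _ X); rewrite il !ext_mlt_lE.
  by rewrite amulDl amulZl.
exists (fun y => (cg y).1), (fun y => (cg y).2); split.
- by move=> c y z; exact: (lin c y z).1.
- by move=> c y z; exact: (lin c y z).2.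
- by move=> y; exact: (cgP y).1.
- move=> y z; apply: ext_eq => [|x x'].
    rewrite (cgP _).1 (star_homD (ext_p_hom X)) ext_p_i addr0 pM pS qM qS.
    by rewrite (cgP y).1 (cgP z).1.
  have : star (y ** col x' 0) ** (z ** col x 0) =
      star (col x' 0) ** ((star y ** z) ** col x 0).
    by rewrite starM !amulA.
  rewrite !(cgP _).2 !col_gram => /col_inj[+ _].
  rewrite star0 amul0l addr0 => /(congr1 (ext_i X)).
  rewrite (star_homD (ext_i_hom X)) !iM !iS !iM !ext_mlt_lE => <-.
  by rewrite amulDl amulDr !starM !amulA.
- move=> y; apply: ext_eq => [|x x'].
    by rewrite (cgP _).1 pS qS (cgP y).1.
  have : star (y ** col x' 0) ** col x 0 = star (col x' 0) ** (star y ** col x 0).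
    by rewrite starM amulA.
  rewrite (cgP y).2 (cgP (star y)).2 !col_gram => /col_inj[+ _].
  rewrite star0 amul0l amul0 !addr0 => /(congr1 (ext_i X)).
  rewrite !iM !iS !ext_mlt_lE starM => <-.
  by rewrite !amulA.
Qed.

End compression.

(** * Lifts, spatial norms and asymptotic norms *)

Section lifts.
Variable R : realType.

Lemma atensor_map_pi (K : pzRingType) (E A D : lmodType K) (p : E -> A) (s : seq (E * D)) :
  linear p -> atensor_map p (\pi_(atensor E D) s) = \pi_(atensor A D) [seq (p u.1, u.2) | u <- s].
Proof.
move=> pl; apply/atensor_eqP.
have pD u v : p (u + v) = p u + p v by have := pl 1 u v; rewrite !scale1r.
have p0 : p 0 = 0 by apply: (addrI (p 0)); rewrite -pD !addr0.
have pZ c u : p (c *: u) = c *: p u by have := pl c u 0; rewrite p0 !addr0.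
suff h (t u : seq (E * D)) : tensor_eq t u ->
    tensor_eq [seq (p v.1, v.2) | v <- t] [seq (p v.1, v.2) | v <- u].
  by apply: h; apply/atensor_eqP; rewrite reprK.
elim=> {t u} [t|t u _|t u v _ tu _|v t u _|v w t|d t|a b d t|a d e t|c a d t] /=.
- exact: tensor_refl.
- exact: tensor_sym.
- exact: tensor_trans tu.
- exact: tensor_cons.
- exact: tensor_swap.
- by rewrite p0; exact: tensor_zero.
- by rewrite pD; exact: tensor_addl.
- exact: tensor_addr.
- by rewrite pZ; exact: tensor_scale.
Qed.

(** The lift is itself in the coset over which the quotient norm is the
    infimum. *)
Lemma norm_E_le_min_norm (B A D : cstarAlgType R) (X : extension B A)
    (ED : min_tensor X D) (x : atensor A D) (z : atensor X D) :
  atensor_map (@ext_p _ _ _ X) z = x -> ((norm_E ED x)%:E <= min_norm z)%E.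
Proof.
move=> zx; rewrite -(mt_norm ED) lee_fin; apply: ge_inf.
  by exists 0 => _ [w _ <-]; exact: nrm_ge0.
exists (tsum (mt_tens ED) z) => //; exists z => //; rewrite subrr.
apply: subset_closure; exists (\pi_(atensor B D) [::]) => //.
have [il _ _] := ext_i_hom X.
rewrite (@tsum_pi _ _ _ _ _ _ _ [::]) ?big_nil // => [d c a b|b].
  by rewrite il mt_linearl.
exact: mt_linearr.
Qed.

(** The vector is a finite sum of elementary tensors, on which the operator can
    be computed; for negative [L] only the representations matter. *)
Lemma min_norm_witness (A D : cstarAlgType R) (z : atensor A D) (L : R) :
  (L%:E < min_norm z)%E ->
  exists (H1 H2 : hilbertType R) (HT : hilbert_tensor H1 H2)
    (pi : A -> bop H1) (sigma : D -> bop H2) (l : seq (H1 * H2)),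
    [/\ star_hom pi, star_hom sigma & 0 <= L -> L * nrm (tens HT l) <
      nrm ((tsum (fun a d => op_tensor HT (pi a) (sigma d)) z : bop HT) (tens HT l))].
Proof.
move=> /ereal_sup_gt[_ [H1 [H2 [HT [pi [sigma [piP sigmaP ->]]]]]]].
set T := tsum _ _; rewrite lte_fin => LT; exists H1, H2, HT, pi, sigma.
have [L0|L0] := ltP L 0; first by exists [::]; split=> //; rewrite leNgt L0.
have [xi Txi] : exists xi : HT, L * nrm xi < nrm (T xi).
  apply: contrapT => no; move: LT; apply/negP; rewrite -leNgt nrm_bopE.
  apply: opnorm_le => // xi; rewrite leNgt; apply/negP => Txi.
  by apply: no; exists xi.
have k0 : 0 < nrm T + L + 1 by rewrite ltr_wpDl // addr_ge0 // nrm_ge0.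
have [|l xil] := tens_dense xi (e := (nrm (T xi) - L * nrm xi) / (nrm T + L + 1)).
  by rewrite divr_gt0 // subr_gt0.
exists l; split=> // _; move: xil; rewrite ltr_pdivlMr // => xil.
have := le_opnorm T (xi - tens HT l); rewrite bopB -nrm_bopE.
have := nrm_dist (T xi) (T (tens HT l)).
have := ler_wpM2l L0 (nrm_dist (tens HT l) xi); rewrite (nrmB _ xi).
have := nrm_ge0 (xi - tens HT l).
by lra.
Qed.

(** Functions that vanish at infinity are small at large integers. *)
Lemma le_cb_mod_c0_norm (V : normedModType R[i]) (f : R -> V) (L : R) :
  (forall n : nat, L <= nrm (f n%:R)) -> (L%:E <= cb_mod_c0_norm f)%E.
Proof.
move=> Lf; apply: le_ereal_inf_tmp => _ [g [_ g0] <-].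
apply/lee_addgt0Pr => e e0.
have : \forall t \near +oo%R, nrm (g t) < e.
  by have /cvgr_lt := g0; apply.
move=> [M [_ gM]].
pose n := (Num.truncn `|M|).+1.
have Mn : M < n%:R by rewrite (le_lt_trans (ler_norm M)) // truncnS_gt.
have gn := gM _ Mn.
apply: (@le_trans _ _ ((nrm (f n%:R - g n%:R))%:E + e%:E)%E).
  rewrite -EFinD lee_fin -lerBlDr (le_trans _ (nrm_dist _ _)) //.
  by apply: lerB; [exact: Lf|exact: ltW].
by rewrite leeD2r // ; apply: ereal_sup_ubound; exists n%:R => //=; rewrite ler0n.
Qed.

Lemma asymptotic_hom_comp (A Y : cstarAlgType R) (H : hilbertType R)
    (s : R -> A -> Y) (pi : Y -> bop H) :
  asymptotic_hom s -> star_hom pi -> asymptotic_hom (fun t a => pi (s t a)).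
Proof.
move=> [sc sM sDZ sS] pih; have [pl pM pS] := pih.
have pB := star_homB pih; have pn := star_hom_contractive pih.
have squeeze (u : R -> Y) : nrm (u t) @[t --> +oo] --> (0 : R) ->
    nrm (pi (u t)) @[t --> +oo] --> (0 : R).
  move=> u0; apply: (@squeeze_cvgr _ _ _ _ (fun=> 0) (fun t => nrm (u t))) => //.
    by apply: nearW => t; rewrite nrm_ge0 pn.
  exact: cvg_cst.
split.
- move=> a x; have := sc a x.
  move=> h; apply/cvg_nrmP => e e0; have /cvg_nrmP/(_ e e0) := h.
  apply: filterS => t st; have := le_lt_trans (pn _) st; rewrite pB.
  by apply.
- by move=> a b; under eq_fun do rewrite -pM -pB; exact: squeeze.
- move=> c a b.
  have e t : nrm (pi (s t (a + c *: b)) - pi (s t a) - c *: pi (s t b)) =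
      nrm (pi (s t (a + c *: b) - s t a - c *: s t b)).
    have pZ y : pi (c *: y) = c *: pi y.
      by have := pl c y 0; rewrite (star_hom0 pih) !addr0.
    by rewrite !pB pZ.
  by under eq_fun do rewrite e; exact: squeeze.
- by move=> a; under eq_fun do rewrite -pS -pB; exact: squeeze.
Qed.

End lifts.

Section tensor_gram.
Variable R : realType.

(** The norm of a sum of elementary tensors depends only on the inner products
    of the factors, and additively on those of the first ones. *)
Lemma nrm_tens_gram (H1 H2 H1' H2' : hilbertType R) (HT : hilbert_tensor H1 H2)
    (HT' : hilbert_tensor H1' H2') (Q : Type) (s : seq Q) (a : Q -> H1) (b : Q -> H2)
    (a1 a2 : Q -> H1') (b' : Q -> H2') :
  (forall p q, inner (a p) (a q) = inner (a1 p) (a1 q) + inner (a2 p) (a2 q)) ->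
  (forall p q, inner (b p) (b q) = inner (b' p) (b' q)) ->
  nrm (tens HT [seq (a q, b q) | q <- s]) ^+ 2 =
  nrm (tens HT' [seq (a1 q, b' q) | q <- s]) ^+ 2 +
  nrm (tens HT' [seq (a2 q, b' q) | q <- s]) ^+ 2.
Proof.
move=> aa bb; rewrite !nrm2E -raddfD /= !inner_tens !big_map -big_split; congr complex.Re.
apply: eq_bigr => p _; rewrite !big_map -big_split; apply: eq_bigr => q _ /=.
by rewrite aa bb mulrDl.
Qed.

Lemma sum_op_tensor (H1 H2 : hilbertType R) (HT : hilbert_tensor H1 H2) (U J : Type)
    (s : seq U) (S : U -> bop H1) (T : U -> bop H2) (idx : seq J) (a : J -> H1) (b : J -> H2) :
  (\sum_(u <- s) op_tensor HT (S u) (T u)) (tens HT [seq (a j, b j) | j <- idx]) =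
  tens HT [seq (S q.1 (a q.2), T q.1 (b q.2)) | q <- [seq (u, j) | u <- s, j <- idx]].
Proof.
rewrite bop_sumE [in RHS]/tens big_map big_allpairs; apply: eq_bigr => u _.
by rewrite op_tensor_tens /tens !big_map.
Qed.

End tensor_gram.

(** * Dilating countably many representations at once *)

(** Representations of [X] and [D] with a distinguished vector of the algebraic
    tensor product of the spaces. *)
Record witness (R : realType) (X D : cstarAlgType R) := Witness {
  wH1 : hilbertType R;
  wH2 : hilbertType R;
  wHT : hilbert_tensor wH1 wH2;
  wpi : X -> bop wH1;
  wsigma : D -> bop wH2;
  wpi_hom : star_hom wpi;
  wsigma_hom : star_hom wsigma;
  wl : seq (wH1 * wH2)
}.

Section common_dilation.
Variables (R : realType) (Y X D : cstarAlgType R) (c phi : Y -> X).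
Hypotheses (c_linear : linear c) (phi_linear : linear phi).
Hypothesis c_gram : forall y z,
  c (star y ** z) = star (c y) ** c z + star (phi y) ** phi z.
Hypothesis c_star : forall y, c (star y) = star (c y).
Hypotheses (sepX : separable_space X) (sepD : separable_space D).
Variable w : nat -> witness X D.

Let F1 (i : nat * bool) : hilbertType R := wH1 (w i.1).
Let F2 (n : nat) : hilbertType R := wH2 (w n).

Let single1 n b (a : wH1 (w n)) : dsum F1 := @single _ _ F1 (n, b) a.
Let single2 n (a : wH2 (w n)) : dsum F2 := @single _ _ F2 n a.

Let vecs (k : nat * nat) : wH1 (w k.1) * wH2 (w k.1) := nth (0, 0) (wl (w k.1)) k.2.
Let u k := (vecs k).1.
Let v k := (vecs k).2.

Let xi1 k : dsum F1 := single1 false (u k).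
Let v1 k y : dsum F1 :=
  single1 false (wpi (w k.1) (c y) (u k)) + single1 true (wpi (w k.1) (phi y) (u k)).
Let xi2 k : dsum F2 := single2 (v k).
Let v2 k d : dsum F2 := single2 (wsigma (w k.1) d (v k)).

Let inner1 n b (a a' : wH1 (w n)) : inner (single1 b a) (single1 b a') = inner a a'.
Proof. exact: inner_single_eq. Qed.
Let inner1_neq n b m b' (a : wH1 (w n)) (a' : wH1 (w m)) :
  (n, b) != (m, b') -> inner (single1 b a) (single1 b' a') = 0.
Proof. exact: inner_single_neq. Qed.
Let inner2 n (a a' : wH2 (w n)) : inner (single2 a) (single2 a') = inner a a'.
Proof. exact: inner_single_eq. Qed.
Let inner2_neq n m (a : wH2 (w n)) (a' : wH2 (w m)) :
  n != m -> inner (single2 a) (single2 a') = 0.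
Proof. exact: inner_single_neq. Qed.

Let single1_linear n b : linear (@single1 n b).
Proof. exact: (@single_linear _ _ F1 (n, b)). Qed.
Let single2_linear n : linear (@single2 n).
Proof. exact: (@single_linear _ _ F2 n). Qed.

Let v1_linear k : linear (v1 k).
Proof.
move=> d y z; rewrite /v1; have [pl _ _] := wpi_hom (w k.1).
rewrite c_linear phi_linear !pl.
have e (S T : bop (wH1 (w k.1))) a : (d *: S + T) a = d *: S a + T a by [].
by rewrite !e !single1_linear scalerDr addrACA.
Qed.

Let v2_linear k : linear (v2 k).
Proof.
move=> d y z; rewrite /v2; have [pl _ _] := wsigma_hom (w k.1).
by rewrite pl -single2_linear.
Qed.

Let v1_inner n j j' y z : inner (v1 (n, j) y) (v1 (n, j') z) =
  inner (wpi (w n) (c y) (u (n, j))) (wpi (w n) (c z) (u (n, j'))) +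
  inner (wpi (w n) (phi y) (u (n, j))) (wpi (w n) (phi z) (u (n, j'))).
Proof.
rewrite /v1 innerDl !innerDr !inner1 !inner1_neq ?addr0 ?add0r //.
  by rewrite xpair_eqE eqxx.
by rewrite xpair_eqE eqxx.
Qed.

Let v1_gram k l y z : inner (v1 k y) (v1 l z) = inner (xi1 k) (v1 l (star y ** z)).
Proof.
case: k l => [n j] [m j']; have [e|nm] := eqVneq n m; last first.
  rewrite /v1 /xi1 innerDl !innerDr !inner1_neq ?addr0 //;
  by rewrite xpair_eqE (negbTE nm).
case: _ / e; rewrite v1_inner /v1 /xi1 innerDr inner1 inner1_neq ?addr0; last first.
  by rewrite xpair_eqE eqxx.
have pih := wpi_hom (w n); have [_ pM pS] := pih.
rewrite c_gram (star_homD pih) -[(_ + _ : bop _) _]/(_ _ + _ _) innerDr.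
by rewrite !pM !pS !adjointE.
Qed.

Let v1_xi k l y : inner (v1 k y) (xi1 l) = inner (xi1 k) (v1 l (star y)).
Proof.
case: k l => [n j] [m j']; have [e|nm] := eqVneq n m; last first.
  rewrite /v1 /xi1 innerDl !innerDr !inner1_neq ?addr0 //;
  by rewrite xpair_eqE (negbTE nm).
case: _ / e; rewrite /v1 /xi1 innerDl innerDr !inner1 !inner1_neq ?addr0;
  try by rewrite xpair_eqE eqxx.
by have [_ _ pS] := wpi_hom (w n); rewrite c_star pS adjointE.
Qed.

Let v2_gram k l y z : inner (v2 k y) (v2 l z) = inner (xi2 k) (v2 l (star y ** z)).
Proof.
case: k l => [n j] [m j']; have [e|nm] := eqVneq n m; last first.
  by rewrite /v2 /xi2 !inner2_neq.
case: _ / e; rewrite /v2 /xi2 !inner2.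
by have [_ sM sS] := wsigma_hom (w n); rewrite sM sS adjointE.
Qed.

Let v2_xi k l y : inner (v2 k y) (xi2 l) = inner (xi2 k) (v2 l (star y)).
Proof.
case: k l => [n j] [m j']; have [e|nm] := eqVneq n m; last first.
  by rewrite /v2 /xi2 !inner2_neq.
case: _ / e; rewrite /v2 /xi2 !inner2.
by have [_ _ sS] := wsigma_hom (w n); rewrite sS adjointE.
Qed.

(** It suffices to see the orbit of [a] under a dense subset of [Z]. *)
Let orbit_closed (Z : cstarAlgType R) (H V : hilbertType R) (rho : Z -> bop H)
    (f : H -> V) (P : set V) (a : H) : star_hom rho -> linear f ->
    (forall b, nrm (f b) = nrm b) -> nrm_closed P ->
  nrm_closed [set z | P (f (rho z a))].
Proof.
move=> rh fl fn Pc; apply: (nrm_closed_preimage (k := nrm a)) Pc => z z'.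
have -> : f (rho z a) - f (rho z' a) = f (rho (z - z') a).
  rewrite (star_homB rh) -[(_ - _ : bop _) a]/(rho z a - rho z' a).
  have := fl (-1) (rho z' a) (rho z a); rewrite !scaleN1r => fE.
  by rewrite [in RHS]addrC fE addrC.
rewrite fn (le_trans (le_opnorm _ _)) // mulrC ler_wpM2l ?nrm_ge0 //.
exact: star_hom_contractive.
Qed.

(** The first space lies in the direct sum of two copies of each [wH1 (w n)]
    and is spanned by the vectors [v1 k y], where [k = (n, j)] stands for the
    [j]-th vector of the [n]-th witness.  The second copy holds the defect
    [phi] and accounts for the inequality. *)
Lemma common_dilation :
  exists (W1 W2 : hilbertType R) (HT : hilbert_tensor W1 W2)
    (pi : Y -> bop W1) (nu : D -> bop W2),
    [/\ separable_space W1, separable_space W2, star_hom pi, star_hom nu &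
      forall n, exists zeta : HT, nrm zeta = nrm (tens (wHT (w n)) (wl (w n))) /\
        forall us : seq (Y * D),
          nrm ((\sum_(a <- us) op_tensor (wHT (w n)) (wpi (w n) (c a.1)) (wsigma (w n) a.2))
            (tens (wHT (w n)) (wl (w n)))) <=
          nrm ((\sum_(a <- us) op_tensor HT (pi a.1) (nu a.2)) zeta)].
Proof.
have [dX dXP] := separable_enum sepX; have [dD dDP] := separable_enum sepD.
pose g1 (q : nat * nat * bool * option nat) : dsum F1 := single1 q.1.2
  (if q.2 is Some m then wpi (w q.1.1.1) (dX m) (u q.1.1) else u q.1.1).
pose g2 (q : nat * nat * option nat) : dsum F2 := single2
  (if q.2 is Some m then wsigma (w q.1.1) (dD m) (v q.1) else v q.1).
have g1P k b e : cspan (range g1) (single1 b (wpi (w k.1) e (u k))).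
  move: e; apply: dXP => [|m].
    apply: (@orbit_closed X _ (dsum F1) _ (@single1 k.1 b) _ (u k) (wpi_hom _)
      (@single1_linear _ _) _ (@cspan_closed _ _ _)) => a.
    exact: nrm_single.
  by apply: cspan_gen; exists (k, b, Some m).
have g2P k d : cspan (range g2) (single2 (wsigma (w k.1) d (v k))).
  move: d; apply: dDP => [|m].
    apply: (@orbit_closed D _ (dsum F2) _ (@single2 k.1) _ (v k) (wsigma_hom _)
      (@single2_linear _) _ (@cspan_closed _ _ _)) => a.
    exact: nrm_single.
  by apply: cspan_gen; exists (k, Some m).
have [||W1 [pi [j1 [sW1 pih j1g j1w]]]] :=
    separable_representation v1_linear v1_gram v1_xi (g := g1).
- by move=> k; apply: cspan_gen; exists (k, false, None).
- by move=> k y; apply: subspaceD (cspan_subspace _) _ _; exact: g1P.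
have [||W2 [nu [j2 [sW2 nuh j2g j2w]]]] :=
    separable_representation v2_linear v2_gram v2_xi (g := g2).
- by move=> k; apply: cspan_gen; exists (k, None).
- by move=> k y; exact: g2P.
have [HT] := hilbert_tensor_exists W1 sW2.
exists W1, W2, HT, pi, nu; split=> // n.
set l := wl (w n); pose idx := iota 0 (size l).
pose un j : wH1 (w n) := u (n, j); pose vn j : wH2 (w n) := v (n, j).
have lE : l = [seq (un j, vn j) | j <- idx].
  rewrite -[LHS](mkseq_nth (0, 0)) /mkseq; apply: eq_map => j.
  by rewrite /un /vn /u /v /vecs -surjective_pairing.
exists (tens HT [seq (j1 (n, j), j2 (n, j)) | j <- idx]); split.
  apply/eqP; rewrite -(@eqrXn2 _ 2 (nrm _)) ?nrm_ge0 //; apply/eqP.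
  (* The distinguished vector has no component in the second copies. *)
  rewrite -/l lE (@nrm_tens_gram _ _ _ _ _ HT (wHT (w n)) _ idx _ _ un (fun=> 0) vn).
  - rewrite [X in _ + X](_ : _ = 0) ?addr0 //.
    have -> : tens (wHT (w n)) [seq (0, vn q) | q <- idx] = 0.
      rewrite /tens big_map big1 // => j _.
      by have := tensZl (wHT (w n)) 0 0 (vn j); rewrite !scale0r.
    by rewrite nrm0 expr0n.
  - by move=> p q; rewrite j1g inner0l addr0; exact: inner1.
  - by move=> p q; rewrite j2g; exact: inner2.
move=> us; rewrite -(@ler_pXn2r _ 2) ?nnegrE ?nrm_ge0 // -/l lE !sum_op_tensor.
rewrite (@nrm_tens_gram _ _ _ _ _ HT (wHT (w n)) _ _ _ _
  (fun q => wpi (w n) (c q.1.1) (un q.2)) (fun q => wpi (w n) (phi q.1.1) (un q.2))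
  (fun q => wsigma (w n) q.1.2 (vn q.2))).
- by rewrite lerDl sqr_ge0.
- by move=> p q; rewrite j1w; exact: v1_inner.
- by move=> p q; rewrite j2w; exact: inner2.
Qed.

End common_dilation.

Section semi_invertible_bound.
Variables (R : realType) (A B D : cstarAlgType R) (theta : mx2_iso B).
Variables (E E' Y : extension B A).
Hypotheses (sepE : separable_space E) (sepD : separable_space D).
Hypothesis EY : is_direct_sum theta E E' Y.
Hypothesis Ysplit : asymptotically_split Y.

(** The asymptotic representation is [pi \o s], where [pi] is the dilation of
    the representations that witness the norms of the lifts at integer
    times. *)
Lemma le_norm_lambda (ED : min_tensor E D) (x : atensor A D) (L : R) :
  L < norm_E ED x -> (L%:E <= norm_lambda x)%E.
Proof.
move=> Lx; have [s s_hom s_lift] := Ysplit.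
have [c [g [c_lin g_lin c_lift c_gram c_star]]] := direct_sum_compression EY.
have [il iM iS] := ext_i_hom E; have [pl _ _] := ext_p_hom E.
pose phi y := ext_i E (g y).
have phi_lin : linear phi by move=> d y z; rewrite /phi g_lin il.
have phi_gram y z : c (star y ** z) = star (c y) ** c z + star (phi y) ** phi z.
  by rewrite c_gram iM iS.
pose ys n := [seq (s n%:R a.1, a.2) | a <- repr x].
(* The lift of [x] to [E] at time [n]. *)
pose z n : atensor E D := \pi_(atensor E D) [seq (c a.1, a.2) | a <- ys n].
have zx n : atensor_map (@ext_p _ _ _ E) (z n) = x.
  rewrite atensor_map_pi // -[RHS]reprK; congr (\pi_(atensor A D) _).
  rewrite -!map_comp -[RHS]map_id; apply: eq_map => -[a d] /=.
  by rewrite c_lift s_lift ?ler0n.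
have wex n : exists w : witness E D, 0 <= L -> L * nrm (tens (wHT w) (wl w)) <
    nrm ((\sum_(a <- ys n) op_tensor (wHT w) (wpi w (c a.1)) (wsigma w a.2))
      (tens (wHT w) (wl w))).
  have /min_norm_witness : (L%:E < min_norm (z n))%E.
    by apply: lt_le_trans (norm_E_le_min_norm ED (zx n)); rewrite lte_fin.
  move=> [H1 [H2 [HT [pi [sigma [l [pih sigmah]]]]]]] Ll.
  exists (Witness HT pih sigmah l); move: Ll.
  have [pil _ _] := pih; have [sl _ _] := sigmah.
  rewrite /z tsum_pi ?big_map //.
    by move=> d k a b; rewrite pil op_tensor_linearl.
  by move=> a k d d'; rewrite sl op_tensor_linearr.
have [w wP] := choice wex.
have [W1 [W2 [HT [pi [nu [sW1 sW2 pih nuh zetaP]]]]]] :=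
  common_dilation c_lin phi_lin phi_gram c_star sepE sepD w.
pose f t := tsum (fun a d => op_tensor HT (pi (s t a)) (nu d)) x.
apply: (@le_trans _ _ (cb_mod_c0_norm f)); last first.
  apply: ereal_sup_ubound; exists W1, W2, HT, (fun t a => pi (s t a)), nu.
  by split=> //; exact: asymptotic_hom_comp.
apply: le_cb_mod_c0_norm => n.
have [L0|L0] := ltP L 0; first by rewrite (le_trans (ltW L0)) ?nrm_ge0.
have [zeta [zl /(_ (ys n)) zT]] := zetaP n.
have := lt_le_trans (wP n L0) zT; rewrite -zl.
have -> : \sum_(a <- ys n) op_tensor HT (pi a.1) (nu a.2) = f n%:R.
  by rewrite /f /tsum /ys big_map.
move=> /lt_le_trans/(_ (le_opnorm _ _)) Lz.
have z0 : 0 < nrm zeta.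
  rewrite lt_neqAle nrm_ge0 andbT eq_sym; apply/eqP => z0.
  by move: Lz; rewrite z0 !mulr0 ltxx.
by move: Lz; rewrite ltr_pM2r // => /ltW.
Qed.

End semi_invertible_bound.

Theorem proposition2p3 (R : realType) (A B : cstarAlgType R)
    (theta : mx2_iso B) (E : extension B A)
    (sepA : separable_space A) (sepB : separable_space B)
    (sepE : separable_space E) (stB : stable B) :
  (exists (D : cstarAlgType R) (ED : min_tensor E D) (x : atensor A D),
     separable_space D /\ (norm_lambda x < (norm_E ED x)%:E)%E) ->
  ~ semi_invertible theta E.
Proof.
move=> [D [ED [x [sepD xlt]]]] [E' [Y [EY Ysplit]]].
have le L : L < norm_E ED x -> (L%:E <= norm_lambda x)%E by exact: le_norm_lambda EY Ysplit _ _ _.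
move: xlt le; case: (norm_lambda x) => [r||]; rewrite ?lte_fin.
- move=> rx /(_ ((r + norm_E ED x) / 2)).
  rewrite lee_fin ltr_pdivrMr // ler_pdivrMr //; have := rx.
  by move=> rx' /(_ ltac:(lra)); lra.
- by rewrite ltNge leey.
- by move=> _ /(_ (norm_E ED x - 1)); rewrite gtrBl ltr01 leeNy_eq => /(_ isT).
Qed.
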